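(* Let $V=\mathbb{C}^{n_1}\otimes\cdots\otimes\mathbb{C}^{n_p}$, let $X\subseteq V$ be the cone over the variety of rank-one tensors and $X^*$ its dual variety. Let $\mathrm{DL}_1=X$ and $\mathrm{DL}_r=\mathrm{DL}_{X^*\cap\mathrm{DL}_{r-1}}$ for $r\ge2$. Then for every $r\geq 1$: (a) $\mathrm{DL}_r\subseteq\mathrm{DL}_{r+1}$; (b) any $T\in\mathrm{DL}_r$ has border rank at most $r$; (c) $\mathrm{DL}_r$ contains all rank at most $r$ weakly orthogonally decomposable tensors.
   Context: $X\subseteq V$ is the variety of tensors of the form $x_1\otimes\cdots\otimes x_p$ (rank at most one). Fix inner products $\langle\cdot,\cdot\rangle_i$ on $\mathbb{R}^{n_i}$, extended to complex bilinear forms on $\mathbb{C}^{n_i}$. The Bombieri-Weyl form on $V$ is the bilinear form determined by $\langle x_1\otimes\cdots\otimes x_p,\,y_1\otimes\cdots\otimes y_p\rangle_{BW}=\prod_{i}\langle x_i,y_i\rangle_i$ and linearity. Orthogonality ($\perp$) is with respect to these bilinear forms. For a variety $Y\subseteq V$ let $Y_{reg}$ be its set of regular points and, for $x\in Y_{reg}$, let $N_xY=(T_xY)^\perp$. The conormal variety is $\operatorname{Con}(Y)=\overline{\{(x,y)\in V\times V\mid x\in Y_{reg},\ y\in N_xY\}}$, and the dual variety is $Y^*=\overline{\pi_2(\operatorname{Con}(Y))}\subseteq V$. The joint ED correspondence $\mathcal{E}_{X^*,X}$ is the closure of $\{(y,x,T)\mid (y,x)\in\operatorname{Con}(X^* ),\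 T=x+y\}\subseteq V\times V\times V$, with $\pi_3$ the projection to the last factor. For a subvariety $A\subseteq X^*$ its data locus is $\mathrm{DL}_A=\overline{\pi_3(\mathcal{E}_{X^*,X}\cap(A\times V\times V))}$. A tensor has border rank at most $r$ if it is a limit of tensors of rank at most $r$. A tensor $T\in V$ is weakly orthogonally decomposable if $T=\sum_{i=1}^m x_1^i\otimes\cdots\otimes x_p^i$ with all $x_j^i\in\mathbb{C}^{n_j}$ nonzero and $x_j^k\perp x_j^l$ for all $k\ne l$ and all $1\le j\le p$ (isotropic vectors allowed). ''Weakly orthogonally decomposable of rank at most $r$'' means that $T$ admits such a decomposition with $m\le r$ terms. *)

(* Defs.v *)
From HB Require Import structures.
From mathcomp Require Import all_boot all_order all_algebra.
From mathcomp Require Import complex.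
From mathcomp Require Import boolp classical_sets reals topology normedtype.
From mathcomp Require Import sequences.
(* Not imported: the notations of mpoly conflict with those of topology. *)
From mathcomp Require mpoly.

Set Implicit Arguments.
Unset Strict Implicit.
Unset Printing Implicit Defensive.

Import Order.TTheory GRing.Theory Num.Theory.
Import numFieldNormedType.Exports.

Local Open Scope ring_scope.
Local Open Scope complex_scope.
Local Open Scope classical_set_scope.

(** * Affine algebraic geometry in a finite-dimensional vector space *)

Section AffineVarieties.
Variables (K : closedFieldType) (W : vectType K).

(* Polynomial functions on W are polynomials in the coordinates with respect to
   the basis vbasis fullv; none of the notions below depends on the choice of
   basis. *)
Definition poly_on := mpoly.mpoly (\dim (fullv : {vspace W})) K.

Definition zcoord (j : 'I_(\dim (fullv : {vspace W}))) (x : W) : K :=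
  coord (vbasis fullv) j x.

Definition peval (f : poly_on) (x : W) : K :=
  mpoly.meval (fun j => zcoord j x) f.

Definition vanishing_ideal (S : set W) : set poly_on :=
  [set f | forall x, S x -> peval f x = 0].

Definition zclosure (S : set W) : set W :=
  [set x | forall f, vanishing_ideal S f -> peval f x = 0].

Definition zclosed (S : set W) : Prop := zclosure S `<=` S.

Definition zirreducible (Z : set W) : Prop :=
  [/\ zclosed Z, Z !=set0 &
      forall A B : set W, zclosed A -> zclosed B ->
        Z `<=` A `|` B -> Z `<=` A \/ Z `<=` B].

(* Chains Z 0 < Z 1 < ... < Z d of irreducible closed subsets of Y through x,
   i.e. chains of prime ideals in the local ring of Y at x. *)
Definition irr_chain (Y : set W) (x : W) (d : nat) (Z : nat -> set W) : Prop :=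
  (forall k, (k <= d)%N -> [/\ zirreducible (Z k), Z k x & Z k `<=` Y]) /\
  (forall k, (k < d)%N -> Z k `<` Z k.+1).

(* The Krull dimension of the local ring of Y at x is d. *)
Definition local_dim (Y : set W) (x : W) (d : nat) : Prop :=
  (exists Z, irr_chain Y x d Z) /\
  (forall e Z, irr_chain Y x e Z -> (e <= d)%N).

Definition tangent (Y : set W) (x : W) : set W :=
  [set v | forall f, vanishing_ideal Y f ->
     \sum_j peval (mpoly.mderiv j f) x * zcoord j v = 0].

(* The local ring of Y at x is a regular local ring: the Zariski tangent space
   has dimension dim_x Y. *)
Definition regular_point (Y : set W) (x : W) : Prop :=
  Y x /\ exists U : {vspace W},
    (forall v, v \in U <-> tangent Y x v) /\ local_dim Y x (\dim U).

End AffineVarieties.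

(** * Conormal varieties, dual varieties and data loci *)

Section Duality.
Variables (K : closedFieldType) (V : vectType K) (B : V -> V -> K).

Definition normal_space (Y : set V) (x : V) : set V :=
  [set y | forall v, tangent Y x v -> B v y = 0].

Definition conormal (Y : set V) : set (V * V) :=
  zclosure [set xy : V * V |
    regular_point Y xy.1 /\ normal_space Y xy.1 xy.2].

Definition dual_variety (Y : set V) : set V :=
  zclosure [set y | exists x, conormal Y (x, y)].

(* The triples (y, x, T) with (y, x) in the conormal variety of
   the dual of X and T = x + y. *)
Definition joint_ED (X : set V) : set (V * V * V) :=
  zclosure [set yxT : V * V * V |
    conormal (dual_variety X) yxT.1 /\ yxT.2 = yxT.1.2 + yxT.1.1].

Definition data_locus (X A : set V) : set V :=
  zclosure [set T | exists y x, joint_ED X (y, x, T) /\ A y].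

(* DL_1 = X, and DL_r is the data locus of the intersection of DL_(r-1)
   with the dual of X for r >= 2; the
   value at r = 0 is irrelevant. *)
Definition iterated_data_locus (X : set V) (r : nat) : set V :=
  iter r.-1 (fun D => data_locus X (dual_variety X `&` D)) X.

End Duality.

(** * Tensors *)

Section Tensors.
Variables (R : realType) (p : nat) (n : 'I_p -> nat).

(* A tensor is the array of its coordinates in the basis of tensor products of
   standard basis vectors, indexed by multi-indices. *)
Definition multi_index := {dffun forall i : 'I_p, 'I_(n i)}.

Definition tensor := {ffun multi_index -> R[i]^o}.

HB.instance Definition _ := Vector.on tensor.

Definition vectors := forall i : 'I_p, 'rV[R[i]]_(n i).

Definition rank1 (x : vectors) : tensor :=
  [ffun a : multi_index => \prod_i x i 0 (a i)].

Definition segre_cone : set tensor := [set T | exists x, T = rank1 x].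

Definition rank_le (r : nat) (T : tensor) : Prop :=
  exists2 m, (m <= r)%N &
    exists x : 'I_m -> vectors, T = \sum_(k < m) rank1 (x k).

Definition border_rank_le (r : nat) (T : tensor) : Prop :=
  exists S : nat -> tensor,
    (forall k, rank_le r (S k)) /\
    (forall a, S k a @[k --> \oo] --> T a).

Variable ip : forall i : 'I_p, {dot 'rV[R]_(n i) for idfun}.

(* The complex bilinear (not sesquilinear) extension of ip i. *)
Definition cdot (i : 'I_p) (x y : 'rV[R[i]]_(n i)) : R[i] :=
  \sum_k \sum_l x 0 k * y 0 l * (ip i 'e_k 'e_l)%:C.

Lemma cdot_real i (x y : 'rV[R]_(n i)) :
  cdot (map_mx (real_complex R) x) (map_mx (real_complex R) y) =
    (ip i x y)%:C.
Proof.
rewrite {2}(row_sum_delta x) {2}(row_sum_delta y) linear_sumlz rmorph_sum.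
apply: eq_bigr => k _; rewrite linear_sumr rmorph_sum; apply: eq_bigr => l _.
by rewrite linearZl_LR linearZr_LR /= !mxE mulrA !rmorphM.
Qed.

Definition BW (T S : tensor) : R[i] :=
  \sum_a \sum_b T a * S b * \prod_i (ip i 'e_(a i) 'e_(b i))%:C.

Lemma prod_sum_multi_index (F : forall i : 'I_p, 'I_(n i) -> R[i]) :
  \prod_i \sum_k F i k = \sum_(a : multi_index) \prod_i F i (a i).
Proof.
pose P i := [ffun k => F i k].
have tagE i : \sum_k F i k =
    \sum_(j in tagged_with (fun i => 'I_(n i)) i) untag 0 (P i) j.
  by rewrite -(big_tag (fun i => P i)); apply: eq_bigr => k _; rewrite ffunE.
rewrite (eq_bigr _ (fun i _ => tagE i)) bigA_distr_big_dep.
rewrite [RHS](reindex _ (onW_bij _ (dffun_of_fprod_bij _))) /=.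
rewrite -(big_fprod _ _ P); apply: eq_bigr => t _.
by apply: eq_bigr => i _; rewrite !ffunE.
Qed.

Lemma BW_rank1 (x y : vectors) :
  BW (rank1 x) (rank1 y) = \prod_i cdot (x i) (y i).
Proof.
rewrite /cdot prod_sum_multi_index; apply: eq_bigr => a _.
rewrite prod_sum_multi_index; apply: eq_bigr => b _.
by rewrite !ffunE -!big_split.
Qed.

Definition weakly_odeco_rank_le (r : nat) (T : tensor) : Prop :=
  exists2 m, (m <= r)%N &
    exists x : 'I_m -> vectors,
      [/\ forall k j, x k j != 0,
          forall k l j, k != l -> cdot (x k j) (x l j) = 0 &
          T = \sum_(k < m) rank1 (x k)].

Definition DL (r : nat) : set tensor := iterated_data_locus BW segre_cone r.

End Tensors.

(* Main.v *)
From HB Require Import structures.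
From mathcomp Require Import all_boot all_order all_algebra.
From mathcomp Require Import complex mpoly ring.
From mathcomp Require Import boolp classical_sets reals.
From mathcomp Require topology normedtype sequences.
Require Import Defs.

(** Write X for the cone of rank-one tensors and X' for its dual variety. A
    conormal pair of a variety Y is an element (x, y) of its conormal variety.

    Parametrization. If <x_i, xi_i> is nonzero for all i, there is, up to a
    scalar, a projector onto the normal space of X at [rank1 x] which is
    polynomial in x and xi ([normal_proj]). So the conormal pairs of X at tensors
    with nonzero factors are among the values of a polynomial map
    ([conormal_par]). At a generic parameter of any polynomial map, the value is
    a regular point of the closure of the image, and the tangent space there is
    the image of the differential ([generic_regular]; the proof compares Krull
    dimension, rank of the Jacobian matrix and transcendence degree). It follows
    that the conormal variety of X and X' are the closures of the images of
    polynomial maps ([conormal_segre], [dual_segre]). For the parametrization of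
    X', this also gives one half of biduality ([conormal_dual_par]): if (x, y) is
    a conormal pair of X, then (y, x) is one of X', because <x, y> = 0 remains
    true along curves of conormal pairs.

    Part (a). The pair (0, [rank1 x]) is a conormal pair of X', and 0 lies in X
    and in X', so [rank1 x] is in DL_2. Induction does the rest, since data loci
    are monotone.

    Part (c). Let T be the sum of m + 1 rank-one terms, y the sum of the first m
    of them and [rank1 x] the last one. If p >= 2, then y is orthogonal to all
    tensors that have all factors but one in common with x, since each term of y
    still meets an orthogonal factor. So (y, [rank1 x]) is a conormal pair of X'.
    As y is in DL_m by induction, T is in DL_(m+1). If p = 1, then T has rank at
    most one.

    Part (b). The other half of biduality is needed: if (y, z) is a conormal pair
    of X', then z is in X ([conormal_dual_segre]). Then DL_(r+1) is the closure of
    a set of sums z + y with z in X and y in DL_r, so DL_r is contained in the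
    Zariski closure of the set of tensors of rank at most r ([DL_rank_le]).

    To prove this half, note that a normal vector of X' at y is the gradient at y
    of a function f that vanishes on X' ([tangent_annihilator]). The Hamiltonian
    vector field of f, seen as a function of the second component, is
    (grad f(y), 0); it is tangent to the conormal variety of X
    ([hamiltonian_tangent]), so its flow, which translates x by multiples of
    grad f(y), preserves this variety ([hamiltonian_flow]). Hence x + t grad f(y)
    is in X for all t and all conormal pairs (x, y), and so is grad f(y), because
    X is a closed cone.

    It remains to pass from the Zariski closure of the set of tensors of rank at
    most r, which is the image of a polynomial map, to limits of such tensors
    ([closure_approx]). A point of the closure is moved along a line in general
    position, after a Noether normalization: the roots of a monic polynomial
    depend continuously on the coefficients, and a nonempty open subset of the
    closure is contained in the image ([image_contains_open]). *)

Set Implicit Arguments.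
Unset Strict Implicit.
Unset Printing Implicit Defensive.

Import Order.TTheory GRing.Theory Num.Theory.

Local Open Scope ring_scope.
Local Open Scope classical_set_scope.

(** * Substitution in multivariate polynomials *)

Section Substitution.

Lemma mpoly_rmorph_ext (n : nat) (R S : comNzRingType)
    (phi psi : {rmorphism {mpoly R[n]} -> S}) :
  (forall c, phi c%:MP = psi c%:MP) -> (forall i, phi 'X_i = psi 'X_i) ->
  phi =1 psi.
Proof.
move=> eqC eqX F; rewrite [F]mpolyE !rmorph_sum; apply: eq_bigr => m _.
rewrite -mul_mpolyC !rmorphM /= eqC mpolyXE_id !rmorph_prod; congr (_ * _).
by apply: eq_bigr => i _; rewrite !rmorphXn /= eqX.
Qed.

(** The chain rule: both sides are derivations along phi that agree on constants
    and variables. *)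
Lemma mpoly_derivation (n : nat) (R S : comNzRingType)
    (phi : {rmorphism {mpoly R[n]} -> S}) (D : {additive {mpoly R[n]} -> S}) :
  (forall c, D c%:MP = 0) ->
  (forall p q, D (p * q) = D p * phi q + phi p * D q) ->
  forall F, D F = \sum_i phi (F^`M(i)) * D 'X_i.
Proof.
move=> DC DM.
have D1 : D 1 = 0 by rewrite -[1]/(mpolyC n 1) DC.
pose good F := D F = \sum_i phi (F^`M(i)) * D 'X_i.
have goodM p q : good p -> good q -> good (p * q).
  rewrite /good DM => -> ->.
  under [RHS]eq_bigr do rewrite mderivM rmorphD !rmorphM /= mulrDl.
  rewrite big_split /= mulr_suml mulr_sumr; congr (_ + _).
    by apply: eq_bigr => i _; rewrite mulrAC.
  by apply: eq_bigr => i _; rewrite mulrA.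
have goodC c : good c%:MP.
  rewrite /good DC big1 // => i _; by rewrite mderivC rmorph0 mul0r.
have goodX i : good 'X_i.
  rewrite /good (bigD1 i) //= big1 ?addr0 => [|j ji]; last first.
    rewrite mderivX mnm1E eq_sym (negbTE ji) scale0r rmorph0 mul0r //.
  rewrite mderivX mnm1E eqxx scale1r.
  have -> : (U_(i) - U_(i))%MM = 0%MM :> 'X_{1..n}.
    by apply/mnmP => k; rewrite mnmBE mnm0E subnn.
  by rewrite mpolyX0 rmorph1 mul1r.
have good1 : good 1 by exact: (goodC 1).
have goodXn i k : good ('X_i ^+ k).
  elim: k => [|k IHk]; first by rewrite expr0.
  by rewrite exprS; apply/goodM.
move=> F; suff : good F by [].
rewrite [F]mpolyE; apply: big_ind => [|p q|m _].
- by have := goodC 0; rewrite mpolyC0.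
- rewrite /good raddfD /= => -> ->; rewrite -big_split; apply: eq_bigr => i _.
  by rewrite mderivD rmorphD mulrDl.
rewrite -mul_mpolyC mpolyXE_id; apply/goodM => //.
by apply: (big_ind good good1 goodM) => i _; apply: goodXn.
Qed.

End Substitution.

Section Extension.
Variables (m : nat).

(** The family f followed by b; b has index [ord_max], the position of the main
    variable of [muni]. *)
Definition fext (T : Type) (f : 'I_m -> T) (b : T) (i : 'I_m.+1) : T :=
  oapp f b (unlift ord_max i).

Lemma fext_max T (f : 'I_m -> T) b : fext f b ord_max = b.
Proof. by rewrite /fext unlift_none. Qed.

Lemma fext_lift T (f : 'I_m -> T) b i : fext f b (lift ord_max i) = f i.
Proof. by rewrite /fext liftK. Qed.

Lemma lift_max_widen (i : 'I_m) : lift ord_max i = widen_ord (leqnSn m) i.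
Proof. by apply: val_inj; rewrite /= /bump leqNgt ltn_ord. Qed.

Lemma fext_widen T (f : 'I_m -> T) b i : fext f b (widen_ord (leqnSn m) i) = f i.
Proof. by rewrite -lift_max_widen fext_lift. Qed.

Lemma fext_comp T U (h : T -> U) (f : 'I_m -> T) b :
  h \o fext f b =1 fext (h \o f) (h b).
Proof. by move=> i; rewrite /fext /=; case: unlift. Qed.

Lemma big_fext (R : nmodType) (G : 'I_m.+1 -> R) :
  \sum_i G i = \sum_i G (lift ord_max i) + G ord_max.
Proof.
rewrite big_ord_recr /=; congr (_ + _).
by apply: eq_bigr => i _; rewrite lift_max_widen.
Qed.

Variables (R S : comNzRingType) (phi : {rmorphism R -> S}).

Lemma muniX_lift (i : 'I_m) :
  muni ('X_(lift ord_max i) : {mpoly R[m.+1]}) = ('X_i)%:P.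
Proof.
rewrite muniE msuppX big_seq1 mcoeffX eqxx scale1r mnm1E.
rewrite (negbTE (_ : lift ord_max i != ord_max)) ?neq_lift //; last first.
  by rewrite eq_sym neq_lift.
rewrite expr0 alg_polyC; congr ('X_[_])%:P; apply/mnmP => j.
by rewrite mnmE !mnm1E lift_max_widen.
Qed.

Lemma muniX_max : muni ('X_ord_max : {mpoly R[m.+1]}) = 'X.
Proof.
rewrite muniE msuppX big_seq1 mcoeffX eqxx scale1r mnm1E eqxx expr1.
rewrite (_ : [multinom _ | _ < _] = 0%MM) ?mpolyX0 ?scale1r //.
by apply/mnmP => j; rewrite mnmE mnm1E mnm0E -lift_max_widen (negbTE (neq_lift _ _)).
Qed.

Lemma mmap_fext (f : 'I_m -> S) b (F : {mpoly R[m.+1]}) :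
  mmap phi (fext f b) F = (map_poly (mmap phi f) (muni F)).[b].
Proof.
pose psi : {rmorphism {mpoly R[m.+1]} -> S} :=
  (horner_eval b \o (map_poly (mmap phi f) \o @muni m R))%FUN.
apply: (mpoly_rmorph_ext (phi := mmap phi (fext f b)) (psi := psi)) => [c|i].
  by rewrite /= /horner_eval muniC map_polyC hornerC /= !mmapC.
rewrite /= mmapX mmap1U /horner_eval; case: (unliftP ord_max i) => [j|] ->.
  by rewrite fext_lift muniX_lift map_polyC hornerC /= mmapX mmap1U.
by rewrite fext_max muniX_max map_polyX hornerX.
Qed.

End Extension.

(** Hence univariate polynomials over multivariate ones can be specified freely
    and turned into multivariate polynomials. *)
Lemma muni_mmulti (m : nat) (R : comNzRingType) (P : {poly {mpoly R[m]}}) :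
  muni (mmulti P) = P.
Proof.
have muniW (F : {mpoly R[m]}) : muni (mwiden F) = F%:P.
  apply: (mpoly_rmorph_ext (phi := @muni m R \o @mwiden m R) (psi := polyC)).
    by move=> c; rewrite /= mwidenC muniC.
  by move=> i; rewrite /= mwidenX mnmwiden1 -lift_max_widen muniX_lift.
rewrite /mmulti rmorph_sum /= -[RHS]coefK poly_def; apply: eq_bigr => i _.
by rewrite rmorphM rmorphXn /= muniX_max muniW mul_polyC.
Qed.

Lemma muni_inj0 (m : nat) (R : comNzRingType) (F : {mpoly R[m.+1]}) :
  muni F = 0 -> F = 0.
Proof.
move=> F0; pose f (i : 'I_m) : {mpoly R[m.+1]} := 'X_(lift ord_max i).
have -> : F = mmap (@mpolyC m.+1 R) (fext f 'X_ord_max) F.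
  apply: (mpoly_rmorph_ext (phi := idfun)
    (psi := mmap (@mpolyC m.+1 R) (fext f 'X_ord_max))) => [c|i] /=.
    by rewrite mmapC.
  rewrite mmapX mmap1U; case: (unliftP ord_max i) => [j|] ->.
    by rewrite fext_lift.
  by rewrite fext_max.
by rewrite mmap_fext F0 rmorph0 horner0.
Qed.

Lemma muni_deriv (m : nat) (R : comNzRingType) (F : {mpoly R[m.+1]}) :
  muni (F^`M(ord_max)) = (muni F)^`().
Proof.
pose D : {additive {mpoly R[m.+1]} -> {poly {mpoly R[m]}}} :=
  (@deriv _ \o @muni m R)%FUN.
have -> : (muni F)^`() = D F by [].
rewrite (@mpoly_derivation _ _ _ (@muni m R) D) => [|c|p q]; last first.
- by rewrite /D /= muniM derivM.
- by rewrite /D /= muniC derivC.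
rewrite big_fext /= big1 ?add0r => [|i _].
  by rewrite muniX_max derivX mulr1.
by rewrite muniX_lift derivC mulr0.
Qed.

(** * Algebraic independence *)

Lemma poly_eq_horner (K : numClosedFieldType) (P Q : {poly K}) :
  (forall t, P.[t] = Q.[t]) -> P = Q.
Proof.
move=> eqPQ; apply/eqP; rewrite -subr_eq0; apply/eqP/eqP; apply: contraT => nz.
have := max_poly_roots nz (rs := [seq k%:R | k <- iota 0 (size (P - Q))]).
rewrite size_map size_iota ltnn => -> //.
  by apply/allP => _ /mapP[k _ ->]; rewrite /root hornerD hornerN eqPQ subrr.
by rewrite map_inj_uniq ?iota_uniq // => i1 i2 /eqP; rewrite eqr_nat => /eqP.
Qed.

Section AlgebraicIndependence.
Variables (K : numClosedFieldType).

Definition subst (m N : nat) (f : 'I_m -> {mpoly K[N]}) :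
  {mpoly K[m]} -> {mpoly K[N]} := mmap (@mpolyC N K) f.

HB.instance Definition _ m N f := GRing.RMorphism.on (@subst m N f).

Definition alg_indep (m N : nat) (f : 'I_m -> {mpoly K[N]}) : Prop :=
  forall F, subst f F = 0 -> F = 0.

Lemma substC m N (f : 'I_m -> {mpoly K[N]}) c : subst f c%:MP = c%:MP.
Proof. exact: mmapC. Qed.

Lemma substX m N (f : 'I_m -> {mpoly K[N]}) i : subst f 'X_i = f i.
Proof. by rewrite /subst mmapX mmap1U. Qed.

Lemma meval_subst m N (f : 'I_m -> {mpoly K[N]}) F u :
  (subst f F).@[u] = F.@[fun i => (f i).@[u]].
Proof.
apply: (mpoly_rmorph_ext (phi := meval u \o subst f)
  (psi := meval (fun i => (f i).@[u]))) => [c|i] /=.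
  by rewrite substC !mevalC.
by rewrite substX mevalXU.
Qed.

Lemma subst_comp k m N (f : 'I_m -> {mpoly K[N]}) (g : 'I_k -> {mpoly K[m]}) F :
  subst f (subst g F) = subst (fun i => subst f (g i)) F.
Proof.
apply: (mpoly_rmorph_ext (phi := subst f \o subst g)
  (psi := subst (fun i => subst f (g i)))) => [c|i] /=.
  by rewrite !substC.
by rewrite !substX.
Qed.

Lemma eq_subst m N (f g : 'I_m -> {mpoly K[N]}) : f =1 g -> subst f =1 subst g.
Proof. by move=> eq_fg F; congr subst; apply: funext. Qed.

Lemma subst_fext m N (f : 'I_m -> {mpoly K[N]}) b F :
  subst (fext f b) F = (map_poly (subst f) (muni F)).[b].
Proof. exact: (mmap_fext (@mpolyC N K)). Qed.

Lemma meval_fext m (q : 'I_m -> K) t (F : {mpoly K[m.+1]}) :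
  F.@[fext q t] = (map_poly (meval q) (muni F)).[t].
Proof. exact: (mmap_fext (@idfun K)). Qed.

Lemma subst_mderiv m N (f : 'I_m -> {mpoly K[N]}) F l :
  (subst f F)^`M(l) = \sum_i subst f (F^`M(i)) * (f i)^`M(l).
Proof.
pose D : {additive {mpoly K[m]} -> {mpoly K[N]}} :=
  (mderiv l \o subst f)%FUN.
rewrite -[LHS]/(D F) (@mpoly_derivation _ _ _ (subst f) D) => [|c|p q].
- by apply: eq_bigr => i _; rewrite /D /= substX.
- by rewrite /D /= substC mderivC.
by rewrite /D /= rmorphM mderivM.
Qed.

Lemma mpoly_eq_eval0 N (F : {mpoly K[N]}) : (forall u, F.@[u] = 0) -> F = 0.
Proof.
elim: N F => [|N IHN] F F0.
  have /= := F0 (fun=> 0); rewrite (nvar0_mpolyC F) mevalC => ->.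
  by rewrite mpolyC0.
apply: muni_inj0; apply/polyP => i; rewrite coef0; apply: IHN => q.
suff : map_poly (meval q) (muni F) = 0.
  by move/polyP/(_ i); rewrite coef_map coef0.
by apply: poly_eq_horner => t; rewrite horner0 -meval_fext F0.
Qed.

Lemma exists_eval_neq0 N (F : {mpoly K[N]}) : F != 0 -> exists u, F.@[u] != 0.
Proof.
move=> nzF; apply: contrapT => noF; move/eqP: nzF; apply.
apply: mpoly_eq_eval0 => u; apply/eqP; apply: contraT => nz.
by case: noF; exists u.
Qed.

Lemma msize_prod_exp N m (f : 'I_m -> {mpoly K[N]}) (a : 'I_m -> nat) d :
  (forall i, msize (f i) <= d.+1)%N ->
  (msize (\prod_i f i ^+ a i) <= ((\sum_i a i) * d).+1)%N.
Proof.
move=> le_fd.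
have leM e1 e2 (p q : {mpoly K[N]}) : (msize p <= e1.+1)%N ->
    (msize q <= e2.+1)%N -> (msize (p * q) <= (e1 + e2).+1)%N.
  have [->|nzp] := eqVneq p 0; first by rewrite mul0r msize0.
  have [->|nzq] := eqVneq q 0; first by rewrite mulr0 msize0.
  move=> lep leq; rewrite (msizeM nzp nzq).
  by move: lep leq; rewrite (mpolySpred _ nzp) (mpolySpred _ nzq) addSn /= addnS !ltnS;
     apply: leq_add.
rewrite big_distrl /=; elim/big_rec2: _ => [|i e p _ IHp]; first by rewrite msize1.
apply/leM => //; elim: (a i) => [|k IHk]; first by rewrite expr0 msize1.
by rewrite exprS mulSn; apply/leM.
Qed.

(** Polynomials of bounded degree in N variables span a space whose dimension
    grows like the N-th power of the degree, while m independent elements have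
    as many independent monomials as an m-th power. *)
Lemma alg_indep_leq m N (f : 'I_m -> {mpoly K[N]}) : alg_indep f -> (m <= N)%N.
Proof.
move=> ind_f; rewrite leqNgt; apply/negP => ltNm.
pose d := (\max_i msize (f i))%N.
have le_d i : (msize (f i) <= d.+1)%N.
  by apply: leqW; apply: (leq_bigmax (F := fun i => msize (f i))).
(* There are (k + 1)^m monomials with exponents at most k in the entries of f,
   and fewer monomials with exponents at most m k d in N variables. *)
pose k := ((m * d).+1 ^ N)%N; pose B := ((m * k) * d).+1.
pose mono (a : {ffun 'I_m -> 'I_k.+1}) : 'X_{1..m} := [multinom (a i : nat) | i < m].
pose cmono (b : {ffun 'I_N -> 'I_B}) : 'X_{1..N} := [multinom (b i : nat) | i < N].
have mono_inj : injective mono.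
  move=> a b /mnmP eq_ab; apply/ffunP => i; apply: val_inj.
  by have := eq_ab i; rewrite !mnmE.
pose I := {ffun 'I_m -> 'I_k.+1}; pose J := {ffun 'I_N -> 'I_B}.
have lt_card : (#|J| < #|I|)%N.
  rewrite !card_ffun !card_ord.
  apply: (@leq_trans (k.+1 ^ N.+1)); last by rewrite leq_exp2l // ltnS expn_gt0.
  apply: (@leq_ltn_trans (((m * d).+1 * k.+1) ^ N)).
    case: (N) => [|N']; first by rewrite !expn0.
    rewrite leq_exp2r // /B mulnAC mulSn mulnS.
    by rewrite -addn1 addnC leq_add // (leq_trans _ (leq_addl _ _)).
  by rewrite expnMn expnS ltn_mul2r expn_gt0 /= /k.
pose M : 'M[K]_(#|I|, #|J|) := \matrix_(i, j)
  (subst f 'X_[mono (enum_val i)])@_(cmono (enum_val j)).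
have: kermx M != 0.
  by rewrite kermx_eq0 /row_free neq_ltn (leq_ltn_trans (rank_leq_col M) lt_card).
case/rowV0Pn => v /sub_kermxP vM nzv.
pose F := \sum_i v 0 i *: 'X_[mono (enum_val i)] : {mpoly K[m]}.
have Fcoef i : F@_(mono (enum_val i)) = v 0 i.
  rewrite /F raddf_sum (bigD1 i) //= mcoeffZ mcoeffX eqxx mulr1 big1 ?addr0 //.
  move=> j ji; rewrite mcoeffZ mcoeffX (inj_eq mono_inj) (inj_eq enum_val_inj).
  by rewrite (negbTE ji) mulr0.
have F0 : F = 0; last first.
  case/eqP: nzv; apply/rowP => i; by rewrite -Fcoef F0 mcoeff0 mxE.
have substE i : subst f (v 0 i *: 'X_[mono (enum_val i)]) =
    v 0 i *: subst f 'X_[mono (enum_val i)].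
  by rewrite -mul_mpolyC rmorphM /= substC mul_mpolyC.
apply: ind_f; rewrite /F rmorph_sum /=; apply/mpolyP => mu.
rewrite mcoeff0 raddf_sum /=.
have [lt_mu|] := boolP [forall i, mu i < B]%N; last first.
  rewrite negb_forall => /existsP[l]; rewrite -leqNgt => ge_mu.
  apply: big1 => i _; rewrite substE mcoeffZ.
  apply/eqP; rewrite mulf_eq0; apply/orP; right; apply/eqP/memN_msupp_eq0.
  apply: msize_mdeg_ge; rewrite /subst mmapX.
  apply: (leq_trans (msize_prod_exp _ le_d)).
  have: (mu l <= mdeg mu)%N by rewrite mdegE (bigD1 l) //= leq_addr.
  move/(leq_trans ge_mu); apply: leq_trans; rewrite ltnS leq_mul2r.
  apply/orP; right.
  apply: (@leq_trans (\sum_(j < m) k)); last by rewrite sum_nat_const card_ord.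
  by apply: leq_sum => j _; rewrite mnmE -ltnS.
have ltB i : (mu i < B)%N by move/forallP: lt_mu.
pose b : J := [ffun i => Ordinal (ltB i)].
have mu_b : mu = cmono (enum_val (enum_rank b)).
  by apply/mnmP => i; rewrite enum_rankK mnmE ffunE.
have /matrixP/(_ 0 (enum_rank b)) := vM.
rewrite [LHS]mxE [RHS]mxE => vM0; rewrite -[RHS]vM0.
by apply: eq_bigr => i _; rewrite substE mcoeffZ mxE -mu_b.
Qed.

End AlgebraicIndependence.

(** * Algebraic relations and the Jacobian criterion *)

Lemma minimal_witness (T : Type) (P : T -> Prop) (mu : T -> nat) :
  (exists x, P x) -> exists2 x, P x & forall y, P y -> (mu x <= mu y)%N.
Proof.
move=> [x Px]; have [k] := ubnP (mu x); elim: k x Px => // k IHk x Px lt_xk.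
have [min_x | /existsNP[y /not_implyP[Py /negP]]] :=
  EM (forall y, P y -> (mu x <= mu y)%N); first by exists x.
by rewrite -ltnNge => lt_yx; apply: IHk Py (leq_trans lt_yx _).
Qed.

Section Jacobian.
Variables (K : numClosedFieldType) (N : nat).

(** The relation is nontrivial even after substitution of f: the entries of f may
    satisfy relations, which are the zeros of [subst f]. *)
Definition alg_over (m : nat) (f : 'I_m -> {mpoly K[N]}) (b : {mpoly K[N]}) :=
  exists2 P : {poly {mpoly K[m]}},
    map_poly (subst f) P != 0 & root (map_poly (subst f) P) b.

Lemma map_subst_inj0 m (f : 'I_m -> {mpoly K[N]}) (P : {poly {mpoly K[m]}}) :
  alg_indep f -> map_poly (subst f) P = 0 -> P = 0.
Proof.
move=> ind_f /polyP P0; apply/polyP => i; rewrite coef0; apply: ind_f.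
by have := P0 i; rewrite coef_map coef0.
Qed.

Lemma alg_over_fext m (f : 'I_m -> {mpoly K[N]}) b :
  alg_indep f -> ~ alg_indep (fext f b) -> alg_over f b.
Proof.
move=> ind_f /existsNP[F /not_implyP[F0 nzF]]; exists (muni F).
  by apply/eqP => /(map_subst_inj0 ind_f)/muni_inj0.
by rewrite /root -subst_fext F0.
Qed.

(** The relation is minimal among those whose coefficients lie in the ring
    generated by f. These coefficients are represented by polynomials in the
    entries of f, hence only determined modulo the relations of f. *)
Definition minimal_for m (f : 'I_m -> {mpoly K[N]}) (b : {mpoly K[N]})
    (P : {poly {mpoly K[m]}}) :=
  [/\ subst f (lead_coef P) != 0, root (map_poly (subst f) P) b &
      forall Q : {poly {mpoly K[m]}}, (size Q < size P)%N ->
        root (map_poly (subst f) Q) b -> map_poly (subst f) Q = 0].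

Lemma minimal_relation m (f : 'I_m -> {mpoly K[N]}) b : alg_over f b ->
  exists P, minimal_for f b P.
Proof.
case=> P0 nzP0 P0b; have [|P [nzP Pb] minP] := @minimal_witness _
  (fun P : {poly {mpoly K[m]}} => map_poly (subst f) P != 0 /\
     root (map_poly (subst f) P) b) (fun P => size P).
  by exists P0.
have minP' (Q : {poly {mpoly K[m]}}) : (size Q < size P)%N ->
    root (map_poly (subst f) Q) b -> map_poly (subst f) Q = 0.
  move=> ltQP Qb; apply/eqP; apply: contraT => nzQ.
  by have := minP Q (conj nzQ Qb); rewrite leqNgt ltQP.
exists P; split=> //; apply/eqP => lead0.
have nzP' : P != 0 by apply: contraNneq nzP => ->; rewrite rmorph0.
pose Q := P - lead_coef P *: 'X^((size P).-1).
have eqQ : map_poly (subst f) Q = map_poly (subst f) P.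
  by rewrite rmorphB /= map_polyZ /= lead0 scale0r subr0.
case/eqP: nzP; rewrite -eqQ; apply: minP'; last by rewrite eqQ.
rewrite -(prednK (_ : 0 < size P)%N) ?size_poly_gt0 // ltnS.
apply/leq_sizeP => j; rewrite leq_eqVlt => /orP[/eqP <-|lt_j].
  by rewrite coefB coefZ coefXn eqxx mulr1 subrr.
rewrite coefB coefZ coefXn (gtn_eqF lt_j) mulr0 subr0 nth_default //.
by rewrite -(prednK (_ : 0 < size P)%N) ?size_poly_gt0.
Qed.

(** In characteristic zero, the derivative of a minimal relation is nonzero and has
    smaller degree, so it does not vanish at b. *)
Lemma separable_relation m (f : 'I_m -> {mpoly K[N]}) b : alg_over f b ->
  exists2 F : {mpoly K[m.+1]}, subst (fext f b) F = 0 &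
    subst (fext f b) (F^`M(ord_max)) != 0.
Proof.
case/minimal_relation => P [nz_lead Pb minP].
exists (mmulti P); rewrite subst_fext ?muni_deriv muni_mmulti; first exact/eqP.
have nzP : P != 0.
  by apply: contraNneq nz_lead => ->; rewrite lead_coef0 rmorph0.
have szP : size (map_poly (subst f) P) = size P by rewrite size_map_poly_id0.
have gt1P : (1 < size P)%N.
  rewrite ltnNge; apply: contraL Pb => /size1_polyC P1.
  move: nz_lead; rewrite P1 lead_coefC => nz0.
  by rewrite map_polyC rootC.
apply/eqP => /eqP P'b; have := minP P^`() (lt_size_deriv nzP) P'b.
move/polyP/(_ (size P).-2); rewrite coef0 coef_map coef_deriv.
rewrite (_ : (size P).-2.+1 = (size P).-1); last by case: (size P) gt1P => [|[]].
rewrite raddfMn /= => /eqP.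
rewrite -mulr_natr mulf_eq0 (negbTE nz_lead) /= -mpolyC_nat mpolyC_eq0 pnatr_eq0.
by case: (size P) gt1P => [|[]].
Qed.

Definition jacobian (m : nat) (f : 'I_m -> {mpoly K[N]}) (u : 'I_N -> K) :
  'M[K]_(m, N) := \matrix_(i, l) ((f i)^`M(l)).@[u].

(** Either some variable is transcendental over f, and f can be extended, or
    all variables are algebraic over f; differentiating separable relations of
    the variables then shows that the Jacobian matrix has full rank. *)
Lemma jacobian_row_free m (f : 'I_m -> {mpoly K[N]}) : alg_indep f ->
  exists2 d : {mpoly K[N]}, d != 0 &
    forall u, d.@[u] != 0 -> row_free (jacobian f u).
Proof.
have [k] := ubnP (N - m)%N; elim: k m f => // k IHk m f lt_k ind_f.
have [[l ind_fl]|no_ext] := EM (exists l, alg_indep (fext f 'X_l)).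
  have lt_mN := alg_indep_leq ind_fl.
  have [|d nzd dP] := IHk _ _ _ ind_fl.
    by rewrite -ltnS (leq_trans _ lt_k) // ltnS subnS prednK // subn_gt0.
  exists d => // u /dP/row_freeP[B JB].
  apply/row_freeP; exists (colsub (lift ord_max) B); apply/matrixP => i j.
  have /matrixP/(_ (lift ord_max i) (lift ord_max j)) := JB.
  rewrite !mxE (inj_eq lift_inj) => <-; apply: eq_bigr => l' _.
  by rewrite !mxE fext_lift.
have rel l : exists F : {mpoly K[m.+1]}, subst (fext f 'X_l) F = 0 /\
    subst (fext f 'X_l) (F^`M(ord_max)) != 0.
  have [|F F0 F'] := @separable_relation m f 'X_l; last by exists F.
  by apply: alg_over_fext => // ind; apply: no_ext; exists l.
have [F FP] := choice rel.
exists (\prod_l subst (fext f 'X_l) ((F l)^`M(ord_max))).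
  by apply/prodf_neq0 => l _; case: (FP l).
move=> u; rewrite rmorph_prod /= => /prodf_neq0 nz.
(* Differentiating the relations gives A J = diag D, where D has no zero entry. *)
pose A : 'M[K]_(N, m) :=
  \matrix_(l, i) (subst (fext f 'X_l) ((F l)^`M(lift ord_max i))).@[u].
pose D : 'rV[K]_N := \row_l - (subst (fext f 'X_l) ((F l)^`M(ord_max))).@[u].
have AJ : A *m jacobian f u = diag_mx D.
  apply/matrixP => l l'; rewrite !mxE.
  have [Fl0 _] := FP l; have := subst_mderiv (fext f 'X_l) (F l) l'.
  rewrite Fl0 mderiv0 big_fext fext_max => /(congr1 (meval u)).
  rewrite meval0 mevalD raddf_sum /= => /eqP; rewrite eq_sym addr_eq0 => /eqP.
  under eq_bigr do rewrite fext_lift mevalM.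
  under [in X in _ -> X]eq_bigr do rewrite !mxE.
  move=> ->; rewrite mevalM mderivX mnm1E.
  have [<-|nll] := eqVneq l l'; last by rewrite scale0r meval0 mulr0 oppr0 mulr0n.
  rewrite scale1r (_ : (U_(l) - U_(l))%MM = 0%MM :> 'X_{1..N}) ?mpolyX0 ?meval1 ?mulr1 //.
  by apply/mnmP => i; rewrite mnmBE mnm0E subnn.
have rkD : \rank (diag_mx D) = N.
  apply: mxrank_unit; rewrite unitmxE det_diag unitfE; apply/prodf_neq0 => l _.
  by rewrite mxE oppr_eq0; apply: nz.
rewrite /row_free eqn_leq rank_leq_row (leq_trans (alg_indep_leq ind_f)) //.
have : (\rank (diag_mx D) <= \rank (jacobian f u))%N by rewrite -AJ mxrankM_maxr.
by rewrite rkD.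
Qed.

Lemma msize_mderiv m (F : {mpoly K[m]}) i : F != 0 ->
  (msize (F^`M(i)) < msize F)%N.
Proof.
move=> nzF; rewrite [X in (_ < X)%N](mpolySpred _ nzF) ltnS msizeE.
apply/bigmax_leqP_seq => mu; rewrite mcoeff_msupp mcoeff_mderiv => nz _.
rewrite -ltnS -mpolySpred // (leq_trans _ (msize_mdeg_lt (m := (mu + U_(i))%MM) _)) //.
  by rewrite mdegD mdeg1 addn1.
by rewrite mcoeff_msupp; apply: contraNneq nz => ->; rewrite mul0rn.
Qed.

Lemma mderiv_eq0_const m (F : {mpoly K[m]}) :
  (forall i, F^`M(i) = 0) -> F = (F@_0%MM)%:MP.
Proof.
move=> F'0; apply/mpolyP => mu; rewrite mcoeffC.
have [->|nz_mu] := eqVneq mu 0%MM; first by rewrite mulr1.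
rewrite mulr0; have /existsP[i nz_i] : [exists i, mu i != 0%N].
  apply: contraNT nz_mu; rewrite negb_exists => /forallP mu0.
  by apply/eqP/mnmP => i; rewrite mnm0E; apply/eqP; rewrite -[_ == _]negbK mu0.
have := F'0 i => /(congr1 (mcoeff (mu - U_(i)))).
rewrite mcoeff_mderiv mcoeff0 submK ?lep1mP // => /eqP.
by rewrite mulrn_eq0 /= => /eqP.
Qed.

(** A relation of minimal degree would give, by the chain rule, relations of
    smaller degree among its partial derivatives. *)
Lemma alg_indep_jacobian m (f : 'I_m -> {mpoly K[N]}) u :
  row_free (jacobian f u) -> alg_indep f.
Proof.
case/row_freeP => B JB F; have [k] := ubnP (msize F).
elim: k F => // k IHk F lt_k F0; have [//|nzF] := eqVneq F 0.
have F'0 i : F^`M(i) = 0.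
  apply: IHk; first by rewrite (leq_trans (msize_mderiv i nzF)).
  (* The partial derivatives of F form a row w in the kernel of a matrix whose
     determinant does not vanish at u. *)
  move: i; pose w : 'rV[{mpoly K[N]}]_m := \row_i subst f (F^`M(i)).
  pose C : 'M[{mpoly K[N]}]_m :=
    (\matrix_(i, l) (f i)^`M(l)) *m map_mx (@mpolyC N K) B.
  have wC : w *m C = 0.
    rewrite mulmxA (_ : w *m _ = 0) ?mul0mx //; apply/rowP => l; rewrite [LHS]mxE [RHS]mxE.
    have := subst_mderiv f F l; rewrite F0 mderiv0 => F'l; rewrite [RHS]F'l.
    by apply: eq_bigr => i _; rewrite !mxE.
  have nzC : \det C != 0.
    apply/eqP => /(congr1 (meval u)); rewrite meval0 -det_map_mx.
    suff -> : map_mx (meval u) C = 1%:M by rewrite det1 => /eqP; rewrite oner_eq0.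
    rewrite -JB map_mxM; congr (_ *m _); apply/matrixP => i l; last by rewrite !mxE /= mevalC.
    by rewrite /jacobian !mxE.
  have : w *m C *m \adj C = 0 by rewrite wC mul0mx.
  rewrite -mulmxA mul_mx_adj mul_mx_scalar => /rowP w0 i.
  have /eqP := w0 i; rewrite !mxE mulf_eq0 (negbTE nzC) /=.
  by move/eqP.
move: F0; rewrite (mderiv_eq0_const F'0) substC => /eqP.
by rewrite mpolyC_eq0 => /eqP ->; rewrite mpolyC0.
Qed.

End Jacobian.

(** * Polynomial functions, polynomial maps and Zariski closures *)

Section PolynomialFunctions.
Variables (K : numClosedFieldType).
Implicit Types (U W : vectType K).

Definition poly_fun W (h : W -> K) : Prop := exists f : poly_on W, h =1 peval f.

Definition poly_map U W (phi : U -> W) : Prop :=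
  forall j, poly_fun (fun x => zcoord j (phi x)).

Definition of_coords W (q : 'I_(\dim (fullv : {vspace W})) -> K) : W :=
  \sum_j q j *: (vbasis (fullv : {vspace W}))`_j.

Lemma zcoord_of_coords W q j : zcoord j (of_coords (W := W) q) = q j.
Proof.
rewrite /zcoord coord_sum_free //.
exact: basis_free (vbasisP _).
Qed.

Lemma sum_zcoord W (x : W) :
  x = \sum_j zcoord j x *: (vbasis (fullv : {vspace W}))`_j.
Proof. by rewrite -coord_vbasis ?memvf. Qed.

Lemma zcoord_inj W (x y : W) : (forall j, zcoord j x = zcoord j y) -> x = y.
Proof.
by move=> eq_xy; rewrite [x]sum_zcoord [y]sum_zcoord; apply: eq_bigr => j _; rewrite eq_xy.
Qed.

Lemma zcoordD W j (x y : W) : zcoord j (x + y) = zcoord j x + zcoord j y.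
Proof. by rewrite /zcoord linearD. Qed.

Lemma zcoordZ W j a (x : W) : zcoord j (a *: x) = a * zcoord j x.
Proof. by rewrite /zcoord linearZ. Qed.

Lemma zcoord0 W j : zcoord j (0 : W) = 0.
Proof. by rewrite /zcoord linear0. Qed.

Lemma zcoord_sum W (I : Type) (r : seq I) (P : pred I) j (F : I -> W) :
  zcoord j (\sum_(i <- r | P i) F i) = \sum_(i <- r | P i) zcoord j (F i).
Proof. by rewrite /zcoord linear_sum. Qed.

Lemma peval_of_coords W (f : poly_on W) q : peval f (of_coords q) = f.@[q].
Proof. by apply: meval_eq => j; rewrite zcoord_of_coords. Qed.

Lemma eq_poly_fun W (g h : W -> K) : g =1 h -> poly_fun g -> poly_fun h.
Proof. by move=> eq_gh [f gf]; exists f => x; rewrite -eq_gh. Qed.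

Lemma poly_fun_peval W (f : poly_on W) : poly_fun (peval f).
Proof. by exists f. Qed.

Lemma poly_fun_zcoord W j : poly_fun (@zcoord K W j).
Proof. by exists 'X_j => x; rewrite /peval mevalXU. Qed.

Lemma poly_funC W (c : K) : poly_fun (fun _ : W => c).
Proof. by exists c%:MP => x; rewrite /peval mevalC. Qed.

Lemma poly_funD W (g h : W -> K) :
  poly_fun g -> poly_fun h -> poly_fun (fun x => g x + h x).
Proof.
by move=> [p gp] [q hq]; exists (p + q) => x; rewrite /peval mevalD gp hq.
Qed.

Lemma poly_funM W (g h : W -> K) :
  poly_fun g -> poly_fun h -> poly_fun (fun x => g x * h x).
Proof.
by move=> [p gp] [q hq]; exists (p * q) => x; rewrite /peval mevalM gp hq.
Qed.

Lemma poly_funN W (g : W -> K) : poly_fun g -> poly_fun (fun x => - g x).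
Proof. by move=> [p gp]; exists (- p) => x; rewrite /peval mevalN gp. Qed.

Lemma poly_funB W (g h : W -> K) :
  poly_fun g -> poly_fun h -> poly_fun (fun x => g x - h x).
Proof. by move=> gP hP; apply: poly_funD => //; apply: poly_funN. Qed.

Lemma poly_fun_sum W (I : finType) (P : pred I) (h : I -> W -> K) :
  (forall i, P i -> poly_fun (h i)) -> poly_fun (fun x => \sum_(i | P i) h i x).
Proof.
move=> hP; have [i|f fP] := @choice _ _ (fun i f => P i -> h i =1 peval f).
  have [Pi|nPi] := boolP (P i); last by exists 0.
  by have [f hf] := hP i Pi; exists f.
exists (\sum_(i | P i) f i) => x; rewrite /peval raddf_sum /=.
by apply: eq_bigr => i Pi; rewrite (fP i Pi).
Qed.

Lemma poly_fun_prod W (I : finType) (P : pred I) (h : I -> W -> K) :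
  (forall i, P i -> poly_fun (h i)) -> poly_fun (fun x => \prod_(i | P i) h i x).
Proof.
move=> hP; have [i|f fP] := @choice _ _ (fun i f => P i -> h i =1 peval f).
  have [Pi|nPi] := boolP (P i); last by exists 0.
  by have [f hf] := hP i Pi; exists f.
exists (\prod_(i | P i) f i) => x; rewrite /peval rmorph_prod /=.
by apply: eq_bigr => i Pi; rewrite (fP i Pi).
Qed.

(** Linearity is a hypothesis rather than a structure so that the lemma applies
   to functionals with values in K as well as in its regular module. *)
Lemma poly_fun_linear W (h : W -> K) :
  (forall x y, h (x + y) = h x + h y) -> (forall a x, h (a *: x) = a * h x) ->
  poly_fun h.
Proof.
move=> hD hZ; pose b := vbasis (fullv : {vspace W}).
apply: (@eq_poly_fun W (fun x => \sum_j zcoord j x * h b`_j)).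
  move=> x; rewrite [in RHS](sum_zcoord x).
  have h0 : h 0 = 0 by rewrite -(scale0r 0) hZ mul0r.
  by rewrite (big_morph h hD h0); apply: eq_bigr => j _; rewrite hZ.
by apply: poly_fun_sum => j _; apply: poly_funM; [apply: poly_fun_zcoord|apply: poly_funC].
Qed.

Lemma poly_fun_comp U W (h : W -> K) (phi : U -> W) :
  poly_fun h -> poly_map phi -> poly_fun (h \o phi).
Proof.
move=> [f hf] /choice[g gP]; exists (subst g f) => x.
rewrite /peval meval_subst /= hf; apply: meval_eq => j; exact: gP.
Qed.

Lemma poly_mapD U W (phi psi : U -> W) :
  poly_map phi -> poly_map psi -> poly_map (fun x => phi x + psi x).
Proof.
move=> phiP psiP j; apply: (eq_poly_fun (fun x => esym (zcoordD j (phi x) (psi x)))).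
exact: poly_funD.
Qed.

Lemma poly_mapZ U W (a : U -> K) (phi : U -> W) :
  poly_fun a -> poly_map phi -> poly_map (fun x => a x *: phi x).
Proof.
move=> aP phiP j; apply: (eq_poly_fun (fun x => esym (zcoordZ j (a x) (phi x)))).
exact: poly_funM.
Qed.

Lemma poly_map_comp U (V : vectType K) W (phi : V -> W) (psi : U -> V) :
  poly_map phi -> poly_map psi -> poly_map (phi \o psi).
Proof. by move=> phiP psiP j; apply: poly_fun_comp (phiP j) psiP. Qed.

Lemma poly_map_cst U W (c : W) : poly_map (fun _ : U => c).
Proof. by move=> j; apply: poly_funC. Qed.

Lemma poly_map_id U : poly_map (fun x : U => x).
Proof. by move=> j; apply: poly_fun_zcoord. Qed.

Lemma poly_map_sum U W (I : finType) (h : I -> U -> W) :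
  (forall i, poly_map (h i)) -> poly_map (fun x => \sum_i h i x).
Proof.
move=> hP j; apply: (@eq_poly_fun U (fun x => \sum_i zcoord j (h i x))).
  by move=> x; rewrite /zcoord linear_sum.
by apply: poly_fun_sum => i _; apply: hP.
Qed.

Lemma peval_eq0 W (f : poly_on W) : (forall x, peval f x = 0) -> f = 0.
Proof.
by move=> f0; apply: mpoly_eq_eval0 => q; rewrite -peval_of_coords f0.
Qed.

Lemma exists_peval_neq0 W (f : poly_on W) : f != 0 -> exists x, peval f x != 0.
Proof.
case/exists_eval_neq0 => q nz; exists (of_coords q).
by rewrite peval_of_coords.
Qed.

(** The locus where h is nonzero is Zariski dense. *)
Lemma poly_fun_dense W (g h : W -> K) :
  poly_fun g -> poly_fun h -> (exists x, h x != 0) ->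
  (forall x, h x != 0 -> g x = 0) -> forall x, g x = 0.
Proof.
move=> [p gp] [q hq] [x0 nz] gh0 x; have : p * q = 0.
  apply: peval_eq0 => y; rewrite /peval mevalM -/(peval _ _) -/(peval q _) -gp -hq.
  by have [->|/gh0->] := eqVneq (h y) 0; rewrite ?mulr0 ?mul0r.
move/eqP; rewrite mulf_eq0 => /orP[] /eqP E; first by rewrite gp E /peval meval0.
by move: nz; rewrite hq E /peval meval0 eqxx.
Qed.

Lemma zclosure_poly_fun W (S : set W) (h : W -> K) x :
  poly_fun h -> (forall y, S y -> h y = 0) -> zclosure S x -> h x = 0.
Proof. by move=> [f hf] S0 /(_ f); rewrite hf; apply => y /S0; rewrite hf. Qed.

Lemma sub_zclosure W (S : set W) : S `<=` zclosure S.
Proof. by move=> x Sx f; apply. Qed.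

Lemma zclosure_sub W (S T : set W) : S `<=` T -> zclosure S `<=` zclosure T.
Proof. by move=> sST x Sx f fT; apply: Sx => y /sST/fT. Qed.

Lemma zclosed_zclosure W (S : set W) : zclosed (zclosure S).
Proof. by move=> x Sx f fS; apply: Sx => y; apply. Qed.

Lemma zclosure_min W (S T : set W) :
  S `<=` T -> zclosed T -> zclosure S `<=` T.
Proof. by move=> sST clT x /(zclosure_sub sST)/clT. Qed.

Lemma vanishing_zclosure W (S : set W) :
  vanishing_ideal (zclosure S) = vanishing_ideal S.
Proof.
apply/seteqP; split=> f fS x Sx; first by apply: fS; apply: sub_zclosure.
exact: Sx.
Qed.

Lemma zclosed_preimage U W (phi : U -> W) (S : set W) :
  poly_map phi -> zclosed S -> zclosed (phi @^-1` S).
Proof.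
move=> phiP clS x xcl; apply: clS => f fS.
have [g gP] := poly_fun_comp (poly_fun_peval f) phiP.
have -> : peval f (phi x) = peval g x by rewrite -gP.
by apply: xcl => y Sy; rewrite -gP; apply: fS.
Qed.

Lemma zclosure_image U W (phi : U -> W) (S : set U) (T : set W) :
  poly_map phi -> (forall x, S x -> T (phi x)) ->
  forall x, zclosure S x -> zclosure T (phi x).
Proof.
move=> phiP sST; apply: (@zclosure_min _ _ (phi @^-1` zclosure T)).
  by move=> x /sST; apply: sub_zclosure.
exact: zclosed_preimage phiP (@zclosed_zclosure _ T).
Qed.

(** Polynomial functions on the source form an integral domain. *)
Lemma zirreducible_range U W (phi : U -> W) :
  poly_map phi -> zirreducible (zclosure (range phi)).
Proof.
move=> phiP; split; first exact: zclosed_zclosure.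
  by exists (phi 0); apply: sub_zclosure; exists 0.
move=> A B clA clB sub; apply: contrapT => /not_orP[nA nB].
have outside (C : set W) : zclosed C -> ~ zclosure (range phi) `<=` C ->
    exists f : poly_on W, vanishing_ideal C f /\ exists u, peval f (phi u) != 0.
  move=> clC nC; have [u nCu] : exists u, ~ C (phi u).
    apply: contrapT => noC; apply: nC; apply: zclosure_min => // _ [u _ <-].
    by apply: contrapT => nCu; apply: noC; exists u.
  have /existsNP[f /not_implyP[fC /eqP nz]] : ~ zclosure C (phi u) by move=> /clC.
  by exists f; split=> //; exists u.
have [f [fA [u nzf]]] := outside _ clA nA.
have [g [gB nzg]] := outside _ clB nB.
have fP := poly_fun_comp (poly_fun_peval f) phiP.
have gP := poly_fun_comp (poly_fun_peval g) phiP.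
case/eqP: nzf; apply: (poly_fun_dense fP gP nzg) => x nz.
have [|Ax|Bx] := sub (phi x); first by apply: sub_zclosure; exists x.
  exact: fA.
by move: nz; rewrite /= gB ?eqxx.
Qed.

Lemma zirreducible_prime W (Z : set W) (f g : poly_on W) :
  zirreducible Z -> vanishing_ideal Z (f * g) ->
  vanishing_ideal Z f \/ vanishing_ideal Z g.
Proof.
case=> _ _ irrZ fg0.
have cl (h : poly_on W) : zclosed [set x | peval h x = 0].
  by move=> x xcl; apply: (zclosure_poly_fun (poly_fun_peval h) _ xcl).
apply: irrZ (cl f) (cl g) _ => x /fg0 /=.
rewrite /peval mevalM => /eqP.
by rewrite mulf_eq0 => /orP[] /eqP; [left|right].
Qed.

End PolynomialFunctions.

(** * Polynomial curves and their velocities *)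

Section Velocity.
Variables (K : numClosedFieldType).
Implicit Types (U W : vectType K).

(** Curves have polynomial coordinates, so derivatives at 0 are read off from the
    representing polynomials, over any field of characteristic zero. *)
Definition has_deriv (h : K -> K) (d : K) : Prop :=
  exists2 P : {poly K}, forall t, h t = P.[t] & d = (P^`()).[0].

Definition velocity W (g : K -> W) (v : W) : Prop :=
  forall j, has_deriv (fun t => zcoord j (g t)) (zcoord j v).

Lemma has_deriv_uniq h d1 d2 : has_deriv h d1 -> has_deriv h d2 -> d1 = d2.
Proof.
move=> [P hP ->] [Q hQ ->]; congr (_^`()).[_].
by apply: poly_eq_horner => t; rewrite -hP hQ.
Qed.

Lemma eq_has_deriv g h d : g =1 h -> has_deriv g d -> has_deriv h d.
Proof. by move=> eq_gh [P gP dP]; exists P => // t; rewrite -eq_gh. Qed.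

Lemma has_derivC c : has_deriv (fun=> c) 0.
Proof. by exists c%:P => [t|]; rewrite ?derivC ?hornerC. Qed.

Lemma has_deriv_line a b : has_deriv (fun t => a + t * b) b.
Proof.
exists (a%:P + 'X * b%:P) => [t|]; by rewrite ?derivE ?hornerE.
Qed.

Lemma has_derivD g h d e :
  has_deriv g d -> has_deriv h e -> has_deriv (fun t => g t + h t) (d + e).
Proof.
move=> [P gP ->] [Q hQ ->]; exists (P + Q) => [t|]; first by rewrite hornerD gP hQ.
by rewrite derivD hornerD.
Qed.

Lemma has_derivM g h d e : has_deriv g d -> has_deriv h e ->
  has_deriv (fun t => g t * h t) (d * h 0 + g 0 * e).
Proof.
move=> [P gP ->] [Q hQ ->]; exists (P * Q) => [t|]; first by rewrite hornerM gP hQ.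
by rewrite derivM hornerD !hornerM gP hQ.
Qed.

Lemma has_derivZ a h d : has_deriv h d -> has_deriv (fun t => a * h t) (a * d).
Proof.
move=> hd; have := has_derivM (has_derivC a) hd.
by rewrite mul0r add0r.
Qed.

Lemma has_deriv_sum (I : finType) (h : I -> K -> K) d :
  (forall i, has_deriv (h i) (d i)) ->
  has_deriv (fun t => \sum_i h i t) (\sum_i d i).
Proof.
move=> hd; have [i|P PP] := @choice _ _ (fun i P =>
    (forall t, h i t = P.[t]) /\ d i = (P^`()).[0]).
  by have [P] := hd i; exists P.
exists (\sum_i P i) => [t|]; first rewrite horner_sum.
  by apply: eq_bigr => i _; case: (PP i).
rewrite linear_sum horner_sum; apply: eq_bigr => i _; by case: (PP i).
Qed.

Lemma has_deriv_prod (I : finType) (h : I -> K -> K) d :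
  (forall i, has_deriv (h i) (d i)) ->
  has_deriv (fun t => \prod_i h i t) (\sum_i d i * \prod_(j | j != i) h j 0).
Proof.
move=> hd.
suff : forall r : seq I, uniq r -> has_deriv (fun t => \prod_(i <- r) h i t)
    (\sum_(i <- r) d i * \prod_(j <- r | j != i) h j 0).
  by apply; apply: index_enum_uniq.
elim=> [_|i r IHr /= /andP[ir uniq_r]].
  rewrite big_nil; apply: (eq_has_deriv (g := fun=> 1)) (has_derivC 1) => t.
  by rewrite big_nil.
apply: (eq_has_deriv (g := fun t => h i t * \prod_(j <- r) h j t)).
  by move=> t; rewrite big_cons.
have := has_derivM (hd i) (IHr uniq_r).
congr has_deriv; rewrite big_cons big_cons eqxx /=; congr (_ * _ + _).
  rewrite [RHS]big_seq_cond [LHS]big_seq; apply: eq_bigl => j.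
  by rewrite andbC; case: eqVneq ir => // -> /negbTE ->.
rewrite mulr_sumr !big_seq; apply: eq_bigr => j jr; rewrite big_cons.
rewrite (_ : i != j); first by rewrite mulrCA.
by apply: contraNneq ir => ->.
Qed.

(** The differential of f at x, as a linear form in v. *)
Definition dpeval W (f : poly_on W) (x v : W) : K :=
  \sum_j peval (f^`M(j)) x * zcoord j v.

Lemma has_deriv_peval W (f : poly_on W) (g : K -> W) v :
  velocity g v -> has_deriv (fun t => peval f (g t)) (dpeval f (g 0) v).
Proof.
move=> gv; have [j|P PP] := @choice _ _ (fun j P =>
    (forall t, zcoord j (g t) = P.[t]) /\ zcoord j v = (P^`()).[0]).
  by have [P] := gv j; exists P.
pose phi : {rmorphism {mpoly K[_]} -> {poly K}} := mmap polyC P.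
have phiE t (F : poly_on W) : peval F (g t) = (phi F).[t].
  apply: (mpoly_rmorph_ext (phi := meval (fun j => zcoord j (g t)))
    (psi := horner_eval t \o phi)) => [c|i] /=; rewrite /horner_eval.
    by rewrite mevalC mmapC hornerC.
  by rewrite mevalXU mmapX mmap1U; case: (PP i).
exists (phi f) => //.
pose D : {additive {mpoly K[_]} -> {poly K}} := (@deriv _ \o phi)%FUN.
rewrite -[_^`()]/(D f) (@mpoly_derivation _ _ _ phi D) => [|c|p q].
- rewrite horner_sum; apply: eq_bigr => j _; rewrite hornerM phiE; congr (_ * _).
  by rewrite /= mmapX mmap1U; case: (PP j).
- by rewrite /D /= mmapC derivC.
by rewrite /D /= rmorphM derivM.
Qed.

Lemma velocity_uniq W (g : K -> W) v w : velocity g v -> velocity g w -> v = w.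
Proof. by move=> gv gw; apply: zcoord_inj => j; apply: has_deriv_uniq (gv j) (gw j). Qed.

Lemma eq_velocity W (g h : K -> W) v : g =1 h -> velocity g v -> velocity h v.
Proof. by move=> /funext ->. Qed.

Lemma velocity_line W (x v : W) : velocity (fun t => x + t *: v) v.
Proof.
move=> j; apply: eq_has_deriv (has_deriv_line (zcoord j x) (zcoord j v)) => t.
by rewrite zcoordD zcoordZ.
Qed.

Lemma velocityC W (x : W) : velocity (fun=> x) 0.
Proof. by move=> j; rewrite /zcoord linear0; apply: has_derivC. Qed.

Lemma velocityD W (g h : K -> W) v w :
  velocity g v -> velocity h w -> velocity (fun t => g t + h t) (v + w).
Proof.
move=> gv hw j; rewrite zcoordD; apply: eq_has_deriv (has_derivD (gv j) (hw j)) => t.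
by rewrite zcoordD.
Qed.

Lemma velocityZ W (a : K -> K) (g : K -> W) d v :
  has_deriv a d -> velocity g v ->
  velocity (fun t => a t *: g t) (d *: g 0 + a 0 *: v).
Proof.
move=> ad gv j; rewrite zcoordD !zcoordZ.
by apply: eq_has_deriv (has_derivM ad (gv j)) => t; rewrite zcoordZ.
Qed.

Lemma velocity_sum W (I : finType) (g : I -> K -> W) v :
  (forall i, velocity (g i) (v i)) ->
  velocity (fun t => \sum_i g i t) (\sum_i v i).
Proof.
move=> gv j; rewrite /zcoord linear_sum.
apply: eq_has_deriv (has_deriv_sum (fun i => gv i j)) => t.
by rewrite /zcoord linear_sum.
Qed.

Lemma velocityD0 W (g h : K -> W) v :
  velocity g v -> velocity h 0 -> velocity (fun t => g t + h t) v.
Proof. by move=> gv /(velocityD gv); rewrite addr0. Qed.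

Lemma velocityB0 W (g h : K -> W) v :
  velocity g v -> velocity h 0 -> velocity (fun t => g t - h t) v.
Proof.
move=> gv /(velocityZ (has_derivC (-1))); rewrite scale0r scaler0 addr0.
move/(velocityD0 gv); apply: eq_velocity => t; by rewrite scaleN1r.
Qed.

Lemma velocityZ0 W (a : K -> K) (g : K -> W) d :
  has_deriv a d -> velocity g 0 -> g 0 = 0 -> velocity (fun t => a t *: g t) 0.
Proof. by move=> ad gv g0; have := velocityZ ad gv; rewrite g0 !scaler0 addr0. Qed.

Lemma velocity_sum0 W (I : finType) (g : I -> K -> W) :
  (forall i, velocity (g i) 0) -> velocity (fun t => \sum_i g i t) 0.
Proof. by move=> /velocity_sum; rewrite big1_eq. Qed.

Lemma has_deriv_linear W (h : W -> K) (g : K -> W) v :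
  (forall x y, h (x + y) = h x + h y) -> (forall a x, h (a *: x) = a * h x) ->
  velocity g v -> has_deriv (fun t => h (g t)) (h v).
Proof.
move=> hD hZ gv; have h0 : h 0 = 0 by rewrite -(scale0r 0) hZ mul0r.
have hE x : h x = \sum_j zcoord j x * h (vbasis (fullv : {vspace W}))`_j.
  rewrite [in LHS](sum_zcoord x) (big_morph h hD h0).
  by apply: eq_bigr => j _; rewrite hZ.
rewrite hE; apply: (eq_has_deriv (fun t => esym (hE (g t)))).
apply: has_deriv_sum => j.
have := has_derivM (gv j) (has_derivC (h (vbasis (fullv : {vspace W}))`_j)).
by rewrite mulr0 addr0.
Qed.

Lemma poly_fun_curve W (h : W -> K) (g : K -> W) v :
  poly_fun h -> velocity g v -> exists d, has_deriv (fun t => h (g t)) d.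
Proof.
move=> [f hf] gv; exists (dpeval f (g 0) v).
by apply: eq_has_deriv (has_deriv_peval f gv) => t; rewrite hf.
Qed.

Lemma poly_map_velocity U W (phi : U -> W) (x w : U) :
  poly_map phi -> exists v, velocity (fun t => phi (x + t *: w)) v.
Proof.
move=> phiP; have [|d dP] := @choice _ _ (fun j d =>
    has_deriv (fun t => zcoord j (phi (x + t *: w))) d).
  by move=> j; have := poly_fun_curve (phiP j) (velocity_line x w).
by exists (of_coords d) => j; rewrite zcoord_of_coords.
Qed.

Lemma tangent_velocity W (S : set W) (g : K -> W) v :
  (forall t, S (g t)) -> velocity g v -> tangent S (g 0) v.
Proof.
move=> Sg gv f fS; apply: has_deriv_uniq (has_deriv_peval f gv) _.
by apply: eq_has_deriv (has_derivC 0) => t; rewrite fS.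
Qed.

Lemma dpevalD W (f : poly_on W) x v w :
  dpeval f x (v + w) = dpeval f x v + dpeval f x w.
Proof.
by rewrite -big_split; apply: eq_bigr => j _; rewrite zcoordD mulrDr.
Qed.

Lemma dpevalZ W (f : poly_on W) x a v : dpeval f x (a *: v) = a * dpeval f x v.
Proof.
by rewrite mulr_sumr; apply: eq_bigr => j _; rewrite zcoordZ mulrCA.
Qed.

End Velocity.

(** * Generic points of the closure of the image of a polynomial map *)

Section GenericPoints.
Variables (K : numClosedFieldType).
Implicit Types (U W : vectType K).

(** Passing from an irreducible closed set to a strictly larger one, any
    function that vanishes on the former only is a new independent element. *)
Lemma irr_chain_alg_indep W (Y : set W) x e Z : irr_chain Y x e Z ->
  exists g : 'I_e -> poly_on W,
    forall F, vanishing_ideal (Z e) (subst g F) -> F = 0.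
Proof.
move=> [irrZ ltZ]; suff : forall k, (k <= e)%N -> exists g : 'I_k -> poly_on W,
    forall F, vanishing_ideal (Z k) (subst g F) -> F = 0 by apply.
elim=> [_|k IHk lt_ke].
  exists (fun=> 0) => F /(_ x); have [_ Zx _] := irrZ 0%N (leq0n e).
  rewrite (nvar0_mpolyC F) substC /peval mevalC => F0.
  by rewrite (F0 Zx) mpolyC0.
have [g gP] := IHk (ltnW lt_ke).
have [irrZk _ _] := irrZ k (ltnW lt_ke); have [irrZk1 _ _] := irrZ k.+1 lt_ke.
have [sZ nsZ] := ltZ k lt_ke.
have [b [bZ nbZ]] : exists b : poly_on W,
    vanishing_ideal (Z k) b /\ ~ vanishing_ideal (Z k.+1) b.
  apply: contrapT => nob; apply: nsZ => y Zy; case: irrZk => clZ _ _.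
  by apply: clZ => f fZ; apply: contrapT => nz; apply: nob; exists f; split=> // /(_ y Zy).
exists (fext g b) => F; rewrite subst_fext => PF; apply: muni_inj0; move: PF.
elim/poly_ind: (muni F) => // P c IHP.
rewrite rmorphD rmorphM /= map_polyX map_polyC hornerD hornerM hornerX hornerC /= => Pc.
have c0 : c = 0.
  apply: gP => y Zy; have := Pc y (sZ y Zy).
  by rewrite /peval mevalD mevalM -[b.@[_]]/(peval b y) bZ // mulr0 add0r.
move: Pc; rewrite c0 rmorph0 addr0 addr0 => /(zirreducible_prime irrZk1)[/IHP->|//].
by rewrite mul0r.
Qed.

Section Parametrization.
Variables (U W : vectType K) (phi : U -> W) (phiP : poly_map phi).

Let Y := zclosure (range phi).
Let N := \dim (fullv : {vspace U}).
Let n := \dim (fullv : {vspace W}).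

Lemma parametrization_coords : exists Phi : 'I_n -> poly_on U,
  forall u j, zcoord j (phi u) = peval (Phi j) u.
Proof. by have [Phi PhiP] := choice phiP; exists Phi => u j; apply: PhiP. Qed.

Lemma vanishing_subst (Phi : 'I_n -> poly_on U) (f : poly_on W) :
  (forall u j, zcoord j (phi u) = peval (Phi j) u) ->
  forall u, peval f (phi u) = peval (subst Phi f) u.
Proof.
move=> PhiP u; rewrite /peval meval_subst; apply: meval_eq => j; exact: PhiP.
Qed.

Lemma maximal_coords (Phi : 'I_n -> poly_on U) : exists m (iota : 'I_m -> 'I_n),
  alg_indep (Phi \o iota) /\ forall l, alg_over (Phi \o iota) (Phi l).
Proof.
pose good (s : {m : nat & 'I_m -> 'I_n}) := alg_indep (Phi \o projT2 s).
have [|[m iota] /= ind_i max_i] := @minimal_witness _ good (fun s => N - projT1 s)%N.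
  exists (existT _ 0%N (fun i : 'I_0 =>
    match i with Ordinal k lt => False_rect _ (notF lt) end)).
  move=> F; rewrite (nvar0_mpolyC F) substC => /eqP.
  by rewrite mpolyC_eq0 => /eqP ->; rewrite mpolyC0.
exists m, iota; split=> // l; apply: alg_over_fext => // ind_l.
have goodl : good (existT _ m.+1 (fext iota l)).
  rewrite /good /= => F; rewrite (eq_subst (fext_comp Phi iota l)); exact: ind_l.
have := max_i _ goodl; rewrite /= leqNgt ltn_sub2l //.
exact: alg_indep_leq ind_l.
Qed.

(** At a generic parameter, the tangent vectors are determined by a maximal
    family of independent coordinates, on which the differential of phi is
    onto. *)
Lemma generic_tangent : exists (d : poly_on U) (m : nat) (iota : 'I_m -> 'I_n),
  d != 0 /\ forall u, peval d u != 0 ->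
  (forall v, tangent Y (phi u) v -> (forall i, zcoord (iota i) v = 0) -> v = 0) /\
  exists (w : 'I_m -> U) (e : 'I_m -> W), forall k,
    velocity (fun t => phi (u + t *: w k)) (e k) /\
    forall i, zcoord (iota i) (e k) = (i == k)%:R.
Proof.
have [Phi PhiP] := parametrization_coords.
have [m [iota [ind_i alg_i]]] := maximal_coords Phi.
have [F FP] := choice (fun l => match separable_relation (alg_i l) with
  ex_intro2 F a b => ex_intro (fun F => _ /\ _) F (conj a b) end).
have [d0 nzd0 d0P] := jacobian_row_free ind_i.
exists (d0 * \prod_l subst (fext (Phi \o iota) (Phi l)) ((F l)^`M(ord_max))), m, iota.
split; first by rewrite mulf_neq0 //; apply/prodf_neq0 => l _; case: (FP l).
move=> u; rewrite /peval mevalM mulf_eq0 negb_or rmorph_prod /=.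
move=> /andP[nz0 /prodf_neq0 nzF]; split.
  move=> v tv v0; apply: zcoord_inj => l; rewrite [RHS]/zcoord linear0.
  (* The relation of coordinate l with the independent ones, as a function on W;
     the tangent vector v kills its differential. *)
  pose R : poly_on W := subst (fext (fun i => 'X_(iota i)) 'X_l) (F l).
  have RY : vanishing_ideal Y R.
    rewrite vanishing_zclosure => _ [u' _ <-].
    rewrite (vanishing_subst _ PhiP) subst_comp.
    rewrite (_ : (fun i => _) = fext (Phi \o iota) (Phi l)).
      by have [-> _] := FP l; rewrite /peval meval0.
    apply: funext => i; case: (unliftP ord_max i) => [i'|] ->.
      by rewrite !fext_lift substX.
    by rewrite !fext_max substX.
  have := tv R RY; have coef (G : {mpoly K[m.+1]}) :
      peval (subst (fext (fun i => 'X_(iota i)) 'X_l) G) (phi u) =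
      peval (subst (fext (Phi \o iota) (Phi l)) G) u.
    rewrite (vanishing_subst _ PhiP) subst_comp; congr peval; apply: eq_subst.
    move=> i; case: (unliftP ord_max i) => [i'|] ->.
      by rewrite !fext_lift substX.
    by rewrite !fext_max substX.
  have dX (a : 'I_n) : \sum_j peval (('X_a)^`M(j)) (phi u) * zcoord j v = zcoord a v.
    rewrite (bigD1 a) //= big1 => [|j ja].
      rewrite mderivX mnm1E eqxx scale1r (_ : (U_(a) - U_(a))%MM = 0%MM :> 'X_{1..n}).
        by rewrite mpolyX0 /peval meval1 mul1r addr0.
      by apply/mnmP => i; rewrite mnmBE mnm0E subnn.
    by rewrite mderivX mnm1E eq_sym (negbTE ja) scale0r /peval meval0 mul0r.
  have -> : \sum_j peval (R^`M(j)) (phi u) * zcoord j v =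
      \sum_i peval (subst (fext (Phi \o iota) (Phi l)) ((F l)^`M(i))) u *
        zcoord (fext iota l i) v.
    under eq_bigr => j _.
      rewrite /R subst_mderiv /peval raddf_sum /= mulr_suml.
      under eq_bigr => i _ do rewrite mevalM -mulrA -/(peval _ _) coef.
      over.
    rewrite exchange_big /=; apply: eq_bigr => i _; rewrite -mulr_sumr; congr (_ * _).
    case: (unliftP ord_max i) => [i'|] ->.
      by rewrite !fext_lift; apply: dX.
    by rewrite !fext_max; apply: dX.
  rewrite big_fext big1 ?add0r => [|i _]; last by rewrite fext_lift v0 mulr0.
  move/eqP; rewrite fext_max mulf_eq0 => /orP[/eqP E|/eqP//].
  by have := nzF l isT; rewrite -/(peval _ u) E eqxx.
have [B JB] := row_freeP (d0P _ nz0).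
pose w k : U := of_coords (fun j => B j k).
have [e eP] := choice (fun k => poly_map_velocity u (w k) phiP).
exists w, e => k; split=> // i.
apply: has_deriv_uniq (eP k (iota i)) _.
have /matrixP/(_ i k) := JB; rewrite !mxE => <-.
rewrite (_ : \sum_j _ = dpeval (Phi (iota i)) (u + 0 *: w k) (w k)).
  apply: eq_has_deriv (has_deriv_peval (Phi (iota i)) (velocity_line u (w k))) => t.
  by rewrite PhiP.
by apply: eq_bigr => j _; rewrite scale0r addr0 zcoord_of_coords mxE.
Qed.

End Parametrization.
End GenericPoints.

Section GenericRegularity.
Variables (K : numClosedFieldType).
Variables (U W : vectType K) (phi : U -> W) (phiP : poly_map phi).

Let Y := zclosure (range phi).

Lemma tangentD (V : vectType K) (S : set V) x v w :
  tangent S x v -> tangent S x w -> tangent S x (v + w).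
Proof.
move=> tv tw f fS; have := dpevalD f x v w; rewrite /dpeval => ->.
by rewrite tv // tw // addr0.
Qed.

Lemma tangentZ (V : vectType K) (S : set V) x a v :
  tangent S x v -> tangent S x (a *: v).
Proof.
by move=> tv f fS; have := dpevalZ f x a v; rewrite /dpeval => ->; rewrite tv // mulr0.
Qed.

Lemma tangent_sum (V : vectType K) (S : set V) x (I : finType) (v : I -> V) :
  (forall i, tangent S x (v i)) -> tangent S x (\sum_i v i).
Proof.
move=> tv; apply: big_ind => //; last by move=> ? ?; apply: tangentD.
move=> f fS; rewrite big1 // => j _; by rewrite zcoord0 mulr0.
Qed.

Lemma velocity_differential (Phi : 'I_(\dim (fullv : {vspace W})) -> poly_on U) u w :
  (forall u j, zcoord j (phi u) = peval (Phi j) u) ->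
  velocity (fun t => phi (u + t *: w)) (of_coords (fun j => dpeval (Phi j) u w)).
Proof.
move=> PhiP j; rewrite zcoord_of_coords.
have := has_deriv_peval (Phi j) (velocity_line u w); rewrite scale0r addr0.
by apply: eq_has_deriv => t; rewrite PhiP.
Qed.

Lemma tangent_image u w v :
  velocity (fun t => phi (u + t *: w)) v -> tangent Y (phi u) v.
Proof.
move=> /(@tangent_velocity _ _ Y); rewrite scale0r addr0; apply=> t.
by apply: sub_zclosure; exists (u + t *: w).
Qed.

Section AtPoint.
Variables (m : nat) (iota : 'I_m -> 'I_(\dim (fullv : {vspace W}))) (u : U).
Hypothesis tangent_inj :
  forall v, tangent Y (phi u) v -> (forall i, zcoord (iota i) v = 0) -> v = 0.
Variables (w : 'I_m -> U) (e : 'I_m -> W).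
Hypothesis we : forall k, velocity (fun t => phi (u + t *: w k)) (e k) /\
    forall i, zcoord (iota i) (e k) = (i == k)%:R.

Lemma tangent_frame k : tangent Y (phi u) (e k).
Proof. by have [/tangent_image] := we k. Qed.

Lemma zcoord_frame c i : zcoord (iota i) (\sum_k c k *: e k) = c i.
Proof.
rewrite zcoord_sum (bigD1 i) //= big1 => [|k ki]; rewrite zcoordZ.
  by have [_ ->] := we i; rewrite eqxx mulr1 addr0.
by have [_ ->] := we k; rewrite eq_sym (negbTE ki) mulr0.
Qed.

Lemma tangent_decomp v :
  tangent Y (phi u) v -> v = \sum_k zcoord (iota k) v *: e k.
Proof.
move=> tv; apply/eqP; rewrite -subr_eq0; apply/eqP; apply: tangent_inj.
  rewrite -scaleN1r; apply: tangentD => //; apply: tangentZ.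
  by apply: tangent_sum => k; apply: tangentZ; apply: tangent_frame.
by move=> i; rewrite -scaleN1r zcoordD zcoordZ zcoord_frame mulN1r subrr.
Qed.

(** The velocity of the right-hand side depends linearly on w, so it suffices to
    combine the directions w_k. *)
Lemma tangent_onto v : tangent Y (phi u) v ->
  exists w', velocity (fun t => phi (u + t *: w')) v.
Proof.
move=> tv; have [Phi PhiP] := parametrization_coords phiP.
exists (\sum_k zcoord (iota k) v *: w k).
suff vE : v = of_coords (fun j => dpeval (Phi j) u (\sum_k zcoord (iota k) v *: w k)).
  by rewrite [X in velocity _ X]vE; apply: velocity_differential.
rewrite [LHS]tangent_decomp //; apply: zcoord_inj => j; rewrite zcoord_of_coords.
have d0 : dpeval (Phi j) u 0 = 0 by rewrite -(scale0r 0) dpevalZ mul0r.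
rewrite (big_morph (dpeval (Phi j) u) (dpevalD _ _) d0) zcoord_sum.
apply: eq_bigr => k _; rewrite zcoordZ dpevalZ; congr (_ * _).
have [/velocity_uniq/(_ (velocity_differential u (w k) PhiP)) -> _] := we k.
by rewrite zcoord_of_coords.
Qed.

Lemma tangent_space : exists2 T : {vspace W},
  forall v, v \in T <-> tangent Y (phi u) v & \dim T = m.
Proof.
pose X := [tuple e k | k < m]; exists <<X>>%VS => [v|].
  split=> [/coord_span ->|tv].
    apply: tangent_sum => k; apply: tangentZ.
    by rewrite -tnth_nth tnth_mktuple; apply: tangent_frame.
  rewrite (tangent_decomp tv); apply: rpred_sum => k _; apply: rpredZ.
  by apply: memv_span; apply/tnthP; exists k; rewrite tnth_mktuple.
suff : free X by rewrite /free size_tuple => /eqP.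
apply/freeP => c c0 i; have := zcoord_frame c i.
under eq_bigr => k _ do rewrite -(tnth_mktuple e k) (tnth_nth 0).
by rewrite c0 zcoord0.
Qed.

(** The closures of the images of the affine subspaces through u spanned by the
    first directions w_k form a chain. It is strictly increasing since the first k + 1 distinguished coordinates are
    independent on the image of k + 1 directions, while any k + 1 functions are
    dependent on the image of k directions. *)
Lemma chain_exists : exists Z, irr_chain Y (phi u) m Z.
Proof.
pose w' (i : nat) : U := oapp w 0 (insub i).
have w'E (i : 'I_m) : w' i = w i by rewrite /w' valK.
pose psi k (t : 'rV[K]_k) : W := phi (u + \sum_(i < k) t 0 i *: w' i).
have psiP k : poly_map (@psi k).
  apply: poly_map_comp phiP _; apply: poly_mapD; first exact: poly_map_cst.
  apply: poly_map_sum => i; apply: poly_mapZ; last exact: poly_map_cst.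
  by apply: poly_fun_linear => *; rewrite mxE.
exists (fun k => zclosure (range (@psi k))); split=> [k _|k lt_km].
  split; first exact: zirreducible_range.
    apply: sub_zclosure; exists 0 => //; rewrite /psi big1 ?addr0 // => i _.
    by rewrite mxE scale0r.
  by apply: zclosure_sub => _ [t _ <-]; exists (u + \sum_(i < k) t 0 i *: w' i).
split=> [|sub].
  apply: zclosure_sub => _ [t _ <-]; exists (\row_i fext (t 0) 0 i) => //.
  rewrite /psi big_ord_recr /= mxE fext_max scale0r addr0; congr (phi (_ + _)).
  by apply: eq_bigr => i _; rewrite mxE fext_widen.
pose kap (i : 'I_k.+1) := iota (widen_ord lt_km i).
have [G GP] := choice (fun i => psiP k.+1 (kap i)).
have [H HP] := choice (fun i => psiP k (kap i)).
have indG : alg_indep G.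
  apply: (@alg_indep_jacobian _ _ _ _ (fun j => zcoord j (0 : 'rV[K]_k.+1))).
  apply/row_freeP; exists (\matrix_(l, j) zcoord l (delta_mx 0 j : 'rV[K]_k.+1)).
  apply/matrixP => i j; rewrite !mxE.
  have [vel_j ej] := we (widen_ord lt_km j).
  have -> : (i == j)%:R = zcoord (kap i) (e (widen_ord lt_km j)).
    by rewrite ej -!val_eqE.
  under eq_bigr do rewrite !mxE.
  have := has_deriv_peval (G i) (velocity_line 0 (delta_mx 0 j : 'rV[K]_k.+1)).
  rewrite scale0r addr0 => dG; apply: has_deriv_uniq dG _.
  apply: eq_has_deriv (vel_j (kap i)) => t; rewrite -GP; congr (zcoord _ (phi (_ + _))).
  rewrite (bigD1 j) //= big1 => [|l lj].
    by rewrite !mxE !eqxx mulr1 add0r addr0 -[j : nat]/(val (widen_ord lt_km j)) w'E.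
  by rewrite !mxE (negbTE lj) andbF mulr0 addr0 scale0r.
have /existsNP[F /not_implyP[HF nzF]] : ~ alg_indep H.
  by move=> /alg_indep_leq; rewrite dimvf /dim /= mul1n ltnn.
apply: nzF; apply: indG; apply: peval_eq0 => t.
pose R y := peval (subst (fun i => 'X_(kap i)) F : poly_on W) y.
have RE k' (Q : 'I_k.+1 -> poly_on 'rV[K]_k') t' :
    (forall i, (fun x => zcoord (kap i) (psi k' x)) =1 peval (Q i)) ->
    R (psi k' t') = peval (subst Q F) t'.
  move=> QP; rewrite /R /peval !meval_subst; apply: meval_eq => i.
  by rewrite mevalXU -/(peval _ _) -QP.
rewrite -(RE _ _ _ GP).
apply: (zclosure_poly_fun (S := range (@psi k)) (h := R)).
- exact: poly_fun_peval.
- by move=> _ [t' _ <-]; rewrite (RE _ _ _ HP) HF /peval meval0.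
by apply: sub; apply: sub_zclosure; exists t.
Qed.

End AtPoint.

(** The rank m of the differential bounds the length of chains through the point: a
    chain of length k gives k independent functions on the closure, whose
    Jacobian matrix, pulled back to the parameters, has rank k at a generic
    parameter and factors through the tangent space there. *)
Lemma generic_regular : exists2 d : poly_on U, d != 0 &
  forall u, peval d u != 0 -> regular_point Y (phi u) /\
    forall v, tangent Y (phi u) v ->
      exists w, velocity (fun t => phi (u + t *: w)) v.
Proof.
have [d [m [iota [nzd dP]]]] := generic_tangent phiP; exists d => // u du.
have [inj_u [w [e we]]] := dP u du; split; last exact: tangent_onto inj_u w e we.
split; first by apply: sub_zclosure; exists u.
have [T TP dimT] := tangent_space inj_u we; exists T; split=> //; rewrite dimT.
split; first exact: chain_exists we.
move=> k Z chZ; have [g gP] := irr_chain_alg_indep chZ.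
have [Phi PhiP] := parametrization_coords phiP.
have ind_g : alg_indep (fun i => subst Phi (g i)).
  move=> F F0; apply: gP => y Zy.
  have [/(_ k (leqnn k))[_ _ /(_ y Zy) Yy] _] := chZ.
  apply: (zclosure_poly_fun (poly_fun_peval _) _ Yy) => _ [u' _ <-].
  by rewrite (vanishing_subst _ PhiP) subst_comp F0 /peval meval0.
have [d1 nzd1 d1P] := jacobian_row_free ind_g.
have [u'] := exists_peval_neq0 (mulf_neq0 nzd nzd1 : d * d1 != 0).
rewrite /peval mevalM mulf_eq0 negb_or => /andP[nz nz1].
have [inj_u' [w' [e' we']]] := dP u' nz.
pose b l : U := of_coords (fun j => (j == l)%:R).
have [v vP] := choice (fun l => poly_map_velocity u' (b l) phiP).
have JE : jacobian (fun i => subst Phi (g i)) (fun j => zcoord j u') =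
    (\matrix_(i, k) dpeval (g i) (phi u') (e' k)) *m
    (\matrix_(k, l) zcoord (iota k) (v l)).
  apply/matrixP => i l; rewrite !mxE.
  have dg : has_deriv (fun t => peval (g i) (phi (u' + t *: b l)))
      (dpeval (g i) (phi u') (v l)).
    by have := has_deriv_peval (g i) (vP l); rewrite scale0r addr0.
  have dg' : has_deriv (fun t => peval (g i) (phi (u' + t *: b l)))
      (((subst Phi (g i))^`M(l)).@[fun j => zcoord j u']).
    have := has_deriv_peval (subst Phi (g i)) (velocity_line u' (b l)).
    rewrite scale0r addr0 /dpeval (bigD1 l) //= zcoord_of_coords eqxx mulr1.
    rewrite big1 ?addr0 => [|j jl]; last by rewrite zcoord_of_coords (negbTE jl) mulr0.
    by apply: eq_has_deriv => t; rewrite (vanishing_subst _ PhiP).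
  rewrite (has_deriv_uniq dg' dg) [in LHS](tangent_decomp inj_u' we' (tangent_image (vP l))).
  have d0 : dpeval (g i) (phi u') 0 = 0 by rewrite -(scale0r 0) dpevalZ mul0r.
  rewrite (big_morph (dpeval (g i) (phi u')) (dpevalD _ _) d0).
  by apply: eq_bigr => k' _; rewrite dpevalZ !mxE mulrC.
have /eqP <- := d1P _ nz1; rewrite JE.
exact: leq_trans (mxrankM_maxl _ _) (rank_leq_col _).
Qed.

End GenericRegularity.

(** * Monic minimal relations over a polynomial ring *)

(** Division without inverting the leading coefficient. *)
Lemma pseudo_division (R : comNzRingType) (P d : {poly R}) : d != 0 ->
  exists k Q S, lead_coef d ^+ k *: P = Q * d + S /\ (size S < size d)%N.
Proof.
move=> nzd; exists (Pdiv.Ring.rscalp P d), (Pdiv.Ring.rdivp P d), (Pdiv.Ring.rmodp P d).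
by rewrite Pdiv.ComRing.rdivp_eq Pdiv.Ring.ltn_rmodp.
Qed.

Lemma scale_poly_inj (R : idomainType) (a : R) (P Q : {poly R}) :
  a != 0 -> a *: P = a *: Q -> P = Q.
Proof. by move=> nza; rewrite -!mul_polyC; apply: mulfI; rewrite polyC_eq0. Qed.

Section MonicRelations.
Variables (K : numClosedFieldType).

Lemma coef_factor (F : {poly {poly K}}) t0 :
  map_poly (horner_eval t0) F = 0 -> exists F1, F = ('X - t0%:P) *: F1.
Proof.
move=> /polyP F0; have /choice[c cP] : forall i, exists c, F`_i = c * ('X - t0%:P).
  move=> i; apply/factor_theorem; rewrite /root.
  by have := F0 i; rewrite coef0 coef_map /= /horner_eval => ->.
exists (\poly_(i < size F) c i); apply/polyP => i; rewrite coefZ coef_poly.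
case: ltnP => [_|le_i]; first by rewrite cP mulrC.
by rewrite mulr0 nth_default.
Qed.

(** Gauss's lemma over K[t], by removing the roots of e one by one. *)
Lemma monic_factor_primitive (e : {poly K}) (G F Q : {poly {poly K}}) :
  e != 0 -> G \is monic -> e *: G = F * Q ->
  exists M : {poly {poly K}}, F = lead_coef F *: M.
Proof.
have [k] := ubnP (size e); elim: k e F Q => // k IHk e F Q lt_k nze monG eqG.
have [/size_poly1P[c nzc ec]|/closed_rootP[t0 et0]] := boolP (size e == 1%N).
  have : lead_coef (F * Q) = c%:P by rewrite -eqG lead_coefZ (monicP monG) mulr1.
  rewrite lead_coefM => leadFQ.
  have unitF : lead_coef F \is a GRing.unit.
    have: lead_coef F * lead_coef Q \is a GRing.unit.
      by rewrite leadFQ poly_unitE size_polyC nzc coefC eqxx unitfE.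
    by rewrite unitrM => /andP[].
  by exists ((lead_coef F)^-1 *: F); rewrite scalerA divrr // scale1r.
have [e1 e1E] := factor_theorem _ _ et0.
have nze1 : e1 != 0 by apply: contraNneq nze => e10; rewrite e1E e10 mul0r.
have nzX : 'X - t0%:P != 0 :> {poly K} by rewrite polyXsubC_eq0.
have lt1 : (size e1 < k)%N.
  rewrite -ltnS (leq_trans _ lt_k) // ltnS e1E size_Mmonic ?monicXsubC //.
  by rewrite size_XsubC addn2.
have : map_poly (horner_eval t0) F * map_poly (horner_eval t0) Q = 0.
  rewrite -rmorphM -eqG; apply/polyP => i; rewrite coef_map coefZ /= /horner_eval.
  by rewrite hornerM (eqP et0) mul0r coef0.
move/eqP; rewrite mulf_eq0 => /orP[] /eqP/coef_factor[H HE].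
  have [M ME] : exists M : {poly {poly K}}, H = lead_coef H *: M.
    apply: (IHk e1 H Q) => //; apply: (scale_poly_inj nzX).
    by rewrite scalerA mulrC -e1E eqG HE scalerAl.
  by exists M; rewrite {1}HE {1}ME HE lead_coefZ scalerA.
apply: (IHk e1 F H) => //; apply: (scale_poly_inj nzX).
by rewrite scalerA mulrC -e1E eqG HE scalerAr.
Qed.

Variables (d : nat).
Implicit Types (F a b : {mpoly K[d]}) (v z : 'I_d -> K).

(** The restriction of polynomials to the line through z in direction v, and its
    generic version, where z is the point with indeterminate coordinates. *)
Definition line_subst z v : {mpoly K[d]} -> {poly K} :=
  mmap polyC (fun i => (z i)%:P + v i *: 'X).

HB.instance Definition _ z v := GRing.RMorphism.on (line_subst z v).

Definition shift_subst v : {mpoly K[d]} -> {poly {mpoly K[d]}} :=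
  mmap (polyC \o @mpolyC d K) (fun i => ('X_i)%:P + (v i)%:MP *: 'X).

HB.instance Definition _ v := GRing.RMorphism.on (shift_subst v).

Lemma horner_line_subst z v F t :
  (line_subst z v F).[t] = F.@[fun i => z i + t * v i].
Proof.
apply: (mpoly_rmorph_ext (phi := horner_eval t \o line_subst z v)
  (psi := meval (fun i => z i + t * v i))) => [c|i] /=; rewrite /horner_eval.
  by rewrite mevalC /line_subst mmapC hornerC.
by rewrite mevalXU /line_subst mmapX mmap1U !hornerE mulrC.
Qed.

Lemma map_shift_subst z v F :
  map_poly (meval z) (shift_subst v F) = line_subst z v F.
Proof.
apply: (mpoly_rmorph_ext (phi := map_poly (meval z) \o shift_subst v)
  (psi := line_subst z v)) => [c|i] /=.
  by rewrite /line_subst /shift_subst !mmapC /= map_polyC /= mevalC.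
rewrite /line_subst /shift_subst !mmapX !mmap1U rmorphD /= map_polyC map_polyZ.
by rewrite map_polyX /= mevalXU mevalC.
Qed.

Lemma horner0_shift_subst v F : (shift_subst v F).[0] = F.
Proof.
apply: (mpoly_rmorph_ext (phi := horner_eval 0 \o shift_subst v) (psi := idfun))
  => [c|i] /=; rewrite /horner_eval /shift_subst.
  by rewrite mmapC hornerC.
by rewrite mmapX mmap1U !hornerE.
Qed.

(** The value c may be zero: unlike a leading coefficient, it is multiplicative
    over any ring. *)
Definition leads_by (R : comNzRingType) (P : {poly R}) k c :=
  (size P <= k.+1)%N /\ P`_k = c.

Lemma leads_byM (R : comNzRingType) (P Q : {poly R}) k l c e :
  leads_by P k c -> leads_by Q l e -> leads_by (P * Q) (k + l) (c * e).
Proof.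
move=> [sP <-] [sQ <-]; split.
  rewrite (leq_trans (size_polyMleq _ _)) // -subn1 leq_subLR.
  by rewrite (leq_trans (leq_add sP sQ)) // addSn addnS.
rewrite coefM (bigD1 (inord k)) //= inordK ?ltnS ?leq_addr // addKn big1 ?addr0 //.
move=> j /eqP jk; have [lt_j|le_j] := ltnP k j.
  by rewrite (nth_default _ (leq_trans sP lt_j)) mul0r.
rewrite [X in _ * X]nth_default ?mulr0 // (leq_trans sQ) //.
have lt_jk : (j < k)%N.
  rewrite ltn_neqAle le_j andbT; apply/eqP => E; apply: jk; apply: val_inj.
  by rewrite /= inordK ?ltnS ?leq_addr.
by rewrite ltn_subRL ltn_add2r.
Qed.

(** The homogeneous part of degree k of F, evaluated at v. *)
Definition top_form k F v : K :=
  \sum_(m <- msupp F | mdeg m == k) F@_m * \prod_i v i ^+ m i.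

Lemma shift_subst_leads v F k : (msize F <= k.+1)%N ->
  leads_by (shift_subst v F) k (top_form k F v)%:MP.
Proof.
move=> le_F; rewrite /shift_subst /mmap /top_form.
have leadX i : leads_by (('X_i)%:P + (v i)%:MP *: 'X : {poly {mpoly K[d]}}) 1 (v i)%:MP.
  split; last by rewrite coefD coefC coefZ coefX mulr1 add0r.
  rewrite (leq_trans (size_polyD _ _)) // geq_max size_polyC.
  rewrite (leq_trans (leq_b1 _)) //= (leq_trans (size_scale_leq _ _)) //.
  by rewrite size_polyX.
have lead1 (R : comNzRingType) : leads_by (1 : {poly R}) 0 1.
  by split; rewrite ?size_poly1 // coef1.
have leadXn i (a : nat) : leads_by ((('X_i)%:P + (v i)%:MP *: 'X : {poly {mpoly K[d]}}) ^+ a)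
    a (v i ^+ a)%:MP.
  elim: a => [|a IHa]; first by rewrite !expr0.
  by rewrite !exprS mpolyCM -add1n; apply: leads_byM.
have leadm (m : 'X_{1..d}) : leads_by (mmap1 (fun i => ('X_i)%:P + (v i)%:MP *: 'X) m
    : {poly {mpoly K[d]}}) (mdeg m) (\prod_i v i ^+ m i)%:MP.
  rewrite mdegE /mmap1 rmorph_prod /=.
  elim/big_rec3: _ => [|i c e P _ IH]; first exact: lead1.
  exact: leads_byM (leadXn i (m i)) IH.
rewrite raddf_sum /= [X in leads_by _ _ X]big_mkcond /=.
pose term (m : 'X_{1..d}) : {poly {mpoly K[d]}} :=
  (F@_m)%:MP%:P * mmap1 (fun i => ('X_i)%:P + (v i)%:MP *: 'X) m.
have leC (m : 'X_{1..d}) : m \in msupp F -> leads_by (term m) k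
    (if mdeg m == k then (F@_m * \prod_i v i ^+ m i)%:MP else 0).
  move=> mF; have [sz co] := leadm m.
  have sz' : (size (term m) <= (mdeg m).+1)%N.
    by rewrite /term mul_polyC (leq_trans (size_scale_leq _ _)).
  have lem : (mdeg m <= k)%N.
    by rewrite -ltnS (leq_trans (msize_mdeg_lt mF)).
  split; first by rewrite (leq_trans sz').
  case: eqP => [<-|/eqP nk]; first by rewrite /term mul_polyC coefZ co mpolyCM.
  by rewrite nth_default // (leq_trans sz') // ltn_neqAle nk.
rewrite !big_seq; elim/big_rec2: _ => [|m c P mF [sz co]].
  by split; rewrite ?size_poly0 ?coef0.
have [sz' co'] := leC m mF; split; last by rewrite coefD co' co.
by rewrite (leq_trans (size_polyD _ _)) // geq_max sz' sz.
Qed.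

Lemma exists_top_form F (G : {mpoly K[d]}) : F != 0 -> G != 0 ->
  exists v, top_form (msize F).-1 F v != 0 /\ G.@[v] != 0.
Proof.
move=> nzF nzG; pose k := (msize F).-1.
pose T : {mpoly K[d]} := \sum_(m <- msupp F | mdeg m == k) F@_m *: 'X_[m].
have TE v : T.@[v] = top_form k F v.
  by rewrite /T raddf_sum /=; apply: eq_bigr => m _; rewrite mevalZ mevalX.
have nzT : T != 0.
  apply/eqP => /(congr1 (mcoeff (mlead F))); rewrite mcoeff0 raddf_sum /=.
  rewrite -big_filter (bigD1_seq (mlead F)) ?filter_uniq ?msupp_uniq //=; last first.
    by rewrite mem_filter mlead_supp // andbT -eqSS mlead_deg // /k -mpolySpred.
  rewrite mcoeffZ mcoeffX eqxx mulr1 big1 ?addr0 => [|m nm].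
    by move/eqP; rewrite mleadc_eq0 (negbTE nzF).
  by rewrite mcoeffZ mcoeffX (negbTE nm) mulr0.
have [v] := exists_eval_neq0 (mulf_neq0 nzT nzG).
by rewrite mevalM mulf_eq0 negb_or TE => nz; exists v; apply/andP.
Qed.

(** Shifting along a direction where the top form of a does not vanish makes a
    monic up to a scalar; the remainder of the division of b by a then vanishes
    because it vanishes on all lines in that direction. *)
Lemma dvd_on_lines a b : a != 0 ->
  (forall z v, line_subst z v a != 0 ->
     exists q, line_subst z v b = line_subst z v a * q) ->
  exists c, b = a * c.
Proof.
move=> nza dvd; have [v [nzv _]] := exists_top_form nza nza.
set k := (msize a).-1 in nzv; pose c := top_form k a v.
have [sz co] : leads_by (shift_subst v a) k c%:MP.
  by apply: shift_subst_leads; rewrite -mpolySpred.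
have nzc : c%:MP != 0 :> {mpoly K[d]} by rewrite mpolyC_eq0.
have szA : size (shift_subst v a) = k.+1.
  by apply/eqP; rewrite eqn_leq sz ltnNge; apply: contra nzc => ?; rewrite -co nth_default.
pose A := (c^-1)%:MP *: shift_subst v a.
have monA : A \is monic.
  rewrite monicE lead_coefZ lead_coefE szA co -mpolyCM mulVf ?mpolyC1 //.
have aA : shift_subst v a = c%:MP *: A.
  by rewrite scalerA -mpolyCM mulfV // mpolyC1 scale1r.
have := Pdiv.RingMonic.rdivp_eq monA (shift_subst v b).
set q := Pdiv.CommonRing.rdivp _ _; set r := Pdiv.CommonRing.rmodp _ _ => bqr.
have r0 : r = 0.
  apply/polyP => i; rewrite coef0; apply: mpoly_eq_eval0 => z.
  suff rz0 : map_poly (meval z) r = 0 by move/polyP/(_ i): rz0; rewrite coef_map coef0.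
  have monAz : map_poly (meval z) A \is monic by apply: monic_map.
  have lineA : line_subst z v a = c *: map_poly (meval z) A.
    by rewrite -map_shift_subst aA map_polyZ /= mevalC.
  have [|s sP] := dvd z v.
    by rewrite lineA scaler_eq0 negb_or nzv monic_neq0.
  have := congr1 (map_poly (meval z)) bqr.
  rewrite map_shift_subst sP lineA rmorphD rmorphM /= => E.
  have {}E : map_poly (meval z) r = (c *: s - map_poly (meval z) q) * map_poly (meval z) A.
    by rewrite mulrBl -scalerAl [s * _]mulrC scalerAl E addrC addKr.
  apply/eqP; apply: contraT => nzr.
  have nzs : c *: s - map_poly (meval z) q != 0.
    by apply: contraNneq nzr => s0; rewrite E s0 mul0r.
  have : (size (map_poly (meval z) r) < size (map_poly (meval z) A))%N.
    rewrite (leq_ltn_trans (size_poly _ _)) //.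
    rewrite size_map_poly_id0 ?(monicP monA) ?rmorph1 ?oner_eq0 //.
    by rewrite Pdiv.Ring.ltn_rmodp monic_neq0.
  rewrite E size_Mmonic //; rewrite -size_poly_gt0 in nzs.
  by rewrite -(prednK nzs) addSn /= ltnNge leq_addl.
exists ((c^-1)%:MP * q.[0]).
rewrite -[LHS](horner0_shift_subst v) bqr r0 addr0 hornerM /A hornerZ.
by rewrite horner0_shift_subst mulrC mulrAC -mulrA mulrC -!mulrA [q.[0] * _]mulrC mulrA.
Qed.

End MonicRelations.

Lemma horner_map_division (R S : comNzRingType) (phi : {rmorphism R -> S})
    (a : R) (P Q d r : {poly R}) x : a *: P = Q * d + r ->
  phi a * (map_poly phi P).[x] =
    (map_poly phi Q).[x] * (map_poly phi d).[x] + (map_poly phi r).[x].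
Proof.
by move=> /(congr1 (map_poly phi)); rewrite map_polyZ rmorphD rmorphM /=
  => /(congr1 (horner^~ x)); rewrite hornerZ hornerD hornerM.
Qed.

(** * Specialization of relations, and open subsets of images *)

Section Specialization.
Variables (K : numClosedFieldType) (N : nat).
Local Notation D := {mpoly K[N]}.

(** The point q lies in the Zariski closure of the image of f. *)
Definition specializes m (f : 'I_m -> D) (q : 'I_m -> K) : Prop :=
  forall F, subst f F = 0 -> F.@[q] = 0.

Lemma minimal_for_neq0 m (f : 'I_m -> D) b P : minimal_for f b P -> P != 0.
Proof. by case=> nz _ _; apply: contraNneq nz => ->; rewrite lead_coef0 rmorph0. Qed.

Lemma minimal_for_size m (f : 'I_m -> D) b P : minimal_for f b P -> (1 < size P)%N.
Proof.
case=> nz Pb _; rewrite ltnNge; apply: contraL Pb => /size1_polyC P1.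
by move: nz; rewrite P1 lead_coefC => nz; rewrite map_polyC rootC.
Qed.

Lemma map_specialize0 m (f : 'I_m -> D) q (P : {poly {mpoly K[m]}}) :
  specializes f q -> map_poly (subst f) P = 0 -> map_poly (meval q) P = 0.
Proof.
move=> fq /polyP P0; apply/polyP => i; rewrite coef0 coef_map.
by apply: fq; have := P0 i; rewrite coef0 coef_map.
Qed.

(** The minimal relation F of w divides the monic relation G up to a power of its
    leading coefficient a; on every line, Gauss's lemma shows that a divides all
    coefficients of F, hence it divides them as polynomials. *)
Lemma monic_relation d (z : 'I_d -> D) w : alg_indep z ->
  integralOver (subst z) w -> exists2 M, M \is monic & minimal_for z w M.
Proof.
move=> ind_z [G monG Gw].
have [|F minF] := @minimal_relation K N d z w.
  exists G => //; apply: monic_neq0; exact: monic_map.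
have nzF := minimal_for_neq0 minF; have [nza Fw minF'] := minF.
set a := lead_coef F in nza.
have nza' : a != 0 by rewrite lead_coef_eq0.
have [k [Q [S [GQ ltS]]]] := pseudo_division G nzF.
have S0 : S = 0.
  apply: (map_subst_inj0 ind_z); apply: (minF' S ltS).
  have := horner_map_division (subst z) w GQ.
  by rewrite (eqP Gw) (eqP Fw) !mulr0 add0r => E; rewrite /root -E.
move: GQ; rewrite S0 addr0 mulrC -/a => GQ.
have /choice[c cP] : forall i, exists c, F`_i = a * c.
  move=> i; apply: dvd_on_lines => // x v nzl.
  have := congr1 (map_poly (line_subst x v)) GQ.
  rewrite map_polyZ rmorphM /= rmorphXn /= => E.
  have lF : lead_coef (map_poly (line_subst x v) F) = line_subst x v a.
    by rewrite lead_coef_map_eq.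
  have [|M ME] := monic_factor_primitive _ (monic_map _ monG) E.
    by rewrite expf_neq0.
  exists M`_i; have := congr1 (fun P : {poly {poly K}} => P`_i) ME.
  by rewrite lF coefZ coef_map.
pose M : {poly {mpoly K[d]}} := \poly_(i < size F) c i.
have FM : F = a *: M.
  apply/polyP => i; rewrite coefZ coef_poly; case: ltnP => [_|le_i]; first exact: cP.
  by rewrite mulr0 nth_default.
have szM : size M = size F by rewrite FM size_scale.
have monM : M \is monic.
  have : a = a * lead_coef M by rewrite {1}/a {1}FM lead_coefZ.
  rewrite -{1}[a]mulr1 => /(mulfI nza') E; by rewrite monicE -E.
exists M; first exact: monM.
split.
- by rewrite (monicP monM) rmorph1 oner_neq0.
- have := Fw; rewrite FM map_polyZ /root hornerZ mulf_eq0 => /orP[a0|Mw]; last exact: Mw.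
  by case/negP: nza.
by rewrite szM.
Qed.

Lemma minimal_for_leq m (f : 'I_m -> D) b P (Q : {poly {mpoly K[m]}}) :
  minimal_for f b P -> root (map_poly (subst f) Q) b ->
  map_poly (subst f) Q != 0 -> (size P <= size (map_poly (subst f) Q))%N.
Proof.
move=> [_ _ minP] Qb nzQ; rewrite leqNgt; apply/negP => lt_QP.
pose Q' : {poly {mpoly K[m]}} := \poly_(i < size (map_poly (subst f) Q)) Q`_i.
have QQ' : map_poly (subst f) Q' = map_poly (subst f) Q.
  apply/polyP => i; rewrite coef_map coef_poly; case: ltnP => le_i.
    by rewrite coef_map.
  by rewrite raddf0 nth_default.
case/eqP: nzQ; rewrite -QQ'; apply: minP; last by rewrite QQ'.
exact: leq_ltn_trans (size_poly _ _) lt_QP.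
Qed.

(** Euclid's algorithm for h and the minimal relation P of b, over the ring
    generated by f: the ideal they generate contains, modulo relations between
    the entries of f, a nonzero constant. *)
Lemma minimal_bezout m (f : 'I_m -> D) b P (h : {poly {mpoly K[m]}}) :
  minimal_for f b P -> (map_poly (subst f) h).[b] != 0 ->
  exists (A B Z : {poly {mpoly K[m]}}) e, [/\ subst f e != 0,
    map_poly (subst f) Z = 0 & A * h + B * P + Z = e%:P].
Proof.
move=> minP nzhb.
pose good (E : {poly {mpoly K[m]}}) := map_poly (subst f) E != 0 /\
  exists A B Z, map_poly (subst f) Z = 0 /\ A * h + B * P + Z = E.
have [|E [nzE [A [B [Z [Z0 EE]]]]] minE] := @minimal_witness _ good (fun E => size E).
  exists h; split; first by apply: contraNneq nzhb => ->; rewrite horner0.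
  by exists 1, 0, 0; rewrite rmorph0 mul1r mul0r !addr0.
have minE' (S : {poly {mpoly K[m]}}) A' B' Z' : (size S < size E)%N ->
    map_poly (subst f) Z' = 0 -> A' * h + B' * P + Z' = S -> map_poly (subst f) S = 0.
  move=> lt_S Z'0 SE; apply/eqP; apply: contraT => nzS.
  have : good S by split=> //; exists A', B', Z'.
  by move/minE; rewrite leqNgt lt_S.
have nzE' : E != 0 by apply: contraNneq nzE => ->; rewrite rmorph0.
have nzlead : subst f (lead_coef E) != 0.
  apply/eqP => lead0; case/eqP: nzE.
  pose S := E - lead_coef E *: 'X^((size E).-1).
  have -> : map_poly (subst f) E = map_poly (subst f) S.
    by rewrite /S rmorphB /= map_polyZ /= lead0 scale0r subr0.
  apply: (minE' S A B (Z - lead_coef E *: 'X^((size E).-1))); last by rewrite addrA EE.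
    rewrite -(prednK (_ : 0 < size E)%N) ?size_poly_gt0 // ltnS.
    apply/leq_sizeP => j; rewrite leq_eqVlt => /orP[/eqP <-|lt_j].
      by rewrite coefB coefZ coefXn eqxx mulr1 subrr.
    rewrite coefB coefZ coefXn (gtn_eqF lt_j) mulr0 subr0 nth_default //.
    by rewrite -(prednK (_ : 0 < size E)%N) ?size_poly_gt0.
  by rewrite rmorphB /= map_polyZ /= lead0 scale0r subr0.
(* By minimality, E divides h and P up to powers of its leading coefficient. *)
have divE (T : {poly {mpoly K[m]}}) : (exists A' B', A' * h + B' * P = T) ->
    exists k Q, subst f (lead_coef E) ^+ k *: map_poly (subst f) T =
      map_poly (subst f) Q * map_poly (subst f) E.
  move=> [A' [B' TE]]; have [k [Q [S [TQ ltS]]]] := pseudo_division T nzE'.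
  exists k, Q; have S0 : map_poly (subst f) S = 0.
    apply: (minE' S ((lead_coef E ^+ k)%:P * A' - Q * A)
      ((lead_coef E ^+ k)%:P * B' - Q * B) (- (Q * Z))) => //.
      by rewrite rmorphN rmorphM /= Z0 mulr0 oppr0.
    have -> : S = (lead_coef E ^+ k)%:P * T - Q * E by rewrite mul_polyC TQ addrC addKr.
    by rewrite -TE -EE; ring.
  have := congr1 (map_poly (subst f)) TQ.
  by rewrite map_polyZ rmorphXn rmorphD rmorphM /= S0 addr0.
have [|kh [Qh Eh]] := divE h; first by exists 1, 0; rewrite mul1r mul0r addr0.
have [|kP [QP EP]] := divE P; first by exists 0, 1; rewrite mul1r mul0r add0r.
have nzEb : (map_poly (subst f) E).[b] != 0.
  have : subst f (lead_coef E) ^+ kh * (map_poly (subst f) h).[b] != 0.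
    by rewrite mulf_neq0 // expf_neq0.
  by rewrite -hornerZ Eh hornerM mulf_eq0 negb_or => /andP[].
have [nzP Pb _] := minP.
have nzmP : map_poly (subst f) P != 0.
  by apply: contraNneq nzP => /polyP/(_ (size P).-1); rewrite coef0 coef_map => ->.
(* The cofactor of E in P vanishes at b, so it has the degree of P. *)
have QPb : root (map_poly (subst f) QP) b.
  have := congr1 (horner^~ b) EP; rewrite hornerZ (eqP Pb) mulr0 hornerM => /esym/eqP.
  by rewrite mulf_eq0 (negbTE nzEb) orbF.
have nzQP : map_poly (subst f) QP != 0.
  apply: contraNneq (_ : subst f (lead_coef E) ^+ kP *: map_poly (subst f) P != 0).
    by move=> E0; rewrite EP E0 mul0r.
  by rewrite -mul_polyC mulf_neq0 // polyC_eq0 expf_neq0.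
have szE : (size (map_poly (subst f) E) <= 1)%N.
  have := minimal_for_leq minP QPb nzQP.
  have szP : size (map_poly (subst f) P) = size P by rewrite size_map_poly_id0.
  have : size (subst f (lead_coef E) ^+ kP *: map_poly (subst f) P) = size P.
    by rewrite size_scale ?expf_neq0.
  rewrite EP size_mul // => <-; rewrite -subn1 leq_subLR => le1.
  by rewrite -(leq_add2l (size (map_poly (subst f) QP))) [leqRHS]addnC.
have {}szE : (size E <= 1)%N by rewrite size_map_poly_id0 in szE.
have EC := size1_polyC szE.
exists A, B, Z, E`_0; split=> //; last by rewrite EE.
by rewrite -[E`_0]lead_coefC -EC.
Qed.

Lemma exists_horner_neq0 (P : {poly K}) : P != 0 -> exists t, P.[t] != 0.
Proof.
move=> nzP; apply: contrapT => noP; case/eqP: nzP; apply: poly_eq_horner => t.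
by rewrite horner0; apply/eqP; apply: contraT => nz; case: noP; exists t.
Qed.

(** Any relation of b is divisible by the minimal relation P, up to powers of the
    leading coefficient; so every root of P at q extends the specialization. *)
Lemma specializes_root m (f : 'I_m -> D) b P q t : minimal_for f b P ->
  specializes f q -> (lead_coef P).@[q] != 0 -> root (map_poly (meval q) P) t ->
  specializes (fext f b) (fext q t).
Proof.
move=> minP fq nzlead Pt R; rewrite subst_fext meval_fext => Rb.
have [_ Pb minP'] := minP.
have [k [Q [S [RQ ltS]]]] := pseudo_division (muni R) (minimal_for_neq0 minP).
have S0 : map_poly (subst f) S = 0.
  apply: (minP' S ltS).
  have := horner_map_division (subst f) b RQ.
  by rewrite Rb (eqP Pb) !mulr0 add0r => E; rewrite /root -E.
have := horner_map_division (meval q) t RQ.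
rewrite (map_specialize0 fq S0).
rewrite (eqP Pt) horner0 mulr0 addr0 rmorphXn /= => /eqP.
by rewrite mulf_eq0 expf_eq0 (negbTE nzlead) andbF => /eqP.
Qed.

(** Where the Bezout constant does not vanish, h and P have no common root. *)
Lemma bezout_specialize m (f : 'I_m -> D) b P (h : {poly {mpoly K[m]}}) :
  minimal_for f b P -> (map_poly (subst f) h).[b] != 0 ->
  exists2 e, subst f e != 0 & forall q t, specializes f q -> e.@[q] != 0 ->
    root (map_poly (meval q) P) t -> (map_poly (meval q) h).[t] != 0.
Proof.
move=> minP /(minimal_bezout minP)[A [B [Z [e [nze Z0 eE]]]]].
exists e => // q t fq nzeq Pt; apply: contraNneq nzeq => h0.
have := congr1 (fun P => (map_poly (meval q) P).[t]) eE.
rewrite !rmorphD !rmorphM /= !hornerD !hornerM (map_specialize0 fq Z0) h0 (eqP Pt).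
by rewrite !mulr0 horner0 !addr0 map_polyC hornerC => <-.
Qed.

(** If b is algebraic over f, the new coordinate is a root of its minimal relation;
    if b is transcendental, almost every value is allowed. *)
Lemma specializes_extend m (f : 'I_m -> D) b (h : {mpoly K[m.+1]}) :
  subst (fext f b) h != 0 ->
  exists2 h', subst f h' != 0 & forall q, specializes f q -> h'.@[q] != 0 ->
    exists2 t, specializes (fext f b) (fext q t) & h.@[fext q t] != 0.
Proof.
rewrite subst_fext => nzh; have [[P minP]|no_alg] := EM (exists P, minimal_for f b P).
  have [e nze eP] := bezout_specialize minP nzh; have [nzP _ _] := minP.
  exists (lead_coef P * e); first by rewrite rmorphM mulf_neq0.
  move=> q fq; rewrite mevalM mulf_eq0 negb_or => /andP[nzPq nzeq].
  have /closed_rootP[t Pt] : size (map_poly (meval q) P) != 1%N.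
    by rewrite size_map_poly_id0 // gtn_eqF // (minimal_for_size minP).
  exists t; first exact: specializes_root minP fq nzPq Pt.
  by rewrite meval_fext; apply: eP.
have trans (R : {poly {mpoly K[m]}}) :
    root (map_poly (subst f) R) b -> map_poly (subst f) R = 0.
  move=> Rb; apply/eqP; apply: contraT => nzR; case: no_alg.
  by have [P PP] := minimal_relation (ex_intro2 _ _ R nzR Rb); exists P.
have : map_poly (subst f) (muni h) != 0.
  by apply: contraNneq nzh => ->; rewrite horner0.
rewrite -lead_coef_eq0 lead_coefE coef_map /=; set k := _.-1 => nzk.
exists (muni h)`_k => // q fq nzq.
have [|t nzt] := @exists_horner_neq0 (map_poly (meval q) (muni h)).
  by apply: contraNneq nzq => /polyP/(_ k); rewrite coef0 coef_map => ->.
exists t; last by rewrite meval_fext.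
move=> R; rewrite subst_fext meval_fext => /eqP/trans/(map_specialize0 fq) ->.
by rewrite horner0.
Qed.

(** The image of a polynomial map contains a nonempty open subset of its
    closure: the parameters are added one at a time to the entries of g. *)
Lemma image_contains_open m (g : 'I_m -> D) : exists2 h, subst g h != 0 &
  forall q, specializes g q -> h.@[q] != 0 -> exists u, forall i, (g i).@[u] = q i.
Proof.
suff claim : forall (r : seq 'I_N) m (g : 'I_m -> D),
    (forall l, l \in r \/ exists i, g i = 'X_l) -> exists2 h, subst g h != 0 &
    forall q, specializes g q -> h.@[q] != 0 -> exists u, forall i, (g i).@[u] = q i.
  by apply: (claim (enum 'I_N)) => l; left; rewrite mem_enum.
elim=> [|l r IHr] {}m {}g gr.
  exists 1 => [|q gq _]; first by rewrite rmorph1 oner_neq0.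
  have /choice[kap kapP] : forall l, exists i, g i = 'X_l.
    by move=> l; case: (gr l) => //.
  exists (q \o kap) => i; apply/eqP; rewrite -subr_eq0.
  have -> : (g i).@[q \o kap] - q i = (subst (fun l => 'X_(kap l)) (g i) - 'X_i).@[q].
    rewrite mevalB mevalXU meval_subst; congr (_ - _).
    by apply: meval_eq => l /=; rewrite mevalXU.
  apply/eqP; apply: gq; rewrite rmorphB /= substX subst_comp.
  suff -> : subst (fun l => subst g 'X_(kap l)) (g i) = g i by rewrite subrr.
  rewrite (@eq_subst _ _ _ _ (fun l => 'X_l)); last by move=> l; rewrite substX.
  apply: (mpoly_rmorph_ext (phi := subst (fun l => 'X_l)) (psi := idfun)) => [c|l] /=.
    by rewrite substC.
  by rewrite substX.
have [l'|h nzh hP] := IHr _ (fext g 'X_l).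
  have [|[i gi]] := gr l'; last by right; exists (lift ord_max i); rewrite fext_lift.
  by rewrite in_cons => /orP[/eqP->|]; [right; exists ord_max; rewrite fext_max|left].
have [h' nzh' h'P] := specializes_extend nzh.
exists h' => // q gq nzq; have [t spec nzt] := h'P q gq nzq.
have [u uP] := hP _ spec nzt; exists u => i.
by have := uP (lift ord_max i); rewrite !fext_lift.
Qed.

End Specialization.

(** * Noether normalization *)

Section NoetherNormalization.
Variables (K : numClosedFieldType) (N : nat).
Local Notation D := {mpoly K[N]}.

Lemma integral_subst d n (z : 'I_d -> D) (f : 'I_n -> D) F :
  (forall j, integralOver (subst z) (f j)) -> integralOver (subst z) (subst f F).
Proof.
move=> intf; rewrite [subst f F](_ : _ = mmap (@mpolyC N K) f F) // /mmap.
apply: big_ind => [|p q ? ?|m _]; [exact: integral0|exact: integral_add|].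
apply: integral_mul; first by rewrite -(substC z); apply: integral_id.
apply: big_ind => [|p q ? ?|i _]; [exact: integral1|exact: integral_mul|].
elim: (m i) => [|k IHk]; first by rewrite expr0; apply: integral1.
by rewrite exprS; apply: integral_mul.
Qed.

Lemma horner_shift_subst n (g : 'I_n -> D) v F s :
  (map_poly (subst g) (shift_subst v F)).[s] =
  subst (fun i => g i + (v i)%:MP * s) F.
Proof.
apply: (mpoly_rmorph_ext
  (phi := horner_eval s \o map_poly (subst g) \o shift_subst v)
  (psi := subst (fun i => g i + (v i)%:MP * s))) => [c|i] /=; rewrite /horner_eval.
  by rewrite /shift_subst mmapC map_polyC hornerC /= !substC.
rewrite substX /shift_subst mmapX mmap1U rmorphD /= map_polyC map_polyZ map_polyX.
by rewrite !hornerE /= substX substC.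
Qed.

(** In a direction where the top form of a relation F does not vanish, F becomes
    an integral dependence relation for the coordinate that is projected away. *)
Lemma noether_normalization n (f : 'I_n -> D) :
  exists d (z : 'I_d -> D) (C : 'I_d -> 'I_n -> K),
  [/\ alg_indep z, forall i, z i = \sum_j (C i j)%:MP * f j &
      forall j, integralOver (subst z) (f j)].
Proof.
elim: n f => [|n IHn] f.
  exists 0%N, f, (fun _ _ => 0); split=> [F|[]//|[]//].
  rewrite (nvar0_mpolyC F) substC => /eqP.
  by rewrite mpolyC_eq0 => /eqP ->; rewrite mpolyC0.
have [ind_f|/existsNP[F /not_implyP[F0 /eqP nzF]]] := EM (alg_indep f).
  exists n.+1, f, (fun i j => (i == j)%:R); split=> // [i|j].
    rewrite (bigD1 i) //= eqxx mpolyC1 mul1r big1 ?addr0 // => j ji.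
    by rewrite eq_sym (negbTE ji) mpolyC0 mul0r.
  by rewrite -(substX f j); apply: integral_id.
(* In the coordinates f' and s, the direction v becomes the direction of s. *)
have [|v [nzc]] := exists_top_form nzF (_ : 'X_ord_max != 0).
  by rewrite -msize_poly_eq0 msizeX.
rewrite mevalXU => nzv; pose s := (v ord_max)^-1%:MP * f ord_max.
pose f' j := f (lift ord_max j) - (v (lift ord_max j))%:MP * s.
have [d [z [C [ind_z zC intz]]]] := IHn f'.
pose g := fext f' 0.
have fE : f =1 (fun i => g i + (v i)%:MP * s).
  move=> i; rewrite /g; case: (unliftP ord_max i) => [j|] ->.
    by rewrite fext_lift subrK.
  by rewrite fext_max add0r /s mulrA -mpolyCM mulfV // mpolyC1 mul1r.
have intg i : integralOver (subst z) (g i).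
  rewrite /g; case: (unliftP ord_max i) => [j|] ->; first by rewrite fext_lift.
  by rewrite fext_max; apply: integral0.
have intC (c : K) : integralOver (subst z) c%:MP.
  by rewrite -(substC z); apply: integral_id.
set k := (msize F).-1 in nzc; set c := top_form k F v in nzc.
have [sz co] : leads_by (shift_subst v F) k c%:MP.
  by apply: shift_subst_leads; rewrite -mpolySpred.
pose P := (c^-1)%:MP *: map_poly (subst g) (shift_subst v F).
have coefP i : P`_i = (c^-1)%:MP * subst g (shift_subst v F)`_i.
  by rewrite coefZ coef_map.
have Pk : P`_k = 1 by rewrite coefP co substC -mpolyCM mulVf // mpolyC1.
have szP : size P = k.+1.
  apply/eqP; rewrite eqn_leq; apply/andP; split.
    by rewrite (leq_trans (size_scale_leq _ _)) // (leq_trans (size_poly _ _)).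
  rewrite ltnNge; apply/negP => /(nth_default 0) Pk0.
  by move: Pk; rewrite Pk0 => /esym/eqP; rewrite oner_eq0.
have ints : integralOver (subst z) s.
  apply: (@integral_root_monic _ _ _ s P).
  - by rewrite monicE lead_coefE szP Pk.
  - rewrite /root hornerZ horner_shift_subst -(eq_subst fE) F0 mulr0 //.
  apply/integral_poly => i; rewrite coefP.
  by apply: integral_mul => //; apply: integral_subst.
exists d, z, (fun i => fext (C i)
  (- \sum_j C i j * (v (lift ord_max j) / v ord_max))); split=> // [i|j].
  rewrite big_fext fext_max zC.
  under eq_bigr => j _ do rewrite /f' mulrBr.
  rewrite sumrB; congr (_ + _).
    by apply: eq_bigr => j _; rewrite fext_lift.
  rewrite mpolyCN mulNr rmorph_sum /= mulr_suml; congr (- _); apply: eq_bigr => j _.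
  by rewrite /s !mpolyCM -!mulrA.
rewrite fE; apply: integral_add => //; exact: integral_mul.
Qed.

End NoetherNormalization.

(** * Small perturbations of polynomials and of their roots *)

Section Perturbation.
Variables (K : numClosedFieldType).
Implicit Types (P : {poly K}) (A B : K -> Prop) (x e d : K).

(** The radii are positive elements of K; such elements are real, hence
    comparable. *)
Definition near_zero (A : K -> Prop) : Prop :=
  exists2 d : K, 0 < d & forall t, `|t| < d -> A t.

Lemma near_zeroI A B : near_zero A -> near_zero B ->
  near_zero (fun t => A t /\ B t).
Proof.
move=> [d d0 dA] [e e0 eB].
have [le_de|le_ed] := orP (real_leVge (gtr0_real d0) (gtr0_real e0)).
  by exists d => // t td; split; [apply: dA|apply: eB; apply: lt_le_trans le_de].
by exists e => // t te; split; [apply: dA; apply: lt_le_trans le_ed|apply: eB].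
Qed.

Lemma near_zero_all (I : finType) (A : I -> K -> Prop) :
  (forall i, near_zero (A i)) -> near_zero (fun t => forall i, A i t).
Proof.
move=> nA; suff [d d0 dA] : near_zero (fun t => forall i, i \in enum I -> A i t).
  by exists d => // t /dA At i; apply: At; rewrite mem_enum.
elim: (enum I) => [|i r IHr]; first by exists 1.
have [d d0 dA] := near_zeroI (nA i) IHr; exists d => // t /dA[Ai Ar] j.
by rewrite in_cons => /orP[/eqP->|/Ar].
Qed.

Lemma near_zeroS A B : (forall t, A t -> B t) -> near_zero A -> near_zero B.
Proof. by move=> AB [d d0 dA]; exists d => // t /dA/AB. Qed.

Lemma near_zero_lt d : 0 < d -> near_zero (fun t : K => `|t| < d).
Proof. by exists d. Qed.

Lemma poly_bounded P : exists2 b, 0 <= b & forall t, `|t| <= 1 -> `|P.[t]| <= b.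
Proof.
elim/poly_ind: P => [|P c [b b0 bP]]; first by exists 0 => // t _; rewrite horner0 normr0.
exists (b + `|c|); first by rewrite addr_ge0.
move=> t t1; rewrite hornerMXaddC (le_trans (ler_normD _ _)) // lerD2r normrM.
by rewrite -[b]mulr1 ler_pM ?bP.
Qed.

Lemma poly_near_zero P e : 0 < e -> near_zero (fun t => `|P.[t] - P.[0]| < e).
Proof.
move=> e0; elim/poly_ind: P => [|P c _].
  by exists 1 => // t _; rewrite !horner0 subr0 normr0.
have [b b0 bP] := poly_bounded P; have b1 : 0 < b + 1 by rewrite ltr_wpDl.
apply: near_zeroS (near_zeroI (near_zero_lt ltr01) (near_zero_lt (divr_gt0 e0 b1))).
move=> t [t1 te]; rewrite !hornerMXaddC mulr0 add0r addrK normrM.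
rewrite ltr_pdivlMr // in te.
apply: le_lt_trans te; rewrite mulrC ler_wpM2l //.
by rewrite (le_trans (bP t (ltW t1))) // lerDl.
Qed.

(** A nonzero polynomial has finitely many roots, and every neighborhood of 0 is
    infinite. *)
Lemma near_zero_neq0 P A : P != 0 -> near_zero A -> exists2 t, P.[t] != 0 & A t.
Proof.
move=> nzP [d d0 dA]; pose rs := [seq d / k.+2%:R | k <- iota 0 (size P)].
have [all_rs|] := boolP (all (root P) rs).
  have := max_poly_roots nzP all_rs; rewrite size_map size_iota ltnn.
  suff uniq_rs : uniq rs by move/(_ uniq_rs).
  rewrite map_inj_uniq ?iota_uniq // => i j /(mulfI (lt0r_neq0 d0))/invr_inj/eqP.
  by rewrite eqr_nat => /eqP[].
case/allPn => _ /mapP[k _ ->] nz; exists (d / k.+2%:R) => //; apply: dA.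
rewrite normrM normfV normr_nat gtr0_norm // ltr_pdivrMr ?ltr0n //.
by rewrite -[X in X < _]mulr1 ltr_pM2l // ltr1n.
Qed.

(** Otherwise all factors have norm at least e. *)
Lemma small_prod_root (r : seq K) x e : 0 < e -> (0 < size r)%N ->
  `|\prod_(z <- r) (x - z)| < e ^+ size r -> exists2 z, z \in r & `|x - z| < e.
Proof.
move=> e0; elim: r => // z r IHr _; rewrite big_cons normrM exprS => lt_e.
have [lt_z|] := boolP (`|x - z| < e); first by exists z => //; rewrite mem_head.
rewrite -real_leNgt ?normr_real ?gtr0_real // => ge_z.
case: r => [|z' r] in IHr lt_e *.
  by move: lt_e; rewrite big_nil normr1 expr0 !mulr1 => /(le_lt_trans ge_z); rewrite ltxx.
have [] := IHr; rewrite ?inE //.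
  rewrite -(ltr_pM2l e0); apply: le_lt_trans lt_e.
  by rewrite ler_wpM2r.
by move=> y yr lt_y; exists y => //; rewrite inE yr orbT.
Qed.

Lemma monic_close_root P x e : P \is monic -> (1 < size P)%N -> 0 < e ->
  `|P.[x]| < e ^+ (size P).-1 -> exists2 z, root P z & `|x - z| < e.
Proof.
move=> monP szP e0; have [r Pr] := closed_field_poly_normal P.
rewrite (monicP monP) scale1r in Pr.
have szr : size P = (size r).+1 by rewrite Pr size_prod_XsubC.
have Px : P.[x] = \prod_(z <- r) (x - z).
  by rewrite Pr horner_prod; apply: eq_bigr => z _; rewrite !hornerE.
rewrite Px szr /= => /small_prod_root[//||z zr lt_z]; first by move: szP; rewrite szr.
by exists z => //; rewrite Pr root_prod_XsubC.
Qed.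

Lemma monic_root_bound P x : P \is monic -> root P x ->
  `|x| <= 1 + \sum_(i < (size P).-1) `|P`_i|.
Proof.
move=> monP Px; have S0 : 0 <= \sum_(i < (size P).-1) `|P`_i| by apply: sumr_ge0.
have [le1|] := boolP (`|x| <= 1); first by rewrite (le_trans le1) // lerDl.
rewrite -real_ltNge ?normr_real ?real1 // => gt1.
apply: le_trans (_ : \sum_(i < (size P).-1) `|P`_i| <= _); last by rewrite lerDr.
have x0 : 0 < `|x| by apply: lt_trans gt1.
have szP : (0 < size P)%N by rewrite size_poly_gt0 monic_neq0.
case: (posnP (size P).-1) => [sz0|sz1].
  have le1 : (size P <= 1)%N by case: (size P) sz0 => [|[]].
  have := monicP monP; rewrite lead_coefE sz0 => P0.
  by move: Px; rewrite (size1_polyC le1) P0 rootC oner_eq0.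
set k := (size P).-1 in sz1 *.
have E : x ^+ k = - \sum_(i < k) P`_i * x ^+ i.
  move: Px; rewrite /root horner_coef -(prednK szP) big_ord_recr /= -/k.
  have := monicP monP; rewrite lead_coefE -/k => ->.
  by rewrite mul1r addrC addr_eq0 => /eqP.
rewrite -(ler_pM2r (exprn_gt0 k.-1 x0)) -exprS prednK // -normrX E normrN.
rewrite (le_trans (ler_norm_sum _ _ _)) // mulr_suml; apply: ler_sum => i _.
rewrite normrM ler_wpM2l // normrX ler_eXn2l // -ltnS prednK //.
Qed.

(** Continuity of the roots of a monic polynomial whose coefficients depend
    polynomially on a parameter. *)
Lemma root_near (P : {poly {poly K}}) x e : P \is monic -> 0 < e ->
  root (map_poly (horner_eval 0) P) x ->
  near_zero (fun t => exists2 y, root (map_poly (horner_eval t) P) y & `|x - y| < e).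
Proof.
move=> monP e0 Px; pose Q := P.[x%:P].
have QE t : (map_poly (horner_eval t) P).[x] = Q.[t].
  by rewrite -[RHS]/(horner_eval t Q) -horner_map /= /horner_eval hornerC.
have mon t : map_poly (horner_eval t) P \is monic by apply: monic_map.
have sz t : size (map_poly (horner_eval t) P) = size P.
  by rewrite size_map_poly_id0 // (monicP monP) /= /horner_eval hornerC oner_neq0.
have gt1 : (1 < size P)%N.
  rewrite -(sz 0) ltnNge; apply: contraL Px => /size1_polyC E; have := monicP (mon 0).
  by rewrite E lead_coefC rootC => ->; rewrite oner_eq0.
apply: near_zeroS (poly_near_zero Q (exprn_gt0 (size P).-1 e0)) => t.
rewrite -(QE 0) (eqP Px) subr0 -QE -(sz t) => lt_e.
by apply: monic_close_root lt_e; rewrite ?sz.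
Qed.

(** The roots for small t are bounded, so the value of the polynomial at 0 is
    uniformly small on them. *)
Lemma root_near_limit (P : {poly {poly K}}) e : P \is monic -> 0 < e ->
  near_zero (fun t => forall x, root (map_poly (horner_eval t) P) x ->
    exists2 y, root (map_poly (horner_eval 0) P) y & `|x - y| < e).
Proof.
move=> monP e0.
have mon t : map_poly (horner_eval t) P \is monic by apply: monic_map.
have sz t : size (map_poly (horner_eval t) P) = size P.
  by rewrite size_map_poly_id0 // (monicP monP) /= /horner_eval hornerC oner_neq0.
have [le1|gt1] := leqP (size P) 1.
  exists 1 => // t _ x; have le1t : (size (map_poly (horner_eval t) P) <= 1)%N by rewrite sz.
  have := monicP (mon t); rewrite lead_coefE sz (_ : (size P).-1 = 0%N).
    by move=> P0; rewrite (size1_polyC le1t) P0 rootC oner_eq0.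
  by case: (size P) le1 => [|[]].
have [|b bP] := @choice _ _ (fun (i : nat) (b : K) =>
    0 <= b /\ forall t, `|t| <= 1 -> `|(P`_i).[t]| <= b).
  by move=> i; have [b b0 bi] := poly_bounded P`_i; exists b.
pose k := (size P).-1; have kE : size P = k.+1 by rewrite /k prednK // ltnW.
pose c := 1 + \sum_(i < size P) b i.
have S0 : 0 <= \sum_(i < size P) b i by apply: sumr_ge0 => i _; case: (bP i).
have c1 : 1 <= c by rewrite lerDl.
have c0 : 0 < c by apply: lt_le_trans c1.
(* The sum of size P terms of norm less than s c ^+ size P is less than e ^+ k. *)
pose s := e ^+ k / ((size P)%:R * c ^+ size P).
have s0 : 0 < s by rewrite divr_gt0 ?exprn_gt0 // mulr_gt0 ?exprn_gt0 // ltr0n ltnW.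
have := near_zero_all (fun i : 'I_(size P) => poly_near_zero P`_i s0).
move=> /(near_zeroI (near_zero_lt ltr01)); apply: near_zeroS => t [t1 lt_s] x Ptx.
have le_x : `|x| <= c.
  rewrite (le_trans (monic_root_bound (mon t) Ptx)) // lerD2l sz.
  rewrite kE big_ord_recr /= ler_wpDr //; first by case: (bP k).
  apply: ler_sum => i _; rewrite coef_map /= /horner_eval.
  by have [_ /(_ t (ltW t1))] := bP i.
apply: (monic_close_root (mon 0)) => //; first by rewrite sz.
have P0E : (map_poly (horner_eval 0) P).[x] =
    \sum_(i < size P) ((P`_i).[0] - (P`_i).[t]) * x ^+ i.
  under eq_bigr do rewrite mulrBl.
  rewrite sumrB (_ : \sum_(i < size P) (P`_i).[t] * x ^+ i = 0) ?subr0; last first.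
    have Pt0 := eqP Ptx; rewrite horner_coef sz in Pt0; rewrite -[RHS]Pt0.
    by apply: eq_bigr => i _; rewrite coef_map.
  by rewrite horner_coef sz; apply: eq_bigr => i _; rewrite coef_map.
rewrite P0E sz (le_lt_trans (ler_norm_sum _ _ _)) //.
have -> : e ^+ (size P).-1 = \sum_(i < size P) s * c ^+ size P.
  rewrite sumr_const card_ord -mulr_natr /s -mulrA [c ^+ _ * _]mulrC divfK //.
  by rewrite mulf_neq0 ?expf_neq0 ?lt0r_neq0 // ltr0n ltnW.
have szpos : (0 < size P)%N by apply: ltnW.
rewrite (bigD1 (Ordinal szpos)) //= [ltRHS](bigD1 (Ordinal szpos)) //=.
have lti i : `|((P`_i).[0] - (P`_i).[t]) * x ^+ i| < s * c ^+ size P \/ ~~ (i < size P)%N.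
  case: (ltnP i (size P)) => [lt_i|]; last by right.
  left; rewrite normrM -distrC.
  apply: le_lt_trans (_ : `|(P`_i).[t] - (P`_i).[0]| * c ^+ size P < _).
    rewrite ler_wpM2l // normrX (le_trans (lerXn2r i _ _ le_x)) ?nnegrE ?(ltW c0) //.
    by rewrite ler_weXn2l // ltnW.
  by rewrite ltr_pM2r ?exprn_gt0 //; apply: (lt_s (Ordinal lt_i)).
rewrite ltr_leD //; first by case: (lti 0%N) => //; rewrite szpos.
by apply: ler_sum => i _; case: (lti i) => [/ltW//|]; rewrite ltn_ord.
Qed.

End Perturbation.

(** * Zariski closures of images and limits *)

Section EuclideanClosure.
Variables (K : numClosedFieldType).

Lemma exists_below (a b : K) : 0 < a -> 0 < b ->
  exists2 c, 0 < c & c <= a /\ c <= b.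
Proof.
move=> a0 b0; have [le_ab|le_ba] := orP (real_leVge (gtr0_real a0) (gtr0_real b0)).
  by exists a.
by exists b.
Qed.

Lemma finite_gap (I : finType) (x : I -> K) :
  exists2 c : K, 0 < c & forall i, `|x i| < c -> x i = 0.
Proof.
have [|d d0 dP] := @near_zero_all K I (fun i t => x i != 0 -> `|t| < `|x i|).
  move=> i; have [->|nz] := eqVneq (x i) 0; first by exists 1 => //; rewrite ltr01.
  by exists `|x i|; rewrite ?normr_gt0.
exists (d / 2) => [|i lt_i]; first by rewrite divr_gt0.
apply/eqP; apply: contraT => nz.
have d2 : `|d / 2| = d / 2 by rewrite gtr0_norm // divr_gt0.
have lt_d : `|d / 2| < d by rewrite d2 ltr_pdivrMr // ltr_pMr // ltr1n.
by have := dP _ lt_d i nz; rewrite d2 => /(lt_trans lt_i); rewrite ltxx.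
Qed.

(** Finitely many points are separated from y by a linear form. *)
Lemma separating_form n (y : 'I_n -> K) (r : 'I_n -> seq K) :
  (forall j, y j \in r j) ->
  exists (l : 'I_n -> K) (c : K), 0 < c /\ forall x : 'I_n -> K,
    (forall j, x j \in r j) -> `|\sum_j l j * (x j - y j)| < c -> x =1 y.
Proof.
move=> yr; pose B := (\max_j size (r j)).+1.
pose pt (g : {ffun 'I_n -> 'I_B}) j := nth (y j) (r j) (g j).
pose L g : {mpoly K[n]} := \sum_j (pt g j - y j)%:MP * 'X_j.
have LE g l : (L g).@[l] = \sum_j l j * (pt g j - y j).
  rewrite /L raddf_sum /=; apply: eq_bigr => j _.
  by rewrite mevalM mevalC mevalXU mulrC.
have [l nzl] : exists l, (\prod_(g | [exists j, pt g j != y j]) L g).@[l] != 0.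
  apply: exists_eval_neq0; apply/prodf_neq0 => g /existsP[j nj].
  have [l nzl] : exists l, (L g).@[l] != 0.
    exists (fun i => (i == j)%:R); rewrite LE (bigD1 j) //= eqxx mul1r.
    rewrite big1 ?addr0 ?subr_eq0 // => i ij; by rewrite (negbTE ij) mul0r.
  by apply: contraNneq nzl => ->; rewrite meval0.
have [c c0 cP] := finite_gap (fun g => (L g).@[l]); exists l, c; split=> // x xr lt_x.
have lt_B j : (index (x j) (r j) < B)%N.
  rewrite ltnS (leq_trans (index_size _ _)) //.
  exact: (leq_bigmax (F := fun j => size (r j))).
pose g := [ffun j => Ordinal (lt_B j)].
have ptE j : pt g j = x j by rewrite /pt ffunE /= nth_index.
move=> j; apply/eqP; apply: contraT => nj.
move: nzl; rewrite rmorph_prod (bigD1 g) /=; last by apply/existsP; exists j; rewrite ptE.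
rewrite cP ?mul0r ?eqxx // LE.
by under eq_bigr do rewrite ptE.
Qed.

(** Noether normalization makes all coordinates integral over a polynomial ring
    K[z]; over a point near z(y), the coordinates are near the finitely many
    roots over z(y), and a linear form w separates y from the other ones. The
    monic minimal relation of w over K[z] has a root near w(y), which is the
    value of w at a point of the image. *)
Theorem closure_approx N n (f : 'I_n -> {mpoly K[N]}) (y : 'I_n -> K) :
  specializes f y ->
  forall e : K, 0 < e -> exists u, forall j, `|(f j).@[u] - y j| < e.
Proof.
move=> fy e e0; have [d [z [C [ind_z zC intf]]]] := noether_normalization f.
pose z0 i := \sum_j C i j * y j.
pose Z i : {mpoly K[n]} := \sum_j (C i j)%:MP * 'X_j.
have fZ i : subst f (Z i) = z i.
  rewrite zC rmorph_sum /=; apply: eq_bigr => j _.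
  by rewrite rmorphM /= substC substX.
have Zy i : (Z i).@[y] = z0 i.
  rewrite raddf_sum /=; apply: eq_bigr => j _.
  by rewrite mevalM mevalC mevalXU.
have spec_rel (Q : {poly {mpoly K[d]}}) (b : {mpoly K[n]}) :
    root (map_poly (subst z) Q) (subst f b) -> root (map_poly (meval z0) Q) b.@[y].
  move=> /eqP Qb; have : subst f (map_poly (subst Z) Q).[b] = 0.
    rewrite -horner_map -map_poly_comp -[RHS]Qb; congr _.[_]; apply: eq_map_poly => F /=.
    by rewrite subst_comp; apply: eq_subst => i; rewrite fZ.
  move/fy; rewrite -horner_map -map_poly_comp => E; rewrite /root -[X in _ == X]E.
  apply/eqP; congr _.[_]; apply: eq_map_poly => F /=.
  by rewrite meval_subst; apply: meval_eq => i; rewrite Zy.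
have [P PP] : exists P : 'I_n -> {poly {mpoly K[d]}}, forall j,
    P j \is monic /\ root (map_poly (subst z) (P j)) (f j).
  have [|P PP] := @choice _ _ (fun j (P : {poly {mpoly K[d]}}) =>
    P \is monic /\ root (map_poly (subst z) P) (f j)); last by exists P.
  by move=> j; have [P] := intf j; exists P.
have [r rP] : exists r : 'I_n -> seq K, forall j x,
    (x \in r j) = root (map_poly (meval z0) (P j)) x.
  have [|r rP] := @choice _ _ (fun j (r : seq K) => forall x,
    (x \in r) = root (map_poly (meval z0) (P j)) x); last by exists r.
  move=> j; have [s sP] := closed_field_poly_normal (map_poly (meval z0) (P j)).
  exists s => x; rewrite sP (monicP _) ?scale1r ?root_prod_XsubC //.
  by apply: monic_map; case: (PP j).
have yr j : y j \in r j.
  rewrite rP -(mevalXU y j); apply: spec_rel; rewrite substX; by case: (PP j).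
have [l [c [c0 sep]]] := separating_form yr.
pose lX : {mpoly K[n]} := \sum_j (l j)%:MP * 'X_j.
pose w := subst f lX.
have intw : integralOver (subst z) w by apply: integral_subst.
have [M monM minM] := monic_relation ind_z intw.
pose t0 := lX.@[y].
have Mt0 : root (map_poly (meval z0) M) t0 by apply: spec_rel; case: minM.
have [h nzh hP] := image_contains_open (fext z w).
rewrite subst_fext in nzh; have [b nzb bP] := bezout_specialize minM nzh.
have [z1 nzz1] : exists z1, b.@[z1] != 0.
  by apply: exists_eval_neq0; apply: contraNneq nzb => ->; rewrite rmorph0.
(* As b does not vanish at z1, it has finitely many zeros on the line through z0
   and z1. *)
pose v i := z1 i - z0 i; pose q t i := z0 i + t * v i.
have nzE : line_subst z0 v b != 0.
  apply: contraNneq nzz1 => E0; have := horner_line_subst z0 v b 1.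
  rewrite E0 horner0 => ->; apply/eqP; apply: meval_eq => i.
  by rewrite /v mul1r addrC subrK.
have lineE t (Q : {poly {mpoly K[d]}}) :
    map_poly (horner_eval t) (map_poly (line_subst z0 v) Q) = map_poly (meval (q t)) Q.
  rewrite -map_poly_comp; apply: eq_map_poly => F /=.
  by rewrite /horner_eval horner_line_subst.
have q0 : q 0 = z0 by apply: funext => i; rewrite /q mul0r addr0.
have c2 : 0 < c / 2 by rewrite divr_gt0.
have S0 : 0 <= \sum_j `|l j| by apply: sumr_ge0.
have S1 : 0 < 1 + \sum_j `|l j| by rewrite ltr_wpDr.
(* An error of e' on each coordinate changes the linear form by at most c / 2. *)
have [e' e'0 [le_e le_c]] := exists_below e0 (divr_gt0 c2 S1).
have nearM : near_zero (fun t =>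
    exists2 t1, root (map_poly (meval (q t)) M) t1 & `|t0 - t1| < c / 2).
  have := @root_near K (map_poly (line_subst z0 v) M) t0 (c / 2) (monic_map _ monM) c2.
  rewrite lineE q0 => /(_ Mt0); apply: near_zeroS => t [t1].
  by rewrite lineE; exists t1.
have nearP : near_zero (fun t => forall j x, root (map_poly (meval (q t)) (P j)) x ->
    exists2 x', x' \in r j & `|x - x'| < e').
  apply: near_zero_all => j; have [monP _] := PP j.
  have := @root_near_limit K (map_poly (line_subst z0 v) (P j)) e' (monic_map _ monP) e'0.
  apply: near_zeroS => t tP x; rewrite -lineE => /tP[x']; rewrite lineE q0 -rP.
  by exists x'.
have [t nzt [[t1 Mt1 lt_t1] tP]] := near_zero_neq0 nzE (near_zeroI nearM nearP).
rewrite horner_line_subst -/(q t) in nzt.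
have zq : specializes z (q t) by move=> F /ind_z ->; rewrite meval0.
have spec : specializes (fext z w) (fext (q t) t1).
  apply: specializes_root minM zq _ Mt1.
  by rewrite (monicP monM) meval1 oner_neq0.
have [|u uP] := hP _ spec; first by rewrite meval_fext; apply: bP zq nzt Mt1.
have uz i : (z i).@[u] = q t i by have := uP (lift ord_max i); rewrite !fext_lift.
have uw : w.@[u] = t1 by have := uP ord_max; rewrite !fext_max.
exists u.
have /choice[x xP] : forall j, exists x', x' \in r j /\ `|(f j).@[u] - x'| < e'.
  move=> j; have [|x' xr lt_x] := tP j (f j).@[u]; last by exists x'.
  have [_ /eqP Pf] := PP j; rewrite /root; apply/eqP.
  have := congr1 (meval u) Pf; rewrite meval0 -horner_map -map_poly_comp => E.
  rewrite -[RHS]E; congr _.[_]; apply: eq_map_poly => F /=.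
  by rewrite meval_subst; apply: meval_eq => i; rewrite uz.
have xy : x =1 y.
  apply: sep => [j|]; first by case: (xP j).
  have -> : \sum_j l j * (x j - y j) =
      \sum_j l j * (x j - (f j).@[u]) - (t0 - t1).
    have lXE (x' : 'I_n -> K) : lX.@[x'] = \sum_j l j * x' j.
      rewrite /lX raddf_sum /=; apply: eq_bigr => j _.
      by rewrite mevalM mevalC mevalXU.
    rewrite -uw /w /t0 meval_subst !lXE -!sumrB; apply: eq_bigr => j _; ring.
  rewrite [c](splitr c) (le_lt_trans (ler_normB _ _)) // ler_ltD //.
  rewrite (le_trans (ler_norm_sum _ _ _)) //.
  apply: (@le_trans _ _ (\sum_j `|l j| * e')).
    apply: ler_sum => j _; rewrite normrM ler_wpM2l // distrC.
    by case: (xP j) => _ /ltW.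
  rewrite -mulr_suml (le_trans (ler_wpM2l S0 le_c)) // mulrC mulrAC.
  by rewrite ler_pdivrMr // ler_wpM2l ?(ltW c2) // lerDr.
by move=> j; rewrite -xy (lt_le_trans _ le_e) //; case: (xP j).
Qed.

End EuclideanClosure.

Local Open Scope complex_scope.

(** * Tangent and normal spaces of the cone of rank-one tensors *)

Section RankOne.
Variables (R : realType) (p : nat) (n : 'I_p -> nat).
Local Notation K := R[i].
Local Notation tens := (tensor R n).
Local Notation vecs := (vectors R n).
Implicit Types (x y xi w : vecs) (s t z : tens).

Lemma tensD s t a : (s + t) a = s a + t a.
Proof. exact: ffunE. Qed.

Lemma tensZ c s a : (c *: s) a = c * s a.
Proof. exact: ffunE. Qed.

Lemma tens0 a : (0 : tens) a = 0.
Proof. exact: ffunE. Qed.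

Lemma tens_sum (I : Type) (r : seq I) (P : pred I) (F : I -> tens) a :
  (\sum_(i <- r | P i) F i) a = \sum_(i <- r | P i) F i a.
Proof. exact: (big_morph (fun s : tens => s a) (fun s t => tensD s t a) (tens0 a)). Qed.

(** Computations take place with the standard bilinear forms on the factors and on
    tensors; [raise] carries the results over to the Bombieri-Weyl form. *)
Definition dot i (u v : 'rV[K]_(n i)) : K := \sum_k u 0 k * v 0 k.

Definition std s t : K := \sum_a s a * t a.

Lemma dotC i (u v : 'rV[K]_(n i)) : dot u v = dot v u.
Proof. by apply: eq_bigr => k _; rewrite mulrC. Qed.

Lemma dotZr i (u v : 'rV[K]_(n i)) c : dot u (c *: v) = c * dot u v.
Proof. by rewrite mulr_sumr; apply: eq_bigr => k _; rewrite mxE mulrCA. Qed.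

Lemma stdC s t : std s t = std t s.
Proof. by apply: eq_bigr => a _; rewrite mulrC. Qed.

Lemma stdDr s t1 t2 : std s (t1 + t2) = std s t1 + std s t2.
Proof. by rewrite -big_split; apply: eq_bigr => a _; rewrite tensD mulrDr. Qed.

Lemma stdZr s c t : std s (c *: t) = c * std s t.
Proof. by rewrite mulr_sumr; apply: eq_bigr => a _; rewrite tensZ mulrCA. Qed.

Lemma stdNr s t : std s (- t) = - std s t.
Proof. by rewrite -scaleN1r stdZr mulN1r. Qed.

Lemma std0r s : std s 0 = 0.
Proof. by rewrite -(scale0r 0) stdZr mul0r. Qed.

Lemma std_sumr (I : Type) (r : seq I) (P : pred I) s (F : I -> tens) :
  std s (\sum_(i <- r | P i) F i) = \sum_(i <- r | P i) std s (F i).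
Proof. by rewrite (big_morph (std s) (stdDr s) (std0r s)). Qed.

Lemma stdDl s1 s2 t : std (s1 + s2) t = std s1 t + std s2 t.
Proof. by rewrite stdC stdDr !(stdC t). Qed.

Lemma stdZl c s t : std (c *: s) t = c * std s t.
Proof. by rewrite stdC stdZr stdC. Qed.

Lemma std_suml (I : Type) (r : seq I) (P : pred I) t (F : I -> tens) :
  std (\sum_(i <- r | P i) F i) t = \sum_(i <- r | P i) std (F i) t.
Proof. by rewrite stdC std_sumr; apply: eq_bigr => i _; rewrite stdC. Qed.

Definition basis_tensor (a : multi_index n) : tens := [ffun b => (a == b)%:R].

Lemma std_basis a s : std (basis_tensor a) s = s a.
Proof.
rewrite /std (bigD1 a) //= ffunE eqxx mul1r big1 ?addr0 // => b ba.
by rewrite ffunE eq_sym (negbTE ba) mul0r.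
Qed.

Lemma std_eq0 s : (forall t, std t s = 0) -> s = 0.
Proof. by move=> s0; apply/ffunP => a; rewrite -std_basis s0 tens0. Qed.

Lemma sum_basis_tensor s : s = \sum_a s a *: basis_tensor a.
Proof.
apply/ffunP => b; rewrite tens_sum (eq_bigr (fun a => s a * (a == b)%:R)).
  rewrite (bigD1 b) //= eqxx mulr1 big1 ?addr0 // => a /negbTE ->; exact: mulr0.
by move=> a _; rewrite tensZ; congr (_ * _); apply: ffunE.
Qed.

Lemma basis_tensor_rank1 a :
  basis_tensor a = rank1 (fun i => delta_mx 0 (a i) : 'rV[K]_(n i)).
Proof.
apply/ffunP => b; rewrite !ffunE; have [<-|nab] := eqVneq a b.
  by rewrite big1 // => i _; rewrite mxE !eqxx.
have /existsP[i ni] : [exists i, a i != b i].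
  apply: contraNT nab; rewrite negb_exists => /forallP ab.
  by apply/eqP/ffunP => i; apply/eqP; rewrite -[_ == _]negbK ab.
by rewrite (bigD1 i) //= mxE eq_sym (negbTE ni) andbF mul0r.
Qed.

Lemma std_rank1 x y : std (rank1 x) (rank1 y) = \prod_i dot (x i) (y i).
Proof.
rewrite /dot prod_sum_multi_index; apply: eq_bigr => a _.
by rewrite !ffunE -big_split.
Qed.

Lemma rank1_slot x i (v : 'rV[K]_(n i)) a :
  rank1 (dfwith x v) a = v 0 (a i) * \prod_(j | j != i) x j 0 (a j).
Proof.
rewrite ffunE (bigD1 i) //= dfwith_in; congr (_ * _).
by apply: eq_bigr => j ji; rewrite dfwith_out // eq_sym.
Qed.

Lemma rank1_slotD x i (u v : 'rV[K]_(n i)) :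
  rank1 (dfwith x (u + v)) = rank1 (dfwith x u) + rank1 (dfwith x v).
Proof. by apply/ffunP => a; rewrite tensD !rank1_slot mxE mulrDl. Qed.

Lemma rank1_slotZ x i c (v : 'rV[K]_(n i)) :
  rank1 (dfwith x (c *: v)) = c *: rank1 (dfwith x v).
Proof. by apply/ffunP => a; rewrite tensZ !rank1_slot mxE -mulrA. Qed.

Lemma rank1_slot_id x i : rank1 (dfwith x (x i)) = rank1 x.
Proof. by apply/ffunP => a; rewrite rank1_slot ffunE [RHS](bigD1 i). Qed.

Lemma rank1_eq0 x i : x i = 0 -> rank1 x = 0.
Proof. by move=> xi; rewrite -(rank1_slot_id x i) xi -(scale0r 0) rank1_slotZ scale0r. Qed.

Lemma eq_rank1 x y : (forall i, x i = y i) -> rank1 x = rank1 y.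
Proof. by move=> xy; apply/ffunP => a; rewrite !ffunE; apply: eq_bigr => i _; rewrite xy. Qed.

Lemma rank1_slot2C x i j (u : 'rV[K]_(n i)) (v : 'rV[K]_(n j)) : i != j ->
  rank1 (dfwith (dfwith x u) v) = rank1 (dfwith (dfwith x v) u).
Proof.
move=> nij; apply: eq_rank1 => k.
have [<-|nik] := eqVneq i k.
  by rewrite dfwith_in dfwith_out ?dfwith_in // eq_sym.
rewrite [RHS]dfwith_out //; have [<-|njk] := eqVneq j k; first by rewrite !dfwith_in.
by rewrite !dfwith_out.
Qed.

(** The contraction of s with all factors of x but the i-th. *)
Definition contraction x i s : 'rV[K]_(n i) :=
  \row_k std (rank1 (dfwith x (delta_mx 0 k : 'rV[K]_(n i)))) s.

Lemma std_slot x i (v : 'rV[K]_(n i)) s :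
  std (rank1 (dfwith x v)) s = dot v (contraction x i s).
Proof.
have -> : rank1 (dfwith x v) = \sum_k v 0 k *: rank1 (dfwith x (delta_mx 0 k : 'rV[K]_(n i))).
  apply/ffunP => a; rewrite tens_sum rank1_slot.
  rewrite (eq_bigr (fun k => v 0 k * ((k == a i)%:R * \prod_(j | j != i) x j 0 (a j)))).
    rewrite (bigD1 (a i)) //= eqxx mul1r [X in _ + X]big1 ?addr0 // => k /negbTE ->.
    by rewrite mul0r mulr0.
  by move=> k _; rewrite tensZ rank1_slot mxE eqxx eq_sym.
by rewrite std_suml; apply: eq_bigr => k _; rewrite stdZl mxE.
Qed.

(** The tensors that have all factors but one in common with x span the tangent
    space of the cone at [rank1 x] when x has nonzero factors; so s is a normal
    vector for the standard form. *)
Definition normal x s : Prop := forall i (v : 'rV[K]_(n i)), std (rank1 (dfwith x v)) s = 0.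

Lemma normal_contractionP x s : normal x s <-> forall i, contraction x i s = 0.
Proof.
split=> [xs i|xs i v]; first by apply/rowP => k; rewrite mxE xs mxE.
by rewrite std_slot xs /dot big1 // => k _; rewrite mxE mulr0.
Qed.

Lemma normalD x s t : normal x s -> normal x t -> normal x (s + t).
Proof. by move=> xs xt i v; rewrite stdDr xs xt addr0. Qed.

Lemma normalZ x c s : normal x s -> normal x (c *: s).
Proof. by move=> xs i v; rewrite stdZr xs mulr0. Qed.

Lemma normal_rank1 (p_gt0 : (0 < p)%N) x s : normal x s -> std (rank1 x) s = 0.
Proof. by move=> xs; rewrite -(rank1_slot_id x (Ordinal p_gt0)) xs. Qed.

(** Put q_i = <x_i, .> xi_i and r_i = <x_i, xi_i> - q_i. This is the sum of the
    tensor products of factors q_i and r_i with at least two factors r_i: the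
    full product of the q_i + r_i, minus the terms with at most one r_i. Since
    r_i takes values orthogonal to x_i, the terms kept have normal vectors as
    values; on normal vectors the terms removed vanish. *)
Definition normal_proj x xi s : tens :=
  (\prod_i dot (x i) (xi i)) *: s + (p.-1%:R * std (rank1 x) s) *: rank1 xi
  - \sum_i dot (x i) (xi i) *: rank1 (dfwith xi (contraction x i s)).

Lemma normal_proj0 x xi : normal_proj x xi 0 = 0.
Proof.
rewrite /normal_proj scaler0 std0r mulr0 scale0r addr0 sub0r big1 ?oppr0 // => i _.
rewrite (@rank1_eq0 _ i) ?scaler0 // dfwith_in.
by apply/rowP => k; rewrite !mxE std0r.
Qed.

Lemma prod_dot_slot x y i (u v : 'rV[K]_(n i)) :
  std (rank1 (dfwith x u)) (rank1 (dfwith y v)) =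
  dot u v * \prod_(j | j != i) dot (x j) (y j).
Proof.
rewrite std_rank1 (bigD1 i) //= !dfwith_in; congr (_ * _).
by apply: eq_bigr => j ji; rewrite !dfwith_out // eq_sym.
Qed.

Lemma dot_contraction x i s : dot (x i) (contraction x i s) = std (rank1 x) s.
Proof. by rewrite -std_slot rank1_slot_id. Qed.

Lemma normal_proj_normal x xi s : normal x (normal_proj x xi s).
Proof.
move=> l v; set X := rank1 (dfwith x v); set C := \prod_i dot (x i) (xi i).
pose G i := std X (dot (x i) (xi i) *: rank1 (dfwith xi (contraction x i s))).
have Gl : G l = C * std X s.
  rewrite /G stdZr prod_dot_slot -std_slot mulrCA mulrC /C.
  by rewrite (bigD1 l (isT : xpredT l)).
have Gi i : i != l -> G i = std (rank1 x) s * std X (rank1 xi).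
  move=> il; have xvi : dfwith x v i = x i by rewrite dfwith_out // eq_sym.
  rewrite /G stdZr /X -{1}(rank1_slot_id (dfwith x v) i) prod_dot_slot xvi.
  rewrite dot_contraction mulrCA std_rank1; congr (_ * _).
  by rewrite [RHS](bigD1 i (isT : xpredT i)) xvi.
have sumG : \sum_i G i = C * std X s + p.-1%:R * (std (rank1 x) s * std X (rank1 xi)).
  have -> : \sum_i G i = G l + \sum_(i | i != l) G i by rewrite (bigD1 l).
  rewrite Gl (eq_bigr _ Gi) sumr_const mulr_natl; congr (_ + _ *+ _).
  by transitivity #|predC1 l|; [apply: eq_card|rewrite cardC1 card_ord].
rewrite /normal_proj !stdDr stdNr !stdZr std_sumr -/(G _) -/C.
by rewrite sumG mulrA subrr.
Qed.

End RankOne.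

(** * Moving normal vectors along the cone *)

Section Curves.
Variables (R : realType) (p : nat) (n : 'I_p -> nat) (p_gt0 : (0 < p)%N).
Local Notation K := R[i].
Local Notation tens := (tensor R n).
Local Notation vecs := (vectors R n).
Implicit Types (x y xi w : vecs) (s z : tens).

Lemma exists_dual i (u : 'rV[K]_(n i)) : u != 0 -> exists v, dot u v = 1.
Proof.
case/rV0Pn => k nz; exists ((u 0 k)^-1 *: delta_mx 0 k).
rewrite dotZr /dot (bigD1 k) //= mxE !eqxx mulr1 big1 ?addr0 ?mulVf // => j jk.
by rewrite mxE (negbTE jk) mulr0.
Qed.

Lemma normal_proj_id x xi s : (forall i, dot (x i) (xi i) = 1) -> normal x s ->
  normal_proj x xi s = s.
Proof.
move=> x1 xs; rewrite /normal_proj (normal_rank1 p_gt0 xs) mulr0 scale0r addr0.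
rewrite (eq_bigr (fun=> 1)) // big1_eq scale1r.
rewrite (eq_bigr (fun=> 0)) ?big1_eq ?subr0 // => i _.
by rewrite ((normal_contractionP x s).1 xs) (@rank1_eq0 _ _ _ _ i) ?scaler0 ?dfwith_in.
Qed.

(** The linear form <z, .> vanishes on the image of the projector onto the normal
    space. The transpose of the projector is the identity minus a map with values
    in the tangent space, so z is a tangent vector. *)
Lemma tangent_span x xi z : (forall i, dot (x i) (xi i) = 1) ->
  (forall s, normal x s -> std z s = 0) ->
  exists w, z = \sum_i rank1 (dfwith x (w i)).
Proof.
move=> x1 zN; pose c := p.-1%:R * std (rank1 xi) z; pose g i := contraction xi i z.
have zE : z = \sum_i rank1 (dfwith x (g i)) - c *: rank1 x.
  apply/eqP; rewrite -subr_eq0; apply/eqP; apply: std_eq0 => s; rewrite stdC.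
  have := zN _ (normal_proj_normal x xi s); rewrite /normal_proj.
  rewrite (eq_bigr (fun=> 1)) // big1_eq scale1r.
  under eq_bigr do rewrite x1 scale1r.
  rewrite !stdDr stdNr stdZr std_sumr => E.
  rewrite opprB stdC stdDr stdDr stdNr stdZr std_sumr -[RHS]E addrA.
  rewrite (stdC s z) (stdC s (rank1 x)) /c (stdC _ z) mulrAC; congr (_ - _).
  apply: eq_bigr => i _; rewrite (stdC z) std_slot /g dotC -std_slot.
  by rewrite stdC.
have p0 : p%:R != 0 :> K by rewrite pnatr_eq0 -lt0n.
exists (fun i => g i - (c / p%:R) *: x i).
rewrite zE; under [RHS]eq_bigr => i _ do
  rewrite -scaleNr rank1_slotD rank1_slotZ rank1_slot_id.
rewrite big_split /= sumr_const card_ord; congr (_ + _).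
by rewrite -scaler_nat scalerA mulrN mulrCA mulfV // mulr1 scaleNr.
Qed.

Lemma tens_velocity (g : K -> tens) (v : tens) :
  (forall a, has_deriv (fun t => g t a) (v a)) -> velocity g v.
Proof.
move=> gv j; have zE s : zcoord j s = \sum_a s a * zcoord j (basis_tensor R a).
  rewrite {1}[s]sum_basis_tensor zcoord_sum; apply: eq_bigr => a _.
  by rewrite zcoordZ.
rewrite zE; apply: (eq_has_deriv (fun t => esym (zE (g t)))).
apply: has_deriv_sum => a.
have := has_derivM (gv a) (has_derivC (zcoord j (basis_tensor R a))).
by rewrite mulr0 addr0.
Qed.

Lemma velocity_tens (g : K -> tens) (v : tens) a :
  velocity g v -> has_deriv (fun t => g t a) (v a).
Proof.
by apply: (has_deriv_linear (h := fun s : tens => s a)) => *; rewrite ?tensD ?tensZ.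
Qed.

Lemma tens_poly_map (U : vectType K) (phi : U -> tens) :
  (forall a, poly_fun (fun u => phi u a)) -> poly_map phi.
Proof.
move=> phiP j.
apply: (@eq_poly_fun _ _ (fun u => \sum_a phi u a * zcoord j (basis_tensor R a))).
  move=> u; rewrite [in RHS](sum_basis_tensor (phi u)) zcoord_sum; apply: eq_bigr => a _.
  by rewrite zcoordZ.
by apply: poly_fun_sum => a _; apply: poly_funM => //; apply: poly_funC.
Qed.

Lemma poly_map_tens (U : vectType K) (phi : U -> tens) a :
  poly_map phi -> poly_fun (fun u => phi u a).
Proof.
move=> phiP; apply: (poly_fun_comp (h := fun s : tens => s a)) phiP.
by apply: poly_fun_linear => *; rewrite ?tensD ?tensZ.
Qed.

Lemma has_deriv_std (g h : K -> tens) (v w : tens) : velocity g v -> velocity h w ->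
  has_deriv (fun t => std (g t) (h t)) (std v (h 0) + std (g 0) w).
Proof.
move=> gv hw; rewrite -big_split; apply: has_deriv_sum => a.
by apply: has_derivM; apply: velocity_tens.
Qed.

Definition line x w (t : K) : vecs := fun i => x i + t *: w i.

Lemma line0 x w i : line x w 0 i = x i.
Proof. by rewrite /line scale0r addr0. Qed.

Lemma velocity_rank1 x w :
  velocity (fun t => rank1 (line x w t)) (\sum_i rank1 (dfwith x (w i))).
Proof.
apply: tens_velocity => a; rewrite tens_sum.
rewrite (eq_bigr (fun i => w i 0 (a i) * \prod_(j | j != i) line x w 0 j 0 (a j))).
  apply: (@eq_has_deriv _ (fun t => \prod_i line x w t i 0 (a i))).
    by move=> t; rewrite ffunE.
  apply: (has_deriv_prod (h := fun i t => line x w t i 0 (a i))) => i.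
  apply: (eq_has_deriv _ (has_deriv_line (x i 0 (a i)) (w i 0 (a i)))) => t.
  by rewrite /line !mxE.
by move=> i _; rewrite rank1_slot; congr (_ * _); apply: eq_bigr => j _; rewrite line0.
Qed.

Lemma velocity_rank1_slot x w i (v : 'rV[K]_(n i)) :
  velocity (fun t => rank1 (dfwith (line x w t) v))
    (\sum_(j | j != i) rank1 (dfwith (dfwith x v) (w j))).
Proof.
have := velocity_rank1 (dfwith x v) (dfwith w (0 : 'rV[K]_(n i))).
rewrite (bigD1 i) //= (@rank1_eq0 _ _ _ _ i) ?add0r; last by rewrite !dfwith_in.
rewrite (eq_bigr (fun j => rank1 (dfwith (dfwith x v) (w j)))); last first.
  by move=> j ji; rewrite [dfwith w _ j]dfwith_out // eq_sym.
apply: eq_velocity => t; apply: eq_rank1 => j.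
have [<-|ij] := eqVneq i j; first by rewrite /line !dfwith_in scaler0 addr0.
by rewrite /line !dfwith_out.
Qed.

(** The second derivative of <rank1 x, s> in x; its diagonal blocks vanish because
    [rank1] is multilinear. *)
Definition hess x s w w' : K :=
  \sum_i \sum_(j | j != i) std (rank1 (dfwith (dfwith x (w i)) (w' j))) s.

(** Differentiate <dx_t, s_t> = 0 at t = 0, where dx_t is the tangent vector along
    w at the point x + t w', and s_t is normal there. *)
Lemma hess_eq0 x s w w' (st : K -> tens) s' :
  (forall t, normal (line x w' t) (st t)) -> st 0 = s -> velocity st s' ->
  std (\sum_i rank1 (dfwith x (w i))) s' = 0 -> hess x s w w' = 0.
Proof.
move=> nst st0 vst zs'; pose G t := \sum_i rank1 (dfwith (line x w' t) (w i)).
have vG : velocity G (\sum_i \sum_(j | j != i) rank1 (dfwith (dfwith x (w i)) (w' j))).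
  by apply: velocity_sum => i; apply: velocity_rank1_slot.
have G0 : G 0 = \sum_i rank1 (dfwith x (w i)).
  apply: eq_bigr => i _; apply: eq_rank1 => j.
  have [<-|ij] := eqVneq i j; first by rewrite !dfwith_in.
  by rewrite !dfwith_out // line0.
have := has_deriv_std vG vst; rewrite st0 G0 zs' addr0 => /has_deriv_uniq E.
have -> : hess x s w w' =
    std (\sum_i \sum_(j | j != i) rank1 (dfwith (dfwith x (w i)) (w' j))) s.
  by rewrite std_suml; apply: eq_bigr => i _; rewrite std_suml.
apply: E; apply: eq_has_deriv (has_derivC 0) => t.
by rewrite std_suml big1 // => i _; rewrite nst.
Qed.

(** The correction terms of the projector have velocity 0: the multiple of
    [rank1 xi] because s is normal, the other ones because the derivatives of the
    contractions of s are values of the Hessian form. What remains is the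
    derivative of the scalar factor. *)
Lemma velocity_normal_proj x xi s w : (forall i, dot (x i) (xi i) = 1) ->
  normal x s -> (forall w', hess x s w w' = 0) ->
  exists c, velocity (fun t => normal_proj (line x w t) xi s) (c *: s).
Proof.
move=> x1 xs hess0.
have [d dP] : exists d, forall i, has_deriv (fun t => dot (line x w t i) (xi i)) (d i).
  exists (fun i => dot (w i) (xi i)) => i; apply: has_deriv_sum => k.
  have := has_derivM (has_deriv_line (x i 0 k) (w i 0 k)) (has_derivC (xi i 0 k)).
  by rewrite mulr0 addr0; apply: eq_has_deriv => t; rewrite /line !mxE.
have dC := has_deriv_prod dP; set c := \sum_i _ in dC; exists c.
have v1 := velocityZ dC (velocityC s); rewrite scaler0 addr0 in v1.
have contr0 i k : has_deriv (fun t => contraction (line x w t) i s 0 k) 0.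
  have := has_deriv_std (velocity_rank1_slot x w (delta_mx 0 k : 'rV[K]_(n i))) (velocityC s).
  rewrite std0r addr0 (_ : std _ _ = 0).
    by apply: eq_has_deriv => t; rewrite mxE.
  rewrite -[RHS](hess0 (dfwith (fun j => 0 : 'rV[K]_(n j)) (delta_mx 0 k : 'rV[K]_(n i)))).
  rewrite /hess [RHS](bigD1 i) //= [X in X + _]big1 ?add0r => [|j ji]; last first.
    rewrite (@rank1_eq0 _ _ _ _ j); first by rewrite stdC std0r.
    by rewrite dfwith_in dfwith_out // eq_sym.
  rewrite std_suml; apply: eq_bigr => l li.
  rewrite [RHS](bigD1 i) 1?eq_sym //= [X in _ + X]big1 ?addr0 => [|j /andP[_ ji]].
    by rewrite rank1_slot2C 1?eq_sym // dfwith_in.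
  rewrite (@rank1_eq0 _ _ _ _ j); first by rewrite stdC std0r.
  by rewrite dfwith_in dfwith_out // eq_sym.
have v2 : velocity (fun t => (p.-1%:R * std (rank1 (line x w t)) s) *: rank1 xi) 0.
  have := has_deriv_std (velocity_rank1 x w) (velocityC s).
  rewrite std0r addr0 std_suml big1 => [|i _]; last exact: xs.
  move=> /(has_derivZ p.-1%:R); rewrite mulr0 => /velocityZ/(_ (velocityC (rank1 xi))).
  by rewrite scale0r scaler0 addr0.
have v3 i : velocity (fun t => dot (line x w t i) (xi i) *:
    rank1 (dfwith xi (contraction (line x w t) i s))) 0.
  have vr : velocity (fun t => rank1 (dfwith xi (contraction (line x w t) i s))) 0.
    apply: tens_velocity => a; rewrite tens0.
    have := has_derivM (contr0 i (a i)) (has_derivC (\prod_(j | j != i) xi j 0 (a j))).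
    by rewrite mul0r mulr0 addr0; apply: eq_has_deriv => t; rewrite rank1_slot.
  apply: (velocityZ0 (dP i) vr); apply: (@rank1_eq0 _ _ _ _ i).
  rewrite dfwith_in; apply/rowP => k; rewrite !mxE.
  have := xs i (delta_mx 0 k); congr (std _ _ = _); apply: eq_rank1 => j.
  have [<-|ij] := eqVneq i j; first by rewrite !dfwith_in.
  by rewrite !dfwith_out // line0.
exact: velocityB0 (velocityD0 v1 v2) (velocity_sum0 v3).
Qed.

End Curves.

(** * Conormal vectors are differentials *)

Section DoubleAnnihilator.
Variables (K : numClosedFieldType) (W : vectType K).

(** Choose functions in the ideal whose differentials at y have maximal rank:
    their common kernel is the tangent space. *)
Lemma tangent_annihilator (S : set W) y (phi : W -> K) :
  (forall v w, phi (v + w) = phi v + phi w) -> (forall a v, phi (a *: v) = a * phi v) ->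
  (forall v, tangent S y v -> phi v = 0) ->
  exists2 f : poly_on W, vanishing_ideal S f & forall v, phi v = dpeval f y v.
Proof.
move=> phiD phiZ phi0; pose N := \dim (fullv : {vspace W}).
pose row (f : poly_on W) : 'rV[K]_N := \row_j peval (f^`M(j)) y.
pose mat k (f : 'I_k -> poly_on W) : 'M[K]_(k, N) := \matrix_i row (f i).
pose good (s : {k : nat & 'I_k -> poly_on W}) := forall i, vanishing_ideal S (projT2 s i).
have [|[k f] /= fS maxf] := @minimal_witness _ good
    (fun s => N - \rank (mat _ (projT2 s)))%N.
  by exists (existT _ 0%N (fun=> 0)) => i x _; rewrite /= /peval meval0.
have rowS (g : poly_on W) : vanishing_ideal S g -> (row g <= mat _ f)%MS.
  move=> gS; have good_g : good (existT _ k.+1 (fext f g)).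
    move=> i /=; case: (unliftP ord_max i) => [j|] ->; first by rewrite fext_lift; apply: fS.
    by rewrite fext_max.
  have sub1 : (mat _ f <= mat _ (fext f g))%MS.
    apply/row_subP => i; rewrite rowK.
    by rewrite -[row (f i)](_ : matrix.row (lift ord_max i) (mat _ (fext f g)) = _)
      ?row_sub // rowK fext_lift.
  have sub2 : (row g <= mat _ (fext f g))%MS.
    by rewrite -[row g](_ : matrix.row ord_max (mat _ (fext f g)) = _)
      ?row_sub // rowK fext_max.
  apply: (submx_trans sub2); rewrite -(geq_leqif (mxrank_leqif_sup sub1)).
  have := maxf _ good_g; rewrite /= => le; rewrite leqNgt; apply/negP => lt.
  move: le; rewrite leqNgt ltn_sub2l // (leq_trans lt) //; exact: rank_leq_col.
pose psi : 'rV[K]_N := \row_j phi (vbasis (fullv : {vspace W}))`_j.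
have phiE v : phi v = \sum_j psi 0 j * zcoord j v.
  have phi00 : phi 0 = 0 by rewrite -(scale0r 0) phiZ mul0r.
  rewrite [in LHS](sum_zcoord v) (big_morph phi phiD phi00); apply: eq_bigr => j _.
  by rewrite phiZ mxE mulrC.
have : (psi <= mat _ f)%MS.
  rewrite submxE; apply/eqP/rowP => c; rewrite [RHS]mxE.
  pose v : W := of_coords (fun j => cokermx (mat _ f) j c).
  have -> : (psi *m cokermx (mat _ f)) 0 c = phi v.
    by rewrite phiE mxE; apply: eq_bigr => j _; rewrite zcoord_of_coords.
  apply: phi0 => g /rowS; rewrite submxE => /eqP/rowP/(_ c).
  rewrite [RHS]mxE => g0; rewrite -[RHS]g0 mxE; apply: eq_bigr => j _.
  by rewrite zcoord_of_coords [row g 0 j]mxE.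
case/submxP => c psiE; exists (\sum_i (c 0 i)%:MP * f i).
  move=> x Sx; rewrite /peval raddf_sum /= big1 // => i _.
  by rewrite mevalM [X in _ * X](fS i x Sx) mulr0.
move=> v; rewrite phiE; apply: eq_bigr => j _; congr (_ * _).
rewrite psiE mxE /peval (linear_sum (mderiv j)) /= raddf_sum /=; apply: eq_bigr => i _.
by rewrite mderiv_mulC mevalM mevalC !mxE.
Qed.

End DoubleAnnihilator.

(** * The Bombieri-Weyl form, and the cone as a closed set *)

Section Forms.
Variables (R : realType) (p : nat) (n : 'I_p -> nat) (p_gt0 : (0 < p)%N).
Local Notation K := R[i].
Local Notation tens := (tensor R n).
Local Notation vecs := (vectors R n).
Implicit Types (x y xi w : vecs) (s z : tens).
Variable ip : forall i : 'I_p, {dot 'rV[R]_(n i) for idfun}.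

(** The tensor product of the maps h i. *)
Definition act (h : forall i, 'M[K]_(n i)) s : tens :=
  [ffun a : multi_index n => \sum_(b : multi_index n) (\prod_i h i (a i) (b i)) * s b].

Lemma actE h s (a : multi_index n) :
  act h s a = \sum_(b : multi_index n) (\prod_i h i (a i) (b i)) * s b.
Proof. exact: ffunE. Qed.

Lemma actD h s z : act h (s + z) = act h s + act h z.
Proof.
apply/ffunP => a; rewrite tensD !actE -big_split; apply: eq_bigr => b _.
by rewrite tensD mulrDr.
Qed.

Lemma actZ h c s : act h (c *: s) = c *: act h s.
Proof.
apply/ffunP => a; rewrite tensZ !actE mulr_sumr; apply: eq_bigr => b _.
by rewrite tensZ mulrCA.
Qed.

Lemma act_comp g h s : act g (act h s) = act (fun i => g i *m h i) s.
Proof.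
apply/ffunP => a; rewrite !actE.
under eq_bigr => b _ do rewrite actE mulr_sumr.
rewrite exchange_big /=; apply: eq_bigr => c _.
under eq_bigr => b _ do rewrite mulrA.
rewrite -mulr_suml; congr (_ * _).
rewrite (eq_bigr (fun b : multi_index n => \prod_i (g i (a i) (b i) * h i (b i) (c i))));
  last by move=> b _; rewrite big_split.
rewrite -(prod_sum_multi_index (fun i k => g i (a i) k * h i k (c i))).
by apply: eq_bigr => i _; rewrite mxE.
Qed.

Lemma act1 s : act (fun i => 1%:M) s = s.
Proof.
apply/ffunP => a; rewrite actE (bigD1 a) //= [X in _ + X]big1 ?addr0 => [|b ba].
  by rewrite big1 ?mul1r // => i _; rewrite mxE eqxx.
have /existsP[i ni] : [exists i, a i != b i].
  apply: contraNT ba; rewrite negb_exists => /forallP ab.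
  by apply/eqP/ffunP => i; apply/esym/eqP; rewrite -[_ == _]negbK ab.
by rewrite (bigD1 i) //= mxE (negbTE ni) !mul0r.
Qed.

Definition gram i : 'M[K]_(n i) := \matrix_(k, l) (ip i 'e_k 'e_l)%:C.

(** An inner product is positive definite, so its Gram matrix has trivial kernel. *)
Lemma gram_unit i : gram i \in unitmx.
Proof.
pose G : 'M[R]_(n i) := \matrix_(k, l) ip i 'e_k 'e_l.
have -> : gram i = map_mx (real_complex R) G by apply/matrixP => k l; rewrite !mxE.
rewrite map_unitmx -row_free_unit -kermx_eq0; apply: contraT => /rowV0Pn[v].
move/sub_kermxP => vG nzv; have := neq0_dnorm_gt0 (s := ip i) v nzv.
suff -> : ip i v v = 0 by rewrite ltxx.
rewrite {2}[v]row_sum_delta linear_sumr big1 // => l _.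
rewrite linearZr_LR /=; have /rowP/(_ l) := vG; rewrite !mxE => E.
suff -> : ip i v 'e_l = 0 by rewrite mulr0.
rewrite [v]row_sum_delta linear_sumlz -[RHS]E; apply: eq_bigr => k _.
by rewrite linearZl_LR /= mxE.
Qed.

Lemma BW_act s z : BW ip s z = std s (act gram z).
Proof.
apply: eq_bigr => a _; rewrite actE mulr_sumr; apply: eq_bigr => b _.
rewrite -mulrA; congr (_ * _); rewrite mulrC; congr (_ * _).
by apply: eq_bigr => i _; rewrite mxE.
Qed.

Lemma BW_sym s z : BW ip s z = BW ip z s.
Proof.
rewrite /BW exchange_big; apply: eq_bigr => a _; apply: eq_bigr => b _.
congr (_ * _); first by rewrite mulrC.
by apply: eq_bigr => i _; rewrite hermC expr0 mul1r.
Qed.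

(** The tensor that represents the linear form <., s> with respect to the
    Bombieri-Weyl form. *)
Definition raise s : tens := act (fun i => invmx (gram i)) s.

Lemma raise0 : raise 0 = 0.
Proof. by have := actZ (fun i => invmx (gram i)) 0 0; rewrite !scale0r. Qed.

Lemma raiseK s : act gram (raise s) = s.
Proof.
rewrite /raise act_comp -[RHS]act1; congr act; apply: functional_extensionality_dep => i.
by rewrite mulmxV ?gram_unit.
Qed.

Lemma lowerK s : raise (act gram s) = s.
Proof.
rewrite /raise act_comp -[RHS]act1; congr act; apply: functional_extensionality_dep => i.
by rewrite mulVmx ?gram_unit.
Qed.

Lemma BW_raise s z : BW ip s (raise z) = std s z.
Proof. by rewrite BW_act raiseK. Qed.

Lemma raiseD s z : raise (s + z) = raise s + raise z.
Proof. exact: actD. Qed.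

Lemma raiseZ c s : raise (c *: s) = c *: raise s.
Proof. exact: actZ. Qed.

Definition exchange (a b : multi_index n) i : multi_index n :=
  finfun (dfwith (a : forall i, 'I_(n i)) (b i)).

Lemma exchange_in a b i : exchange a b i i = b i.
Proof. by rewrite ffunE dfwith_in. Qed.

Lemma exchange_out a b i j : i != j -> exchange a b i j = a j.
Proof. by move=> ij; rewrite ffunE dfwith_out. Qed.

Lemma segre_exchange s a b i : @segre_cone R p n s ->
  s a * s b = s (exchange a b i) * s (exchange b a i).
Proof.
case=> x ->; rewrite !ffunE -!big_split; apply: eq_bigr => j _ /=.
have [<-|ij] := eqVneq i j; first by rewrite !exchange_in mulrC.
by rewrite !exchange_out.
Qed.

Lemma segre_coneZ c s : @segre_cone R p n s -> @segre_cone R p n (c *: s).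
Proof.
case=> x ->; pose i0 := Ordinal p_gt0; exists (dfwith x (c *: x i0)).
by rewrite rank1_slotZ rank1_slot_id.
Qed.

Lemma segre_cone0 : @segre_cone R p n 0.
Proof.
rewrite -(scale0r (rank1 (fun i => 0) : tens)); apply: segre_coneZ.
by exists (fun i => 0).
Qed.

Lemma poly_fun_entry a : poly_fun (fun s : tens => s a).
Proof. by apply: poly_fun_linear => *; rewrite ?tensD ?tensZ. Qed.

(** The quadrics s_a s_b = s_a' s_b', where a' and b' are a and b with one entry
    exchanged, cut out the cone: near an entry s_b that is not zero, s is
    determined by the entries whose index differs from b in one place. *)
Lemma zclosed_segre : zclosed (@segre_cone R p n).
Proof.
move=> s scl; have ex a b i : s a * s b = s (exchange a b i) * s (exchange b a i).
  apply/eqP; rewrite -subr_eq0; apply/eqP.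
  apply: (zclosure_poly_fun (h := fun s : tens =>
    s a * s b - s (exchange a b i) * s (exchange b a i)) _ _ scl).
    by apply: poly_funB; apply: poly_funM; apply: poly_fun_entry.
  by move=> t /segre_exchange => /(_ a b i) ->; rewrite subrr.
have [->|nz] := eqVneq s 0; first exact: segre_cone0.
have [b nzb] : exists b, s b != 0.
  apply: contrapT => nob; case/eqP: nz; apply/ffunP => a; rewrite tens0.
  by apply/eqP; apply: contraT => nza; case: nob; exists a.
pose q i (k : 'I_(n i)) := s (finfun (dfwith (b : forall i, 'I_(n i)) k)) / s b.
suff sE a : s a = s b * \prod_i q i (a i).
  rewrite (_ : s = s b *: rank1 (fun i => \row_k q i k)).
    by apply: segre_coneZ; exists (fun i => \row_k q i k).
  apply/ffunP => a; rewrite [LHS]sE tensZ; congr (_ * _); rewrite ffunE.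
  by apply: eq_bigr => i _; rewrite mxE.
pose mix k : multi_index n := finfun (fun j : 'I_p => if (j < k)%N then a j else b j).
have -> : a = mix p by apply/ffunP => j; rewrite ffunE ltn_ord.
suff : forall k, (k <= p)%N -> s (mix k) = s b * \prod_(i < p | (i < k)%N) q i (a i).
  move/(_ p (leqnn p)) => ->; congr (_ * _); apply: eq_big => [i|i _].
    by rewrite ltn_ord.
  by rewrite ffunE ltn_ord.
elim=> [_|k IHk lt_kp].
  rewrite big_pred0 // mulr1; congr (s _); by apply/ffunP => j; rewrite ffunE.
pose i := Ordinal lt_kp.
have mixk : exchange (mix k.+1) b i = mix k.
  apply/ffunP => j; have [<-|ij] := eqVneq i j.
    by rewrite exchange_in ffunE /= ltnn.
  rewrite exchange_out // !ffunE ltnS leq_eqVlt.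
  rewrite (negbTE (_ : (j : nat) != k)) //= eq_sym.
  by apply: contra ij => /eqP E; apply/eqP/val_inj.
have bk : exchange b (mix k.+1) i = finfun (dfwith (b : forall i, 'I_(n i)) (a i)).
  apply/ffunP => j; rewrite !ffunE; have [<-|ij] := eqVneq i j.
    by rewrite !dfwith_in ltnS leqnn.
  by rewrite !dfwith_out.
have := ex (mix k.+1) b i; rewrite mixk bk (IHk (ltnW lt_kp)) => E.
apply: (mulIf nzb); rewrite E -mulrA -[RHS]mulrA; congr (_ * _).
have <- : q i (a i) * s b = s (finfun (dfwith (b : forall i, 'I_(n i)) (a i))).
  by rewrite /q divfK.
rewrite mulrCA mulrA; congr (_ * _); rewrite [RHS](bigD1 i) //=.
congr (_ * _); apply: eq_bigl => j; rewrite ltnS [(j <= k)%N]leq_eqVlt -val_eqE /=.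
by case: ltngtP.
Qed.

End Forms.

(** * Polynomial maps and velocities in products and families *)

Section Products.
Variables (K : numClosedFieldType).
Implicit Types (U V W : vectType K).

Lemma poly_map_additive U W (phi : U -> W) :
  (forall x y, phi (x + y) = phi x + phi y) -> (forall a x, phi (a *: x) = a *: phi x) ->
  poly_map phi.
Proof.
move=> phiD phiZ j; apply: poly_fun_linear => [x y|a x]; first by rewrite phiD zcoordD.
by rewrite phiZ zcoordZ.
Qed.

Lemma velocity_additive U W (phi : U -> W) (g : K -> U) v :
  (forall x y, phi (x + y) = phi x + phi y) -> (forall a x, phi (a *: x) = a *: phi x) ->
  velocity g v -> velocity (fun t => phi (g t)) (phi v).
Proof.
move=> phiD phiZ gv j.
apply: (has_deriv_linear (h := fun x => zcoord j (phi x)) _ _ gv) => [x y|a x].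
  by rewrite phiD zcoordD.
by rewrite phiZ zcoordZ.
Qed.

Lemma pair_sum V W (x : V) (y : W) : (x, y) = (x, 0) + (0, y) :> V * W.
Proof. by congr pair; rewrite ?addr0 ?add0r. Qed.

Lemma pair_scale0 V W a (y : W) : (0, a *: y) = a *: (0, y) :> V * W.
Proof. by congr pair; rewrite /= scaler0. Qed.

Lemma dpeval_pair V W (g : poly_on (V * W)%type) q (v : V) a (w : W) :
  dpeval g q (0, w) = 0 -> dpeval g q (v, a *: w) = dpeval g q (v, 0).
Proof. by move=> w0; rewrite pair_sum pair_scale0 dpevalD dpevalZ w0 mulr0 addr0. Qed.

Lemma poly_map_pair U V W (phi : U -> V) (psi : U -> W) :
  poly_map phi -> poly_map psi -> poly_map (fun u => (phi u, psi u) : V * W).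
Proof.
move=> phiP psiP j.
apply: (@eq_poly_fun _ _ (fun u =>
  zcoord j (phi u, 0 : W) + zcoord j (0 : V, psi u))).
  by move=> u; rewrite -zcoordD -pair_sum.
apply: poly_funD.
  apply: (poly_fun_comp (h := fun v : V => zcoord j (v, 0 : W))) phiP.
  apply: poly_fun_linear => [x y|a x].
    by rewrite -zcoordD; congr zcoord; congr pair; rewrite /= addr0.
  by rewrite -zcoordZ; congr zcoord; congr pair; rewrite /= scaler0.
apply: (poly_fun_comp (h := fun w : W => zcoord j (0 : V, w))) psiP.
apply: poly_fun_linear => [x y|a x].
  by rewrite -zcoordD; congr zcoord; congr pair; rewrite /= addr0.
by rewrite -zcoordZ; congr zcoord; congr pair; rewrite /= scaler0.
Qed.

Lemma velocity_pair V W (g : K -> V) (h : K -> W) v w :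
  velocity g v -> velocity h w -> velocity (fun t => (g t, h t) : V * W) (v, w).
Proof.
move=> gv hw j; rewrite pair_sum zcoordD.
apply: (@eq_has_deriv _ (fun t => zcoord j (g t, 0 : W) + zcoord j (0 : V, h t))).
  by move=> t; rewrite -zcoordD -pair_sum.
apply: has_derivD.
  apply: (has_deriv_linear (h := fun v : V => zcoord j (v, 0 : W)) _ _ gv) => [x y|a x].
    by rewrite -zcoordD; congr zcoord; congr pair; rewrite /= addr0.
  by rewrite -zcoordZ; congr zcoord; congr pair; rewrite /= scaler0.
apply: (has_deriv_linear (h := fun w : W => zcoord j (0 : V, w)) _ _ hw) => [x y|a x].
  by rewrite -zcoordD; congr zcoord; congr pair; rewrite /= addr0.
by rewrite -zcoordZ; congr zcoord; congr pair; rewrite /= scaler0.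
Qed.

Lemma poly_map_fst V W : poly_map (fun q : V * W => q.1).
Proof. exact: poly_map_additive. Qed.

Lemma poly_map_snd V W : poly_map (fun q : V * W => q.2).
Proof. exact: poly_map_additive. Qed.

(** A generic parameter is enough for membership in a closed set. *)
Lemma zclosure_generic U W (phi : U -> W) (S : set W) (d : poly_on U) :
  poly_map phi -> d != 0 -> (forall u, peval d u != 0 -> S (phi u)) ->
  forall u, zclosure S (phi u).
Proof.
move=> phiP nzd dS u f fS; move: u; apply: (@poly_fun_dense _ _ (peval f \o phi) (peval d)).
- exact: poly_fun_comp (poly_fun_peval f) phiP.
- exact: poly_fun_peval.
- exact: exists_peval_neq0.
by move=> x /dS/fS.
Qed.

End Products.

Section PolynomialParameters.
Variables (R : realType) (p : nat) (n : 'I_p -> nat).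
Local Notation K := R[i].
Local Notation tens := (tensor R n).
Local Notation vecs := (vectors R n).
Variable (U : vectType K).

Definition poly_vecs (x : U -> vecs) := forall i k, poly_fun (fun u => x u i 0 k).

Lemma poly_map_rank1 (x : U -> vecs) : poly_vecs x -> poly_map (fun u => rank1 (x u) : tens).
Proof.
move=> xP; apply: tens_poly_map => a.
apply: (@eq_poly_fun _ _ (fun u => \prod_i x u i 0 (a i))); first by move=> u; rewrite ffunE.
by apply: poly_fun_prod => i _; apply: xP.
Qed.

Lemma poly_fun_std (f g : U -> tens) :
  poly_map f -> poly_map g -> poly_fun (fun u => std (f u) (g u)).
Proof.
by move=> fP gP; apply: poly_fun_sum => a _; apply: poly_funM; apply: poly_map_tens.
Qed.

Lemma poly_fun_dot (x y : U -> vecs) i :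
  poly_vecs x -> poly_vecs y -> poly_fun (fun u => dot (x u i) (y u i)).
Proof. by move=> xP yP; apply: poly_fun_sum => k _; apply: poly_funM. Qed.

Lemma poly_map_slot (x : U -> vecs) i (v : U -> 'rV[K]_(n i)) :
  poly_vecs x -> (forall k, poly_fun (fun u => v u 0 k)) ->
  poly_map (fun u => rank1 (dfwith (x u) (v u)) : tens).
Proof.
move=> xP vP; apply: tens_poly_map => a.
apply: (@eq_poly_fun _ _ (fun u => v u 0 (a i) * \prod_(j | j != i) x u j 0 (a j))).
  by move=> u; rewrite rank1_slot.
by apply: poly_funM => //; apply: poly_fun_prod => j _; apply: xP.
Qed.

Lemma poly_map_normal_proj (x xi : U -> vecs) (s : U -> tens) :
  poly_vecs x -> poly_vecs xi -> poly_map s ->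
  poly_map (fun u => normal_proj (x u) (xi u) (s u)).
Proof.
move=> xP xiP sP.
have dotP i := @poly_fun_dot x xi i xP xiP.
have contrP i k : poly_fun (fun u => contraction (x u) i (s u) 0 k).
  apply: (@eq_poly_fun _ _ (fun u =>
    std (rank1 (dfwith (x u) (delta_mx 0 k : 'rV[K]_(n i)))) (s u))).
    by move=> u; rewrite mxE.
  by apply: poly_fun_std => //; apply: poly_map_slot => // l; apply: poly_funC.
apply: poly_mapD; first apply: poly_mapD.
- by apply: poly_mapZ => //; apply: poly_fun_prod => i _; apply: dotP.
- apply: poly_mapZ; last exact: poly_map_rank1.
  by apply: poly_funM; [apply: poly_funC|apply: poly_fun_std => //; apply: poly_map_rank1].
pose sum u := \sum_i
  dot (x u i) (xi u i) *: rank1 (dfwith (xi u) (contraction (x u) i (s u))).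
have sumP : poly_map sum.
  apply: poly_map_sum => i; apply: poly_mapZ => //; exact: poly_map_slot.
move=> j; apply: (@eq_poly_fun _ _ (fun u => - zcoord j (sum u))).
  by move=> u; rewrite /zcoord linearN.
by apply: poly_funN.
Qed.

End PolynomialParameters.

(** * The conormal variety and the dual variety of the cone *)

Section Conormal.
Variables (R : realType) (p : nat) (n : 'I_p -> nat) (p_gt0 : (0 < p)%N).
Local Notation K := R[i].
Local Notation tens := (tensor R n).
Local Notation vecs := (vectors R n).
Implicit Types (x y xi w : vecs) (s z : tens).
Variable ip : forall i : 'I_p, {dot 'rV[R]_(n i) for idfun}.
Local Notation X := (@segre_cone R p n).
Local Notation Xd := (dual_variety (BW ip) X).

(** The families of factors as a vector space, the source of polynomial maps. *)
Definition entries := {ffun {i : 'I_p & 'I_(n i)} -> K^o}.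

HB.instance Definition _ := Vector.on entries.

Definition to_vectors (e : entries) : vecs := fun i => \row_k e (existT _ i k).

Definition of_vectors x : entries := [ffun t => x (tag t) 0 (tagged t)].

Lemma of_vectorsK x : to_vectors (of_vectors x) = x.
Proof.
by apply: functional_extensionality_dep => i; apply/rowP => k; rewrite mxE ffunE.
Qed.

Lemma to_vectors_line (e e' : entries) t :
  to_vectors (e + t *: e') = line (to_vectors e) (to_vectors e') t.
Proof.
apply: functional_extensionality_dep => i; apply/rowP => k; rewrite !mxE.
by rewrite ffunE; congr (_ + _); rewrite ffunE.
Qed.

Lemma poly_fun_to_vectors (U : vectType K) (phi : U -> entries) :
  poly_map phi -> poly_vecs (fun u => to_vectors (phi u)).
Proof.
move=> phiP i k; apply: (@eq_poly_fun _ _ ((fun e : entries => e (existT _ i k)) \o phi)).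
  by move=> u; rewrite mxE.
apply: poly_fun_comp phiP; apply: poly_fun_linear => [e e'|a e]; exact: ffunE.
Qed.

Definition params := (entries * entries * tens)%type.

HB.instance Definition _ := Vector.on params.

Definition normal_par (u : params) : tens :=
  normal_proj (to_vectors u.1.1) (to_vectors u.1.2) u.2.

(** The parameters are the factors x, the dual vectors xi of [normal_proj], and an
    arbitrary tensor, which is projected to the normal space. *)
Definition conormal_par (u : params) : tens * tens :=
  (rank1 (to_vectors u.1.1), raise ip (normal_par u)).

Definition dual_par (u : params) : tens := raise ip (normal_par u).

Definition par x xi s : params := (of_vectors x, of_vectors xi, s).

Lemma normal_par_par x xi s : normal_par (par x xi s) = normal_proj x xi s.
Proof. by rewrite /normal_par /= !of_vectorsK. Qed.

Lemma conormal_par_par x xi s :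
  conormal_par (par x xi s) = (rank1 x, raise ip (normal_proj x xi s)).
Proof. by rewrite /conormal_par normal_par_par /= of_vectorsK. Qed.

Lemma normal_par_normal u : normal (to_vectors u.1.1) (normal_par u).
Proof. exact: normal_proj_normal. Qed.

Lemma poly_map_params :
  [/\ poly_map (fun u : params => u.1.1), poly_map (fun u : params => u.1.2) &
      poly_map (fun u : params => u.2)].
Proof.
by split; apply: poly_map_additive.
Qed.

Lemma poly_map_normal_par : poly_map normal_par.
Proof.
have [P1 P2 P3] := poly_map_params.
by apply: poly_map_normal_proj => //; apply: poly_fun_to_vectors.
Qed.

Lemma poly_map_raise : poly_map (raise ip).
Proof. by apply: poly_map_additive => *; rewrite ?raiseD ?raiseZ. Qed.

Lemma velocity_raise (g : K -> tens) (v : tens) :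
  velocity g v -> velocity (fun t => raise ip (g t)) (raise ip v).
Proof. by apply: velocity_additive => *; rewrite ?raiseD ?raiseZ. Qed.

Lemma poly_map_dual_par : poly_map dual_par.
Proof. exact: poly_map_comp poly_map_raise poly_map_normal_par. Qed.

Lemma poly_map_conormal_par : poly_map conormal_par.
Proof.
have [P1 _ _] := poly_map_params; apply: poly_map_pair poly_map_dual_par.
by apply: poly_map_rank1; apply: poly_fun_to_vectors.
Qed.

Lemma normal_pair_par x s : (forall i, x i != 0) -> normal x s ->
  exists u, conormal_par u = (rank1 x, raise ip s).
Proof.
move=> nzx xs; have [xi xiP] : exists xi : vecs, forall i, dot (x i) (xi i) = 1.
  by exists (fun i => sval (cid (exists_dual (nzx i)))) => i; case: cid.
by exists (par x xi s); rewrite conormal_par_par normal_proj_id.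
Qed.

Lemma tangent_segre x i (v : 'rV[K]_(n i)) :
  tangent X (rank1 x) (rank1 (dfwith x v)).
Proof.
have := @tangent_velocity _ _ X _ _ _ (velocity_line (rank1 x : tens) (rank1 (dfwith x v))).
rewrite scale0r addr0; apply => t; exists (dfwith x (x i + t *: v)).
by rewrite rank1_slotD rank1_slotZ rank1_slot_id.
Qed.

Lemma normal_space_segre x s :
  normal_space (BW ip) X (rank1 x) (raise ip s) -> normal x s.
Proof. by move=> xs i v; rewrite -(BW_raise ip) xs //; apply: tangent_segre. Qed.

Lemma range_rank1 : range (fun e : entries => rank1 (to_vectors e) : tens) = X.
Proof.
apply/seteqP; split=> [_ [e _ <-]|_ [x ->]]; first by exists (to_vectors e).
by exists (of_vectors x); rewrite ?of_vectorsK.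
Qed.

Lemma zclosure_segre : zclosure X = X.
Proof. by apply/seteqP; split; [apply: zclosed_segre|apply: sub_zclosure]. Qed.

(** At a regular point with nonzero factors, a normal vector is a fixed vector of the
    projector for suitable xi. If a factor vanishes, the point is 0; all rank-one
    tensors are tangent there, so the only normal vector is 0. Conversely,
    values at generic parameters are pairs of a regular point and a normal
    vector. *)
Lemma conormal_segre : conormal (BW ip) X = zclosure (range conormal_par).
Proof.
apply/seteqP; split.
  apply: zclosure_sub => -[_ y] /= [[[x ->] _]]; rewrite -(lowerK ip y).
  move: (act _ y) => s xs; have sN := normal_space_segre xs.
  have [nzx|] := boolP [forall i, x i != 0].
    by have [|u uP] := normal_pair_par _ sN; [apply/forallP|exists u].
  rewrite negb_forall => /existsP[l]; rewrite negbK => /eqP xi0.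
  have x0 := rank1_eq0 xi0; exists (par (fun i => 0) (fun i => 0) 0) => //.
  rewrite conormal_par_par x0 (@rank1_eq0 _ _ _ _ l) //; congr (_, raise ip _).
  have -> : s = 0.
    apply: std_eq0 => z; rewrite [z]sum_basis_tensor std_suml big1 // => a _.
    rewrite stdZl -(BW_raise ip) xs ?mulr0 // x0 basis_tensor_rank1.
    have := @tangent_velocity _ _ X _ _ _
      (velocity_line (0 : tens) (rank1 (fun i => delta_mx 0 (a i)))).
    rewrite scale0r addr0; apply => t; rewrite add0r; apply: segre_coneZ => //.
    by exists (fun i => delta_mx 0 (a i)).
  apply: std_eq0 => z; rewrite /normal_proj stdDr stdDr stdNr !stdZr !std0r.
  rewrite !mulr0 !mul0r addr0 std_sumr big1 ?subr0 // => j _.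
  by rewrite stdZr /dot big1 ?mul0r // => k _; rewrite mxE mul0r.
apply: zclosure_min; last exact: zclosed_zclosure.
pose phi (e : entries) : tens := rank1 (to_vectors e).
have phiP : poly_map phi.
  by apply: poly_map_rank1; apply: poly_fun_to_vectors; apply: poly_map_id.
have [d nzd dP] := generic_regular phiP; rewrite range_rank1 zclosure_segre in dP.
have [P1 _ _] := poly_map_params.
have [d' d'P] := poly_fun_comp (poly_fun_peval d) P1.
have nzd' : d' != 0.
  have [e nze] := exists_peval_neq0 nzd.
  have : peval d' ((e, 0, 0) : params) != 0 by rewrite -d'P.
  by apply: contraNneq => ->; rewrite /peval meval0.
move=> _ [u _ <-]; apply: (zclosure_generic poly_map_conormal_par nzd') => {}u.
rewrite -d'P => /= /dP[reg tan]; split=> //= v /tan[e ve].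
rewrite BW_raise.
have -> : v = \sum_i rank1 (dfwith (to_vectors u.1.1) (to_vectors e i)).
  apply: velocity_uniq ve _.
  apply: eq_velocity (velocity_rank1 (to_vectors u.1.1) (to_vectors e)) => t.
  by rewrite /phi to_vectors_line.
by rewrite std_suml big1 // => i _; apply: normal_par_normal.
Qed.

Lemma dual_segre : Xd = zclosure (range dual_par).
Proof.
rewrite /dual_variety conormal_segre; apply/seteqP; split.
  apply: zclosure_min; last exact: zclosed_zclosure.
  move=> y [x xy]; apply: (zclosure_image (@poly_map_snd _ _ _) _ xy).
  by move=> _ [u _ <-]; exists u.
apply: zclosure_sub => _ [u _ <-]; exists (rank1 (to_vectors u.1.1)).
by apply: sub_zclosure; exists u.
Qed.

(** At a generic parameter, a tangent vector of the dual variety is the velocity of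
    a curve y_t which is the second component of a curve of conormal pairs
    (x_t, y_t). Differentiating <x_t, y_t> = 0 at t = 0 yields <x_0, y'> = 0, since
    the velocity of x_t is a tangent vector and y_0 is normal. *)
Lemma conormal_dual_par u :
  conormal (BW ip) Xd ((conormal_par u).2, (conormal_par u).1).
Proof.
have swapP : poly_map (fun u => ((conormal_par u).2, (conormal_par u).1) : tens * tens).
  apply: poly_map_pair.
    exact: poly_map_comp (@poly_map_snd _ _ _) poly_map_conormal_par.
  exact: poly_map_comp (@poly_map_fst _ _ _) poly_map_conormal_par.
have [d nzd dP] := generic_regular poly_map_dual_par; rewrite -dual_segre in dP.
apply: (zclosure_generic swapP nzd) => {}u /dP[reg tan]; split=> //= v /tan[w vw].
pose x := to_vectors u.1.1; pose x' := to_vectors w.1.1.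
have [s' vs'] := poly_map_velocity u w poly_map_normal_par.
have -> : v = raise ip s'.
  by apply: velocity_uniq vw _; apply: velocity_raise vs'.
rewrite BW_sym BW_raise.
have vx : velocity (fun t => rank1 (to_vectors (u + t *: w).1.1) : tens)
    (\sum_i rank1 (dfwith x (x' i))).
  by apply: eq_velocity (velocity_rank1 x x') => t; rewrite to_vectors_line.
have := has_deriv_std vx vs'.
rewrite scale0r addr0 std_suml big1 ?add0r => [|i _]; last exact: normal_par_normal.
move=> /has_deriv_uniq; apply; apply: eq_has_deriv (has_derivC 0) => t.
by rewrite normal_rank1 //; apply: normal_par_normal.
Qed.

End Conormal.

(** * The normal spaces of the dual variety *)

Lemma line_rescale (K : fieldType) (V : lmodType K) (z x : V) t : t != 0 ->
  z + t *: x = t *: (x + t^-1 *: z).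
Proof. by move=> nzt; rewrite scalerDr scalerA mulfV // scale1r addrC. Qed.

Section Biduality.
Variables (R : realType) (p : nat) (n : 'I_p -> nat) (p_gt0 : (0 < p)%N).
Local Notation K := R[i].
Local Notation tens := (tensor R n).
Local Notation vecs := (vectors R n).
Implicit Types (x xi w : vecs) (s y z : tens).
Variable ip : forall i : 'I_p, {dot 'rV[R]_(n i) for idfun}.
Local Notation X := (@segre_cone R p n).
Local Notation Xd := (dual_variety (BW ip) X).
Local Notation conormal_par := (conormal_par ip).
Local Notation dual_par := (dual_par ip).

Definition differential (f : poly_on tens) (y : tens) : tens :=
  [ffun a => dpeval f y (basis_tensor R a)].

Definition gradient (f : poly_on tens) (y : tens) : tens := raise ip (differential f y).

Lemma BW_gradient f (y v : tens) : BW ip v (gradient f y) = dpeval f y v.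
Proof.
rewrite BW_raise [in RHS](sum_basis_tensor v).
have d0 : dpeval f y 0 = 0 by rewrite -(scale0r 0) dpevalZ mul0r.
rewrite (big_morph (dpeval f y) (dpevalD _ _) d0); apply: eq_bigr => a _.
by rewrite dpevalZ; congr (_ * _); apply: ffunE.
Qed.

Lemma poly_map_gradient f : poly_map (gradient f).
Proof.
apply: (@poly_map_comp _ tens tens tens) (poly_map_raise ip) _.
apply: tens_poly_map => a.
apply: (@eq_poly_fun _ tens (fun y => dpeval f y (basis_tensor R a))).
  by move=> y; rewrite /differential ffunE.
apply: poly_fun_sum => j _; apply: poly_funM; last exact: poly_funC.
exact: poly_fun_peval.
Qed.

Lemma dual_parE f x xi s : vanishing_ideal (range dual_par) f ->
  peval f (raise ip (normal_proj x xi s)) = 0.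
Proof.
move=> fXd; apply: fXd; exists (par x xi s); first exact: I.
by rewrite /dual_par normal_par_par.
Qed.

(** The Hamiltonian vector field of f, as a function of the second factor, is
    tangent to the conormal variety. As f vanishes on the dual variety, its
    gradient is orthogonal to the normal space at x, hence tangent along some w,
    and w is in the kernel of the Hessian form of s. So s remains normal to first
    order, up to a scalar, when x moves along w; the scalar is compensated by
    moving s along its line. *)
Lemma hamiltonian_tangent f g u :
  vanishing_ideal (range dual_par) f -> vanishing_ideal (range conormal_par) g ->
  \prod_i dot (to_vectors u.1.1 i) (to_vectors u.1.2 i) != 0 ->
  dpeval g (conormal_par u) (gradient f (dual_par u), 0) = 0.
Proof.
move=> fXd gC nzu; pose x := to_vectors u.1.1; pose xi0 := to_vectors u.1.2.
pose xi i := (dot (x i) (xi0 i))^-1 *: xi0 i.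
have x1 i : dot (x i) (xi i) = 1.
  by rewrite dotZr mulVf //; move/prodf_neq0: nzu => /(_ i isT).
pose s := normal_par u; have xs : normal x s by apply: normal_par_normal.
pose z := gradient f (raise ip s).
have projs s1 : normal x s1 -> normal_proj x xi s1 = s1 by apply: normal_proj_id.
have zN s1 : normal x s1 -> std z s1 = 0.
  move=> xs1; rewrite -(BW_raise ip) BW_sym BW_gradient.
  have vs1 := velocity_raise ip (velocity_line s s1).
  have := has_deriv_peval f vs1; rewrite scale0r addr0 => /has_deriv_uniq; apply.
  apply: eq_has_deriv (has_derivC 0) => t; rewrite -(projs (s + t *: s1)) ?dual_parE //.
  by apply: normalD => //; apply: normalZ.
have [w zw] := tangent_span p_gt0 x1 zN.
have line00 w' : line x w' 0 = x.
  by apply: functional_extensionality_dep => i; rewrite line0.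
have hess0 w' : hess x s w w' = 0.
  pose st t := normal_proj (line x w' t) xi s.
  have [s' vs'] : exists s', velocity st s'.
    have projP : poly_map (fun e : entries R n => normal_proj (to_vectors e) xi s).
      apply: poly_map_normal_proj; last exact: poly_map_cst.
        by apply: poly_fun_to_vectors; apply: poly_map_id.
      by move=> i k; apply: poly_funC.
    have [s' vs'] := poly_map_velocity (of_vectors x) (of_vectors w') projP.
    exists s'; apply: eq_velocity vs' => t.
    by rewrite to_vectors_line !of_vectorsK.
  apply: (hess_eq0 (st := st) _ _ vs') => [t||].
  - exact: normal_proj_normal.
  - by rewrite /st line00 projs.
  rewrite -zw -(BW_raise ip) BW_sym BW_gradient.
  have := has_deriv_peval f (velocity_raise ip vs').
  rewrite /st line00 projs // => /has_deriv_uniq; apply.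
  by apply: eq_has_deriv (has_derivC 0) => t; rewrite dual_parE.
have [c vc] := velocity_normal_proj x1 xs hess0.
have uE : conormal_par u = (rank1 x, raise ip s) by [].
have gP x' xi' s1 : peval g (rank1 x', raise ip (normal_proj x' xi' s1)) = 0.
  apply: gC; exists (par x' xi' s1); first exact: I.
  exact: conormal_par_par.
have d1 : dpeval g (rank1 x, raise ip s) (z, c *: raise ip s) = 0.
  have := has_deriv_peval g (velocity_pair (velocity_rank1 x w) (velocity_raise ip vc)).
  rewrite line00 projs // raiseZ -zw => /has_deriv_uniq; apply.
  by apply: eq_has_deriv (has_derivC 0) => t; rewrite gP.
have d2 : dpeval g (rank1 x, raise ip s) (0, raise ip s) = 0.
  have := has_deriv_peval g (velocity_pair (velocityC (rank1 x : tens))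
    (velocity_raise ip (velocity_line s s))).
  rewrite scale0r addr0 => /has_deriv_uniq; apply.
  apply: eq_has_deriv (has_derivC 0) => t; rewrite -(projs (s + t *: s)) ?gP //.
  by apply: normalD => //; apply: normalZ.
by rewrite uE -d1; apply/esym; apply: (dpeval_pair _ _ d2).
Qed.

Lemma poly_const_deriv0 (P : {poly K}) : P^`() = 0 -> P = (P`_0)%:P.
Proof.
move/polyP=> P'0; apply/polyP => -[|k]; rewrite coefC //=.
have := P'0 k; rewrite coef_deriv coef0 => /eqP.
by rewrite mulrn_eq0 /= => /eqP.
Qed.

Lemma deriv_horner (h h' : K -> K) (P : {poly K}) : (forall t, h t = P.[t]) ->
  (forall t, has_deriv (fun r => h (t + r)) (h' t)) -> forall t, h' t = P^`().[t].
Proof.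
move=> hP hh' t; apply: has_deriv_uniq (hh' t) _.
exists (P \Po ('X + t%:P)) => [r|].
  by rewrite hP horner_comp !hornerE addrC.
by rewrite deriv_comp derivD derivX derivC addr0 mulr1 horner_comp !hornerE.
Qed.

Hypothesis n_gt0 : forall i, (0 < n i)%N.

Lemma exists_dual_params : exists u : params R n,
  \prod_i dot (to_vectors u.1.1 i) (to_vectors u.1.2 i) != 0.
Proof.
pose e i : 'rV[K]_(n i) := delta_mx 0 (Ordinal (n_gt0 i)).
have nze i : e i != 0.
  apply/eqP => /rowP/(_ (Ordinal (n_gt0 i))); rewrite !mxE !eqxx => /eqP.
  by rewrite oner_eq0.
pose xi i := sval (cid (exists_dual (nze i))).
exists (par e xi 0); rewrite /= !of_vectorsK; apply/prodf_neq0 => i _.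
by rewrite /xi; case: cid => v /= ->; rewrite oner_neq0.
Qed.

(** The Hamiltonian vector field is constant along its integral curves, which are
    the lines r |-> (x + r z, y); all derivatives along such a line of a
    function that vanishes on the conormal variety vanish at r = 0. *)
Lemma hamiltonian_flow f u t : vanishing_ideal (range dual_par) f ->
  X (rank1 (to_vectors u.1.1) + t *: gradient f (dual_par u)).
Proof.
move=> fXd; pose y := dual_par u; pose x := rank1 (to_vectors u.1.1) : tens.
pose z := gradient f y.
have zP : poly_map (fun q : tens * tens => (gradient f q.2, 0) : tens * tens).
  apply: poly_map_pair; last exact: poly_map_cst.
  exact: poly_map_comp (poly_map_gradient f) (@poly_map_snd _ _ _).
have adP (g : poly_on (tens * tens)%type) :
    poly_fun (fun q => dpeval g q (gradient f q.2, 0)).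
  apply: poly_fun_sum => j _; apply: poly_funM; first exact: poly_fun_peval.
  exact: (zP j).
have adC g g' : vanishing_ideal (range conormal_par) g ->
    (fun q => dpeval g q (gradient f q.2, 0)) =1 peval g' ->
    vanishing_ideal (range conormal_par) g'.
  move=> gC gg' _ [v _ <-]; rewrite -gg'; move: v.
  apply: (@poly_fun_dense _ _ _ (fun v : params R n =>
    \prod_i dot (to_vectors v.1.1 i) (to_vectors v.1.2 i))).
  - exact: poly_fun_comp (adP g) (poly_map_conormal_par ip).
  - have [P1 P2 _] := @poly_map_params R p n.
    apply: poly_fun_prod => i _.
    by apply: (poly_fun_dot (x := fun v : params R n => to_vectors v.1.1)
      (y := fun v : params R n => to_vectors v.1.2)); apply: poly_fun_to_vectors.
  - exact: exists_dual_params.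
  by move=> v nzv; apply: hamiltonian_tangent.
have flow k : forall g (P : {poly K}), vanishing_ideal (range conormal_par) g ->
    (forall r, peval g (x + r *: z, y) = P.[r]) -> (size P <= k)%N -> P = 0.
  elim: k => [|k IHk] g P gC gP szP; first by apply/eqP; rewrite -size_poly_eq0 -leqn0.
  have [g' gg'] := adP g.
  have P'0 : P^`() = 0.
    apply: (IHk g') => [|r|]; first exact: adC gg'.
      rewrite -gg' -[dpeval _ _ _]/(dpeval g (x + r *: z, y) (z, 0)).
      apply: (deriv_horner (h' := fun r => dpeval g (x + r *: z, y) (z, 0)) gP) => {}r.
      have := has_deriv_peval g (velocity_pair (velocity_line (x + r *: z) z) (velocityC y)).
      rewrite scale0r addr0; apply: eq_has_deriv => r'.
      by rewrite scalerDl addrA.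
    have [->|nzP] := eqVneq P 0; first by rewrite deriv0 size_poly0.
    by rewrite -ltnS (leq_trans (lt_size_deriv nzP)).
  have := gP 0; rewrite scale0r addr0 (poly_const_deriv0 P'0) hornerC => <-.
  by rewrite gC ?polyC0 //; exists u.
apply: (@zclosed_segre R p n p_gt0) => g gX.
have [g1 gg1] := poly_fun_comp (poly_fun_peval g) (@poly_map_fst _ tens tens).
have g1C : vanishing_ideal (range conormal_par) g1.
  by move=> _ [v _ <-]; rewrite -gg1 /= gX //; exists (to_vectors v.1.1).
have [P gP _] := has_deriv_peval g1 (velocity_pair (velocity_line x z) (velocityC y)).
by have := gP t; rewrite (flow _ g1 P g1C gP (leqnn _)) horner0 -gg1.
Qed.

(** The points x + t z are in the cone, hence so are z + t x for t nonzero, and z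
    in the limit t = 0. *)
Lemma gradient_segre f y : vanishing_ideal Xd f -> Xd y -> X (gradient f y).
Proof.
rewrite dual_segre // vanishing_zclosure => fXd.
apply: (@zclosure_min _ _ _ (gradient f @^-1` X)).
  move=> _ [u _ <-] /=; rewrite -zclosure_segre // => g gX.
  pose x : tens := rank1 (to_vectors u.1.1); pose z := gradient f (dual_par u).
  have [P gP _] := has_deriv_peval g (velocity_line z x).
  have := gP 0; rewrite scale0r addr0 => ->.
  suff -> : P = 0 by rewrite horner0.
  apply/eqP; apply: contraT => nzP.
  have [|t] := @exists_horner_neq0 K (P * 'X); first by rewrite mulf_neq0 ?polyX_eq0.
  rewrite hornerM hornerX mulf_eq0 negb_or => /andP[nzPt nzt].
  case/eqP: nzPt; rewrite -gP; apply: gX.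
  rewrite (line_rescale z x nzt); apply: (segre_coneZ p_gt0).
  exact: hamiltonian_flow.
apply: zclosed_preimage; first exact: poly_map_gradient.
exact: zclosed_segre.
Qed.

Lemma normal_space_dual y z : Xd y -> normal_space (BW ip) Xd y z -> X z.
Proof.
move=> Xdy yz.
have [v w|a v|v /yz|f fXd fz] := @tangent_annihilator _ _ Xd y (fun v => BW ip v z) => //.
- by rewrite !BW_act stdDl.
- by rewrite !BW_act stdZl.
suff -> : z = gradient f y by apply: gradient_segre.
rewrite -(lowerK ip z) -[RHS](lowerK ip); congr raise; apply/eqP; rewrite -subr_eq0.
apply/eqP/std_eq0 => v; rewrite stdDr stdNr -!BW_act fz BW_gradient.
exact: subrr.
Qed.

End Biduality.

(** * Iterated data loci *)

Section DataLoci.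
Variables (R : realType) (p : nat) (n : 'I_p -> nat) (p_gt0 : (0 < p)%N).
Local Notation K := R[i].
Local Notation tens := (tensor R n).
Local Notation vecs := (vectors R n).
Implicit Types (x w : vecs) (s y z T : tens).
Variable ip : forall i : 'I_p, {dot 'rV[R]_(n i) for idfun}.
Local Notation X := (@segre_cone R p n).
Local Notation Xd := (dual_variety (BW ip) X).

(** The cone is closed, so it is enough to consider normal vectors at regular
    points of the dual variety. If some dimension is 0, all tensors vanish. *)
Lemma conormal_dual_segre y z : conormal (BW ip) Xd (y, z) -> X z.
Proof.
have [n_gt0|] := boolP [forall l, 0 < n l]%N; last first.
  rewrite negb_forall => /existsP[l]; rewrite lt0n negbK => /eqP nl0 _.
  suff -> : z = 0 by apply: segre_cone0.
  by apply/ffunP => a; have := ltn_ord (a l); rewrite [X in (_ < X)%N]nl0.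
move: n_gt0 => /forallP n_gt0 yz.
suff : conormal (BW ip) Xd `<=` [set q : tens * tens | X q.2] by move/(_ _ yz).
apply: zclosure_min => [[y' z'] /= [[Xdy _] nz]|].
  exact: (normal_space_dual p_gt0 n_gt0 Xdy nz).
exact: zclosed_preimage (@poly_map_snd _ _ _) (@zclosed_segre R p n p_gt0).
Qed.

(** The triples in the definition form a closed set already. *)
Lemma joint_ED_conormal y z T : joint_ED (BW ip) X (y, z, T) ->
  conormal (BW ip) Xd (y, z) /\ T = z + y.
Proof.
move=> cl; split.
  have := @zclosure_image _ (tens * tens * tens)%type (tens * tens)%type _ _
    (conormal (BW ip) Xd) (@poly_map_fst _ _ _) _ _ cl.
  by move=> /(_ (fun q H => H.1)); apply: zclosed_zclosure.
have diffP : poly_map (fun q : tens * tens * tens => q.2 - (q.1.2 + q.1.1)).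
  apply: poly_map_additive => [q q'|a q] /=; first by rewrite [X in _ - X]addrACA opprD addrACA.
  by rewrite -!scalerDr -scalerBr.
apply/eqP; rewrite -subr_eq0; apply/eqP/zcoord_inj => j; rewrite zcoord0.
apply: (zclosure_poly_fun (diffP j) _ cl) => q [_ ->].
by rewrite subrr zcoord0.
Qed.

Lemma DL1 : DL ip 1 = X.
Proof. by []. Qed.

Lemma DLS r : DL ip r.+2 = data_locus (BW ip) X (Xd `&` DL ip r.+1).
Proof. by []. Qed.

Lemma data_locus_add (A : set tens) y z :
  conormal (BW ip) Xd (y, z) -> A y -> data_locus (BW ip) X A (z + y).
Proof.
by move=> yz Ay; apply: sub_zclosure; exists y, z; split=> //; apply: sub_zclosure.
Qed.

Lemma data_locus_mono (A B : set tens) :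
  A `<=` B -> data_locus (BW ip) X A `<=` data_locus (BW ip) X B.
Proof. by move=> AB; apply: zclosure_sub => T [y [z [yzT /AB By]]]; exists y, z. Qed.

Lemma normal_pair_dual x y : (forall l, x l != 0) ->
  (forall l (v : 'rV[K]_(n l)), BW ip (rank1 (dfwith x v)) y = 0) ->
  Xd y /\ conormal (BW ip) Xd (y, rank1 x).
Proof.
move=> nzx xy; have xs : normal x (act (gram ip) y) by move=> l v; rewrite -BW_act xy.
have [u uE] := normal_pair_par p_gt0 ip nzx xs; rewrite lowerK in uE.
split; last by have := conormal_dual_par p_gt0 (ip := ip) u; rewrite uE.
rewrite dual_segre //; apply: sub_zclosure; exists u => //.
by rewrite -[RHS]/((rank1 x, y).2) -uE.
Qed.

Lemma DL_mono r : DL ip r.+1 `<=` DL ip r.+2.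
Proof.
elim: r => [|r IHr]; last by rewrite !DLS; apply: data_locus_mono => T [XdT /IHr].
rewrite DL1 DLS DL1 => _ [x ->]; rewrite -[rank1 x]addr0.
pose u := par x (fun=> 0) (0 : tens).
have uE : conormal_par ip u = (rank1 x, 0).
  by rewrite conormal_par_par normal_proj0 raise0.
apply: data_locus_add; first by have := conormal_dual_par p_gt0 (ip := ip) u; rewrite uE.
split; last exact: segre_cone0.
rewrite dual_segre //; apply: sub_zclosure; exists u; first exact: I.
by rewrite -[RHS]/((rank1 x, 0 : tens).2) -uE.
Qed.

Lemma DL_mono_le r1 r2 : (0 < r1)%N -> (r1 <= r2)%N -> DL ip r1 `<=` DL ip r2.
Proof.
move=> r1_gt0 /subnK <-; elim: (r2 - r1)%N => [|k IHk] // T /IHk.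
by rewrite addSn; case: r1 r1_gt0 {IHk} => // r1 _; rewrite addnS; apply: DL_mono.
Qed.

Lemma rank_leD r T x : rank_le r T -> rank_le r.+1 (rank1 x + T).
Proof.
move=> [m le_mr [w ->]]; exists m.+1 => //; exists (fext w x).
rewrite big_fext fext_max addrC; congr (_ + _).
by apply: eq_bigr => k _; rewrite fext_lift.
Qed.

Lemma DL_rank_le r : DL ip r.+1 `<=` zclosure [set T | rank_le r.+1 T].
Proof.
elim: r => [|r IHr].
  rewrite DL1 => _ [x ->]; apply: sub_zclosure; exists 1%N => //; exists (fun=> x).
  by rewrite big_ord1.
rewrite DLS; apply: zclosure_min; last exact: zclosed_zclosure.
move=> T [y [z [/joint_ED_conormal[/conormal_dual_segre[x ->] ->] [_ /IHr yr]]]].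
apply: (zclosure_image (phi := fun y => rank1 x + y) _ _ yr).
  by apply: poly_mapD; [apply: poly_map_cst|apply: poly_map_id].
by move=> y' /= /rank_leD.
Qed.

Lemma BW_sum (I : Type) (r : seq I) (P : pred I) z (F : I -> tens) :
  BW ip z (\sum_(k <- r | P k) F k) = \sum_(k <- r | P k) BW ip z (F k).
Proof.
have BW0 : BW ip z 0 = 0 by rewrite -(scale0r 0) BW_act actZ stdZr mul0r.
apply: (big_morph (BW ip z) _ BW0) => s s'.
by rewrite !BW_act actD stdDr.
Qed.

(** The sum of the first m terms is orthogonal to the tangent space of the cone at
    the last term: replacing one factor of the last term leaves another factor
    that is orthogonal. *)
Lemma odeco_DL : (1 < p)%N -> forall m (x : 'I_m.+1 -> vecs),
  (forall k j, x k j != 0) ->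
  (forall k l j, k != l -> cdot ip (x k j) (x l j) = 0) ->
  DL ip m.+1 (\sum_k rank1 (x k)).
Proof.
move=> p_gt1; elim=> [|m IHm] x nzx ox; first by rewrite DL1 big_ord1; exists (x ord0).
rewrite big_ord_recr /= addrC; set y := \sum_(k < m.+1) _.
have yDL : DL ip m.+1 y.
  by apply: IHm => [k j|k l j kl]; [apply: nzx|apply: ox; rewrite -val_eqE].
have [l v|Xdy con] := @normal_pair_dual (x ord_max) y (nzx _).
  rewrite BW_sum big1 // => k _; rewrite BW_rank1.
  have [j jl] : exists j : 'I_p, j != l.
    have : (0 < #|predC1 l|)%N by rewrite cardC1 card_ord -subn1 subn_gt0.
    by case/card_gt0P => j; exists j.
  rewrite (bigD1 j) //= dfwith_out 1?eq_sym // ox ?mul0r //.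
  by rewrite -val_eqE /= gtn_eqF.
by rewrite DLS; apply: data_locus_add.
Qed.

End DataLoci.

(** * Border rank *)

Module Limit.
Import topology normedtype sequences numFieldNormedType.Exports.

Lemma exists_inv_lt (R : realType) (e : R[i]) :
  0 < e -> exists k : nat, k.+1%:R^-1 < e.
Proof.
move=> e0; have eR : e = (complex.Re e)%:C by rewrite RRe_real // gtr0_real.
move: e0; rewrite eR ltcR => e0.
have [k lt_k] : exists k : nat, (complex.Re e)^-1 < k%:R.
  by exists (Num.bound (complex.Re e)^-1); apply: archi_boundP; rewrite invr_ge0 ltW.
exists k; rewrite -(rmorph_nat (real_complex R)) -fmorphV ltcR.
rewrite -[ltRHS]invrK ltf_pV2 ?posrE ?invr_gt0 //.
by rewrite (lt_trans lt_k) // ltr_nat.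
Qed.

Lemma cvg_inv_dist (R : realType) (u : nat -> R[i]^o) (l : R[i]^o) :
  (forall k, `|u k - l| < k.+1%:R^-1) -> u k @[k --> \oo] --> l.
Proof.
move=> uP; apply/cvgrPdistC_lt => e /exists_inv_lt[N ltN].
exists N => // k /= le_Nk; apply: lt_le_trans (uP k) _; apply: ltW.
by apply: le_lt_trans ltN; rewrite lef_pV2 ?posrE ?ltr0n // ler_nat ltnS.
Qed.

End Limit.

Section BorderRank.
Variables (R : realType) (p : nat) (n : 'I_p -> nat) (p_gt0 : (0 < p)%N).
Local Notation K := R[i].
Local Notation tens := (tensor R n).
Local Notation vecs := (vectors R n).

Definition summands r := {ffun 'I_r -> entries R n}.

HB.instance Definition _ r := Vector.on (summands r).

(** Tensors of rank at most r as the image of one polynomial map, to which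
    [closure_approx] applies. *)
Definition rank_par r (q : summands r) : tens := \sum_k rank1 (to_vectors (q k)).

Lemma poly_map_rank_par r : poly_map (@rank_par r).
Proof.
apply: poly_map_sum => k; apply: poly_map_rank1; apply: poly_fun_to_vectors.
apply: poly_map_additive => [q q'|a q]; exact: ffunE.
Qed.

Lemma rank_le_par r T : rank_le r T -> exists q : summands r, rank_par q = T.
Proof.
case=> m le_mr [x ->].
pose x' (k : nat) : vecs := oapp x (fun=> 0) (insub k).
exists ([ffun k : 'I_r => of_vectors (x' k)] : summands r); rewrite /rank_par.
rewrite (eq_bigr (fun k : 'I_r => rank1 (x' k))); last first.
  by move=> k _; rewrite ffunE of_vectorsK.
rewrite -(big_mkord xpredT (fun k => rank1 (x' k))) (big_cat_nat _ le_mr) //=.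
rewrite big_mkord [X in _ + X]big_nat_cond [X in _ + X]big1 ?addr0.
  by apply: eq_bigr => k _; rewrite /x' valK.
move=> k; rewrite andbT => /andP[le_mk _]; rewrite /x' insubF ?ltnNge ?le_mk //=.
exact: (rank1_eq0 (i := Ordinal p_gt0)).
Qed.

Lemma rank_par_le r (q : summands r) : rank_le r (rank_par q).
Proof. by exists r => //; exists (fun k => to_vectors (q k)). Qed.

Lemma rank_le_approx r T : zclosure [set S : tens | rank_le r S] T ->
  forall e : K, 0 < e -> exists S : tens, rank_le r S /\ forall a, `|S a - T a| < e.
Proof.
move=> clT e e0; have [f fP] := choice (fun i : 'I_#|multi_index n| =>
  poly_map_tens (enum_val i) (@poly_map_rank_par r)).
have spec : specializes f (fun i => T (enum_val i)).
  move=> F F0; pose h (S : tens) := F.@[fun i => S (enum_val i)].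
  have [g gP] := choice (fun i : 'I_#|multi_index n| => @poly_fun_entry R p n (enum_val i)).
  have hP : poly_fun h.
    exists (subst g F) => S; rewrite /peval meval_subst; apply: meval_eq => i.
    exact: gP.
  apply: (zclosure_poly_fun hP _ clT) => S /rank_le_par[q <-].
  have := congr1 (fun G : poly_on (summands r) => peval G q) F0.
  rewrite /peval meval0 meval_subst => <-.
  by apply: meval_eq => i; rewrite -/(peval _ _) -fP.
have [u uP] := closure_approx spec e0.
exists (rank_par (of_coords u : summands r)); split; first exact: rank_par_le.
move=> a; have := uP (enum_rank a); rewrite enum_rankK.
by rewrite -(peval_of_coords (W := summands r)) -fP enum_rankK.
Qed.

Lemma zclosure_border_rank r T :
  zclosure [set S : tens | rank_le r S] T -> border_rank_le r T.
Proof.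
move=> clT; have [k|S SP] := @choice _ _ (fun (k : nat) (S : tens) =>
    rank_le r S /\ forall a, `|S a - T a| < k.+1%:R^-1).
  by apply: rank_le_approx clT _ _; rewrite invr_gt0 ltr0n.
exists S; split=> [k|a]; first by case: (SP k).
by apply: Limit.cvg_inv_dist => k; case: (SP k).
Qed.

End BorderRank.

Theorem proposition4p2 (R : realType) (p : nat) (p_gt0 : (0 < p)%N)
    (n : 'I_p -> nat) (ip : forall i : 'I_p, {dot 'rV[R]_(n i) for idfun})
    (r : nat) (r_gt0 : (1 <= r)%N) :
  [/\ DL ip r `<=` DL ip r.+1,
      forall T : tensor R n, DL ip r T -> border_rank_le r T &
      forall T : tensor R n, weakly_odeco_rank_le ip r T -> DL ip r T].
Proof.
case: r r_gt0 => // r _; split.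
- exact: DL_mono.
- by move=> T /(DL_rank_le p_gt0); apply: zclosure_border_rank.
move=> T [m le_mr [x [x_neq0 x_orth ->]]].
have le1 : DL ip 1 `<=` DL ip r.+1 by apply: DL_mono_le.
case: m => [|m] in x le_mr x_neq0 x_orth *.
  apply: le1; rewrite big_ord0; exact: segre_cone0.
have [p_gt1|p_le1] := ltnP 1 p; last first.
  have p1 : p = 1%N by apply/eqP; rewrite eqn_leq p_le1.
  subst p; apply: le1; exists (fun i => \sum_k x k i).
  apply/ffunP => a; rewrite sum_ffunE ffunE big_ord1 summxE.
  by apply: eq_bigr => k _; rewrite ffunE big_ord1.
by apply: (@DL_mono_le _ _ _ _ _ m.+1) => //; apply: odeco_DL.
Qed.
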